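(* Let $h:[1,+\infty)\to[1,+\infty)$ be a function such that $\lim_{x\to\infty}h(x)=+\infty$. Let $E$ be a closed subset of $\mathbb{T}$ such that $\mathrm{cap}(E)=0$. Then there is $\varphi\in A(\mathbb{D})\cap\mathcal{D}$, $\varphi(\mathbb{D})\subset\mathbb{D}$, such that: (1) $E_\varphi(1)=E$; (2) $C_\varphi$ is in the Hilbert–Schmidt class in $\mathcal{D}$; (3) $\displaystyle\int^1\frac{\mathrm{cap}(E_\varphi(s))}{1-s}\,\log\frac{1}{1-s}\;h\!\left(\frac{1}{1-s}\right)ds=+\infty$.
   Context: $\mathbb{D}$ is the open unit disc in $\mathbb{C}$, $\mathbb{T}=\partial\mathbb{D}$, and $A(\mathbb{D})$ is the disc algebra (functions holomorphic on $\mathbb{D}$ and continuous on $\overline{\mathbb{D}}$). The Dirichlet space $\mathcal{D}$ consists of the holomorphic functions $f$ on $\mathbb{D}$ with $\mathcal{D}(f)=\int_{\mathbb{D}}|f'(z)|^2\,dA(z)<\infty$, where $dA=dx\,dy/\pi$, with norm $\|f\|_{\mathcal{D}}^2=|f(0)|^2+\mathcal{D}(f)$. The composition operator is $C_\varphi(f)=f\circ\varphi$, $f\in\mathcal{D}$. For $0<s\le1$, the level set is $E_\varphi(s)=\{\zeta\in\mathbb{T}:|\varphi(\zeta)|\ge s\}$. In (3), the omitted lower limit means that the integral diverges at the endpoint $s=1$. For a Borel probability measure $\mu$ on $\mathbb{T}$ with Fourier coefficients $\widehat{\mu}(n)$, let $I_0(\mu)=\sum_{n=1}^\infty\frac{|\widehat{\mu}(n)|^2}{n}$.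 For a closed set $F\subset\mathbb{T}$, the logarithmic capacity is $\mathrm{cap}(F)=1/\inf\{I_0(\mu):\mu\text{ is a probability measure on }F\}$.
   Formalization: The closed set E is assumed nonempty: for E empty one has cap(E)=0, but (1) gives |φ|<1 on T, so by compactness the level sets are empty for s near 1 and the integral in (3) cannot diverge. *)

(* Defs.v *)
From HB Require Import structures.
From mathcomp Require Import all_boot all_order all_algebra.
From mathcomp Require Import complex.
From mathcomp Require Import all_classical all_reals all_analysis.

Set Implicit Arguments.
Unset Strict Implicit.
Unset Printing Implicit Defensive.

Import Order.TTheory GRing.Theory Num.Theory.
Import numFieldNormedType.Exports.

Local Open Scope classical_set_scope.
Local Open Scope ring_scope.

(* R[i] packed as a numClosedFieldType, so that it inherits the topology and
   the normed space structure (over itself) of every numClosedFieldType. The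
   norm `|z| takes its values in the complex numbers; normc z is the same
   modulus as an element of R. *)
Definition Cplx (R : realType) : numClosedFieldType := R[i].

Section Dirichlet.
Context {R : realType}.
Local Notation C := (Cplx R).
Local Notation lebesgue2 := (@lebesgue_measure R \x @lebesgue_measure R)%E.

Definition cre (z : C) : R := complex.Re z.
Definition cim (z : C) : R := complex.Im z.
Definition modulus (z : C) : R := Normc.normc z.

Definition disc : set C := [set z | modulus z < 1].
Definition closed_disc : set C := [set z | modulus z <= 1].
Definition circle : set C := [set z | modulus z = 1].

Definition cintegral d (T : measurableType d)
    (mu : {measure set T -> \bar R}) (A : set T) (f : T -> C) : C :=
  Complex (\int[mu]_(x in A) cre (f x)) (\int[mu]_(x in A) cim (f x)).

Definition plane (p : R * R) : C := Complex p.1 p.2.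

(* Functions on the disc are total functions C -> C of which only the values on
   the disc (on the closed disc, for the disc algebra) matter. Since the disc is
   open, derivable f z 1 and derive1 f z only depend on f near z. *)
Definition holomorphic (f : C -> C) : Prop :=
  forall z, disc z -> derivable f z 1.

Definition disc_algebra (f : C -> C) : Prop :=
  holomorphic f /\ {within closed_disc, continuous f}.

Definition dirichlet_integral (f : C -> C) : \bar R :=
  ((pi^-1)%:E *
   \int[lebesgue2]_(p in plane @^-1` disc) (modulus (derive1 f (plane p)) ^+ 2)%:E)%E.

Definition dirichlet_space : set (C -> C) :=
  [set f | holomorphic f /\ (dirichlet_integral f < +oo)%E].

Definition dirichlet_normsq (f : C -> C) : \bar R :=
  ((modulus (f 0) ^+ 2)%:E + dirichlet_integral f)%E.

Definition dirichlet_inner (f g : C -> C) : C :=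
  f 0 * (g 0)^* +
  Complex pi^-1 0 * cintegral lebesgue2 (plane @^-1` disc)
    (fun p => derive1 f (plane p) * (derive1 g (plane p))^*).

Definition bounded_operator (T : (C -> C) -> (C -> C)) : Prop :=
  [/\ forall f, dirichlet_space f -> dirichlet_space (T f),
      forall (a : C) f g, dirichlet_space f -> dirichlet_space g ->
        forall z, disc z ->
          T (fun w => a * f w + g w) z = a * T f z + T g z
    & exists M : R, forall f, dirichlet_space f ->
        (dirichlet_normsq (T f) <= M%:E * dirichlet_normsq f)%E].

Definition orthonormal_basis (e : nat -> C -> C) : Prop :=
  [/\ forall n, dirichlet_space (e n),
      forall m n, dirichlet_inner (e m) (e n) = (m == n)%:R
    & forall f, dirichlet_space f ->
        (forall n, dirichlet_inner f (e n) = 0) ->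
        forall z, disc z -> f z = 0].

(* The sum does not depend on the orthonormal basis. *)
Definition hilbert_schmidt (T : (C -> C) -> (C -> C)) : Prop :=
  bounded_operator T /\
  exists2 e, orthonormal_basis e &
    (\sum_(0 <= n <oo) dirichlet_normsq (T (e n)) < +oo)%E.

Definition composition_operator (phi f : C -> C) : C -> C := f \o phi.

Definition borelC := g_sigma_algebraType (@open C).

Definition fourier (mu : probability borelC R) (n : nat) : C :=
  cintegral mu circle (fun z => (z : C)^* ^+ n).

Definition energy (mu : probability borelC R) : \bar R :=
  (\sum_(1 <= n <oo) (modulus (fourier mu n) ^+ 2 / n%:R)%:E)%E.

(* For a closed subset F of the circle, the Borel probability measures on F are
   the Borel probability measures mu on the plane such that mu F = 1. Here
   0^-1 = +oo and +oo^-1 = 0 in \bar R. *)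
Definition capacity (F : set C) : \bar R :=
  (ereal_inf [set energy mu | mu in
     [set mu : probability borelC R | mu F = 1%E]])^-1%E.

Definition level_set (phi : C -> C) (s : R) : set C :=
  [set z | circle z /\ s <= modulus (phi z)].

End Dirichlet.

(* Main.v *)
Require Import Defs.
From HB Require Import structures.
From mathcomp Require Import all_boot all_order all_algebra.
From mathcomp Require Import complex ring lra.
From mathcomp Require Import all_classical all_reals all_analysis measurable_realfun.
Import Order.TTheory GRing.Theory Num.Theory.
Import numFieldNormedType.Exports.
Local Open Scope classical_set_scope.
Local Open Scope ring_scope.
Set Implicit Arguments.
Unset Strict Implicit.
Unset Printing Implicit Defensive.

(** A closed set of capacity zero carries no measure of finite logarithmic energy.
    Among all choices of [N] points, repetitions allowed, on the grid of [N]-th roots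
    of unity close to [E], take one of minimal energy, the energy being truncated at
    frequency [N]. As [N] grows these energies [Q] are unbounded ([energy_unbounded]):
    otherwise a limit of the configurations would be a measure of finite energy on [E]
    ([energy_tight]). The polynomial [f] whose real part is the truncated logarithmic
    potential of a minimal configuration has three properties ([block]). By Fekete's
    variational argument ([fekete]), [Re f >= Q - 20] near all of [E], and also on a
    union of arcs that carries a probability measure of energy at most [6 Q]. The
    logarithmic kernel has bounded imaginary part and is bounded below, so that
    [|Im f| <= 3] and [Re f >= -3] on the closed disc. Finally the Dirichlet integral
    of [f] is proportional to [Q] ([pot_area]).

    Choose such polynomials [f k], with configurations tending to [E] and energies
    [Q k] growing as fast as desired, and let [F], called [log_outer] below, be the
    sum of the series [b k * f k] with weights [b k = 2^-k / (6 sqrt (Q k))]. Then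
    [b k ^ 2 * Q k] is summable with geometric weights to spare, which makes the
    Dirichlet integral of [F] finite, whereas
    [b k * Q k] tends to infinity, so that [Re F] tends to infinity at [E]; elsewhere
    on the closed disc [F] is continuous. Let [phi] be the Cayley transform of [exp F],
    with the value 1 on [E]. Since [|Im F| <= 1], [exp F] takes its values in a sector
    inside the right half plane. Hence [phi] maps the disc into itself, belongs to the
    disc algebra, and reaches modulus 1 exactly on [E]. The same bound gives
    [|phi'| / (1 - |phi|^2) <= |F'|] ([phi_hyperbolic]). So the hyperbolic area of the
    image, with multiplicity, is finite, and this is the Hilbert-Schmidt criterion:
    the sum of [n |phi|^(2n-2) |phi'|^2] over [n] is at most
    [|phi'|^2 / (1 - |phi|^2)^2] ([composition_hilbert_schmidt]).

    On the arcs of the [k]-th block [|phi| >= 1 - 2 exp (- T)] with [T = b k * Q k - 5].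
    Hence the level sets at heights up to [1 - 2 exp (- T)] have capacity at least
    [1 / (6 Q k)], and the part of the integral with
    [exp (- T) <= (1 - s) / 2 <= exp (- T / 2)] is at least a constant times
    [T^2 / Q k], of the order of [4^-k], times the smallest value of [h] at
    [1 / (1 - s)] there. As [h] tends to infinity, [Q k] can be chosen so large that
    this exceeds [k] ([capacity_integral_ge], [block_contribution]).

    The complex analysis this needs is derived from Goursat's theorem. Along a period
    strip of the exponential map it shows that circle integrals of holomorphic
    functions do not depend on the radius ([circint_radius]), which yields the mean
    value property, Cauchy's estimate and the holomorphy of derivatives. Averages over
    rotations of the plane, obtained as products of shears, give the subharmonicity of
    [|g|^2] ([area_mean_ge]), the orthogonality of the monomials and their completeness
    ([bergman_complete]), and thereby an orthonormal basis of the Dirichlet space. *)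

(** * Complex arithmetic in real coordinates *)

Section ComplexBasics.
Context {R : realType}.
Local Notation C := (Cplx R).
Implicit Types (x y z w h : C) (f g : C -> C).

Definition RtoC (a : R) : C := Complex a 0.

Lemma C_ext x y : cre x = cre y -> cim x = cim y -> x = y.
Proof. by case: x => a b; case: y => c d /= -> ->. Qed.

Lemma creD x y : cre (x + y) = cre x + cre y. Proof. by case: x; case: y. Qed.
Lemma cimD x y : cim (x + y) = cim x + cim y. Proof. by case: x; case: y. Qed.
Lemma creN x : cre (- x) = - cre x. Proof. by case: x. Qed.
Lemma cimN x : cim (- x) = - cim x. Proof. by case: x. Qed.
Lemma creB x y : cre (x - y) = cre x - cre y. Proof. by rewrite creD creN. Qed.
Lemma cimB x y : cim (x - y) = cim x - cim y. Proof. by rewrite cimD cimN. Qed.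
Lemma creM x y : cre (x * y) = cre x * cre y - cim x * cim y.
Proof. by case: x; case: y. Qed.
Lemma cimM x y : cim (x * y) = cre x * cim y + cim x * cre y.
Proof. by case: x => a b; case: y => c d. Qed.
Lemma creC x : cre x^* = cre x. Proof. by case: x. Qed.
Lemma cimC x : cim x^* = - cim x. Proof. by case: x. Qed.
Lemma cre0 : cre (0 : C) = 0. Proof. by []. Qed.
Lemma cim0 : cim (0 : C) = 0. Proof. by []. Qed.
Lemma cre1 : cre (1 : C) = 1. Proof. by []. Qed.
Lemma cim1 : cim (1 : C) = 0. Proof. by []. Qed.
Lemma creR a : cre (RtoC a) = a. Proof. by []. Qed.
Lemma cimR a : cim (RtoC a) = 0. Proof. by []. Qed.

Definition cE := (creD, cimD, creN, cimN, creM, cimM, creC, cimC, cre0, cim0,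
  cre1, cim1, creR, cimR).

Lemma RtoC1 : RtoC 1 = 1. Proof. exact: C_ext. Qed.
Lemma RtoC0 : RtoC 0 = 0. Proof. exact: C_ext. Qed.
Lemma RtoCD a b : RtoC (a + b) = RtoC a + RtoC b.
Proof. by apply: C_ext; rewrite !cE ?addr0. Qed.
Lemma RtoCM a b : RtoC (a * b) = RtoC a * RtoC b.
Proof. by apply: C_ext; rewrite !cE; ring. Qed.
Lemma RtoCX a n : RtoC (a ^+ n) = RtoC a ^+ n.
Proof. by elim: n => [|n IH]; rewrite ?expr0 ?RtoC1// !exprS RtoCM IH. Qed.
Lemma RtoC_nat n : RtoC n%:R = n%:R.
Proof. by elim: n => [|n IH]; rewrite ?RtoC0// !mulrS RtoCD IH RtoC1. Qed.
Lemma creZ a x : cre (RtoC a * x) = a * cre x. Proof. by rewrite !cE mul0r subr0. Qed.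
Lemma cimZ a x : cim (RtoC a * x) = a * cim x. Proof. by rewrite !cE mul0r addr0. Qed.

Lemma cre_sum (I : Type) (r : seq I) (P : pred I) (F : I -> C) :
  cre (\sum_(i <- r | P i) F i) = \sum_(i <- r | P i) cre (F i).
Proof. exact: (big_morph cre creD cre0). Qed.
Lemma cim_sum (I : Type) (r : seq I) (P : pred I) (F : I -> C) :
  cim (\sum_(i <- r | P i) F i) = \sum_(i <- r | P i) cim (F i).
Proof. exact: (big_morph cim cimD cim0). Qed.

Lemma modulusE x : modulus x = Num.sqrt (cre x ^+ 2 + cim x ^+ 2).
Proof. by case: x. Qed.
Lemma modulus_sqr x : modulus x ^+ 2 = cre x ^+ 2 + cim x ^+ 2.
Proof. by rewrite modulusE sqr_sqrtr// addr_ge0// sqr_ge0. Qed.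
Lemma modulus_ge0 x : 0 <= modulus x.
Proof. by rewrite modulusE sqrtr_ge0. Qed.
Lemma modulusM x y : modulus (x * y) = modulus x * modulus y.
Proof. exact: Normc.normcM. Qed.
Lemma modulusD x y : modulus (x + y) <= modulus x + modulus y.
Proof. exact: le_normcD. Qed.
Lemma modulusN x : modulus (- x) = modulus x.
Proof. exact: normcN. Qed.
Lemma modulusB x y : modulus (x - y) <= modulus x + modulus y.
Proof. by rewrite -(modulusN y) modulusD. Qed.
Lemma modulus_distC x y : modulus (x - y) = modulus (y - x).
Proof. by rewrite -modulusN opprB. Qed.
Lemma modulus0 : modulus (0 : C) = 0. Proof. exact: Normc.normc0. Qed.
Lemma modulus1 : modulus (1 : C) = 1. Proof. exact: Normc.normc1. Qed.
Lemma modulus_eq0 x : (modulus x == 0) = (x == 0).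
Proof. by apply/eqP/eqP => [/Normc.eq0_normc//|->]; rewrite modulus0. Qed.
Lemma modulus_gt0 x : (0 < modulus x) = (x != 0).
Proof. by rewrite lt_def modulus_ge0 modulus_eq0 andbT. Qed.
Lemma modulusX x n : modulus (x ^+ n) = modulus x ^+ n.
Proof. by elim: n => [|n IH]; rewrite ?expr0 ?modulus1// !exprS modulusM IH. Qed.
Lemma modulusV x : modulus x^-1 = (modulus x)^-1.
Proof. exact: Normc.normcV. Qed.
Lemma modulusR a : modulus (RtoC a) = `|a|.
Proof. by rewrite modulusE !cE expr0n addr0 sqrtr_sqr. Qed.
Lemma modulusC x : modulus x^* = modulus x.
Proof. by rewrite !modulusE !cE sqrrN. Qed.
Lemma modulus_nat n : modulus (n%:R : C) = n%:R.
Proof. by rewrite -RtoC_nat modulusR ger0_norm. Qed.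
Lemma cre_le_modulus x : `|cre x| <= modulus x.
Proof. by rewrite modulusE -sqrtr_sqr ler_wsqrtr// lerDl sqr_ge0. Qed.
Lemma cim_le_modulus x : `|cim x| <= modulus x.
Proof. by rewrite modulusE -sqrtr_sqr ler_wsqrtr// lerDr sqr_ge0. Qed.
Lemma modulus_le x : modulus x <= `|cre x| + `|cim x|.
Proof.
rewrite -ler_sqr ?nnegrE ?modulus_ge0 ?addr_ge0// modulus_sqr.
rewrite -(real_normK (num_real (cre x))) -(real_normK (num_real (cim x))).
by rewrite sqrrD lerD2r lerDl mulrn_wge0// mulr_ge0.
Qed.
Lemma modulus_sum (I : Type) (r : seq I) (P : pred I) (F : I -> C) :
  modulus (\sum_(i <- r | P i) F i) <= \sum_(i <- r | P i) modulus (F i).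
Proof.
elim/big_rec2 : _ => [|i a b _ IH]; first by rewrite modulus0.
by rewrite (le_trans (modulusD _ _))// lerD2l.
Qed.
Lemma modulus_triangle x y z : modulus (x - z) <= modulus (x - y) + modulus (y - z).
Proof. by rewrite (le_trans _ (modulusD _ _))// addrA subrK. Qed.
Lemma modulus_rev x y : modulus x - modulus y <= modulus (x - y).
Proof. by rewrite lerBlDr -{1}(subrK y x) modulusD. Qed.
Lemma mulC_conj x : x * x^* = RtoC (modulus x ^+ 2).
Proof. by apply: C_ext; rewrite !cE ?modulus_sqr; ring. Qed.
Lemma conjCD x y : (x + y)^* = x^* + y^*. Proof. exact: rmorphD. Qed.
Lemma conjCM x y : (x * y)^* = x^* * y^*. Proof. exact: rmorphM. Qed.
Lemma conjCX x n : (x ^+ n)^* = x^* ^+ n. Proof. exact: rmorphXn. Qed.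

Lemma norm_C x : `|x| = RtoC (modulus x). Proof. by []. Qed.
Lemma RtoC_lt (a b : R) : (RtoC a < RtoC b) = (a < b).
Proof. by rewrite ltcE /= eqxx. Qed.
Lemma gt0_CE x : 0 < x -> x = RtoC (cre x) /\ 0 < cre x.
Proof. by case: x => a b; rewrite ltcE/= => /andP[/eqP -> a0]. Qed.

Lemma nbhsCP z (A : set C) :
  nbhs z A <-> exists2 e : R, 0 < e & forall w, modulus (w - z) < e -> A w.
Proof.
split.
  move=> /nbhs_ballP[e /= /gt0_CE[-> e0] eA]; exists (cre e) => // w we.
  apply: eA; rewrite -ball_normE /ball_/= norm_C RtoC_lt.
  by rewrite modulus_distC.
move=> [e e0 eA]; apply/nbhs_ballP; exists (RtoC e) => /=.
  by rewrite -RtoC0 RtoC_lt.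
move=> w; rewrite -ball_normE /ball_/= norm_C RtoC_lt => we.
by apply: eA; rewrite modulus_distC.
Qed.

(** Complex differentiability with an explicit error term; it is equivalent to
    [derivable f z 1] and lets every estimate be made in [R]. *)
Definition cderiv f z (d : C) := forall e : R, 0 < e -> exists2 del : R, 0 < del &
  forall h, modulus h < del -> modulus (f (z + h) - f z - d * h) <= e * modulus h.

Definition ccont f z := forall e : R, 0 < e -> exists2 del : R, 0 < del &
  forall w, modulus (w - z) < del -> modulus (f w - f z) < e.

Lemma cvg_dnbhs_C (F : C -> C) (l : C) : F h @[h --> 0^'] --> l <->
  forall e : R, 0 < e -> exists2 del : R, 0 < del &
    forall h, h != 0 -> modulus h < del -> modulus (F h - l) < e.
Proof.
split=> [Fl e e0|H].
  have : nbhs l [set w : C | modulus (w - l) < e] by apply/nbhsCP; exists e.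
  move=> /Fl /nbhsCP[del del0 D]; exists del => // h h0 hd.
  by apply: D => //; rewrite subr0.
move=> A /nbhsCP[e e0 eA]; have [del del0 D] := H _ e0.
apply/nbhsCP; exists del => // w; rewrite subr0 => wd w0.
by apply: eA; exact: D.
Qed.

Lemma cderiv_cvg f z d : cderiv f z d ->
  h^-1 *: ((f \o shift z) (h *: 1) - f z) @[h --> 0^'] --> (d : C).
Proof.
move=> H; apply/cvg_dnbhs_C => e e0.
have [del del0 D] := H (e / 2) (divr_gt0 e0 (ltr0n _ 2)).
exists del => // h h0 /D hd /=.
have -> : h^-1 *: (f (h *: 1 + z) - f z) - d = h^-1 * (f (z + h) - f z - d * h).
  rewrite /GRing.scale/= mulr1 (addrC h) (mulrBr _ _ (d * h)); congr (_ - _).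
  by rewrite mulrCA mulVf// mulr1.
rewrite modulusM modulusV mulrC ltr_pdivrMr ?modulus_gt0//.
rewrite (le_lt_trans hd)// ltr_pM2r ?modulus_gt0//.
by rewrite ltr_pdivrMr// mulr_natr mulr2n ltrDl.
Qed.

Lemma cvg_cderiv f z (d : C) :
  h^-1 *: ((f \o shift z) (h *: 1) - f z) @[h --> 0^'] --> d -> cderiv f z d.
Proof.
move=> /cvg_dnbhs_C H e /H[del del0 D]; exists del => // h hd.
have [->|h0] := eqVneq h 0.
  by rewrite addr0 mulr0 subrr subr0 modulus0 mulr0.
have /ltW := D _ h0 hd => /=.
have -> : h^-1 *: (f (h *: 1 + z) - f z) - d = h^-1 * (f (z + h) - f z - d * h).
  rewrite /GRing.scale/= mulr1 (addrC h) (mulrBr _ _ (d * h)); congr (_ - _).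
  by rewrite mulrCA mulVf// mulr1.
by rewrite modulusM modulusV mulrC ler_pdivrMr ?modulus_gt0.
Qed.

Lemma cderiv_derivable f z d : cderiv f z d -> derivable f z 1.
Proof. by move=> /cderiv_cvg H; apply/cvg_ex; exists d. Qed.

Lemma derivable_cderiv f z : derivable f z 1 -> cderiv f z (derive1 f z).
Proof. by move=> H; apply: cvg_cderiv; rewrite derive1E. Qed.

Lemma cderiv_derive1 f z d : cderiv f z d -> derive1 f z = d.
Proof. by move=> /cderiv_cvg H; rewrite derive1E; exact: (cvg_lim _ H). Qed.

Lemma cderiv_ccont f z d : cderiv f z d -> ccont f z.
Proof.
move=> /(_ 1 ltr01)[del del0 D] e e0.
have M0 : 0 < 2 + modulus d by have := modulus_ge0 d; lra.
exists (Num.min del (e / (2 + modulus d))).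
  by rewrite lt_min del0 divr_gt0.
move=> w; rewrite lt_min => /andP[wd we].
have := D _ wd; rewrite [z + _]addrC subrK mul1r => h1.
have : modulus (f w - f z) <= modulus (w - z) + modulus d * modulus (w - z).
  rewrite -(subrK (d * (w - z)) (f w - f z)) -modulusM.
  by rewrite (le_trans (modulusD _ _))// lerD2r.
move: we; rewrite ltr_pdivlMr//; have := modulus_ge0 (w - z).
by have := modulus_ge0 d; nra.
Qed.

Lemma cderiv_ext f g z d (del : R) : 0 < del ->
  (forall w, modulus (w - z) < del -> f w = g w) -> cderiv f z d -> cderiv g z d.
Proof.
move=> d0 fg H e /H[del' d0' D]; exists (Num.min del del').
  by rewrite lt_min d0.
move=> h; rewrite lt_min => /andP[h1 h2].
by rewrite -!fg ?D// ?subrr ?modulus0// addrC addKr.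
Qed.

Lemma cderiv_cst (a : C) z : cderiv (fun=> a) z 0.
Proof.
move=> e e0; exists 1 => // h _.
by rewrite mul0r subrr subr0 modulus0 mulr_ge0 ?modulus_ge0// ltW.
Qed.

Lemma cderiv_id z : cderiv id z 1.
Proof.
move=> e e0; exists 1 => // h _.
by rewrite mul1r (addrC z) addrK subrr modulus0 mulr_ge0 ?modulus_ge0// ltW.
Qed.

Lemma cderivD f g z a b : cderiv f z a -> cderiv g z b ->
  cderiv (fun w => f w + g w) z (a + b).
Proof.
move=> F G e e0; have e20 : 0 < e / 2 by lra.
have [d1 d10 D1] := F _ e20; have [d2 d20 D2] := G _ e20.
exists (Num.min d1 d2); first by rewrite lt_min d10.
move=> h; rewrite lt_min => /andP[/D1 h1 /D2 h2].
have -> : f (z + h) + g (z + h) - (f z + g z) - (a + b) * h =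
  (f (z + h) - f z - a * h) + (g (z + h) - g z - b * h) by ring.
rewrite (le_trans (modulusD _ _))// (le_trans (lerD h1 h2))//.
by rewrite -mulrDl -splitr.
Qed.

Lemma cderiv_comp f g z a b : cderiv g z b -> cderiv f (g z) a ->
  cderiv (fun w => f (g w)) z (a * b).
Proof.
move=> G F e e0.
set A := modulus a; set B := modulus b.
have A0 : 0 <= A := modulus_ge0 a; have B0 : 0 <= B := modulus_ge0 b.
have e1 : 0 < e / (2 * (B + 1)) by apply: divr_gt0 => //; lra.
have [d1 d10 D1] := F _ e1.
have m0 : 0 < Num.min 1 (e / (2 * (A + 1))).
  by rewrite lt_min ltr01/= divr_gt0//; lra.
have [d2 d20 D2] := G _ m0.
exists (Num.min d2 (d1 / (B + 1))).
  by rewrite lt_min d20 divr_gt0//; lra.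
move=> h; rewrite lt_min => /andP[/D2 h2]; rewrite ltr_pdivlMr; last lra.
move=> h1; set k := g (z + h) - g z.
have H0 := modulus_ge0 h.
have [hA hB] : modulus (k - b * h) <= modulus h /\
   modulus (k - b * h) <= e / (2 * (A + 1)) * modulus h.
  split; apply: (le_trans h2); last by rewrite ler_wpM2r// ge_min lexx orbT.
  by rewrite -[leRHS]mul1r ler_wpM2r// ge_min lexx.
have kb : modulus k <= (B + 1) * modulus h.
  rewrite -(subrK (b * h) k) (le_trans (modulusD _ _))// modulusM -/B; lra.
have /D1 : modulus k < d1 by rewrite (le_lt_trans kb)// mulrC.
rewrite /k (addrC (g z)) subrK -/k => h3.
have -> : f (g (z + h)) - f (g z) - a * b * h =
  (f (g (z + h)) - f (g z) - a * k) + a * (k - b * h) by rewrite /k; ring.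
rewrite (le_trans (modulusD _ _))// modulusM -/A.
have h4 : e / (2 * (B + 1)) * modulus k <= e / 2 * modulus h.
  apply: (@le_trans _ _ (e / (2 * (B + 1)) * ((B + 1) * modulus h))).
    by rewrite ler_wpM2l// ltW.
  rewrite le_eqVlt; apply/orP; left; apply/eqP; field; lra.
have h5 : A * modulus (k - b * h) <= e / 2 * modulus h.
  apply: (@le_trans _ _ (A * (e / (2 * (A + 1)) * modulus h))).
    by rewrite ler_wpM2l.
  have -> : A * (e / (2 * (A + 1)) * modulus h) = (A / (A + 1)) * (e / 2 * modulus h).
    by field; lra.
  rewrite -[leRHS]mul1r ler_wpM2r ?mulr_ge0//; first lra.
  by rewrite ler_pdivrMr; lra.
lra.
Qed.

Lemma cderivM f g z a b : cderiv f z a -> cderiv g z b ->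
  cderiv (fun w => f w * g w) z (a * g z + f z * b).
Proof.
move=> F G e e0.
have Gc := cderiv_ccont G.
set A := modulus a; set M := modulus (f z); set N := modulus (g z).
have A0 : 0 <= A := modulus_ge0 a; have M0 : 0 <= M := modulus_ge0 (f z).
have N0 : 0 <= N := modulus_ge0 (g z).
have e1 : 0 < e / (3 * (N + 1)) by apply: divr_gt0 => //; lra.
have e2 : 0 < Num.min 1 (e / (3 * (A + 1))).
  by rewrite lt_min ltr01/= divr_gt0//; lra.
have e3 : 0 < e / (3 * (M + 1)) by apply: divr_gt0 => //; lra.
have [d1 d10 D1] := F _ e1; have [d2 d20 D2] := Gc _ e2; have [d3 d30 D3] := G _ e3.
exists (Num.min d1 (Num.min d2 d3)); first by rewrite !lt_min d10 d20.
move=> h; rewrite !lt_min => /and3P[/D1 h1 h2 /D3 h3].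
have {h2} : modulus (g (z + h) - g z) < Num.min 1 (e / (3 * (A + 1))).
  by apply: D2; rewrite addrC addKr.
rewrite lt_min => /andP[h21 h22].
have H0 := modulus_ge0 h.
have -> : f (z + h) * g (z + h) - f z * g z - (a * g z + f z * b) * h =
  (f (z + h) - f z - a * h) * g (z + h) + a * h * (g (z + h) - g z) +
  f z * (g (z + h) - g z - b * h) by ring.
rewrite (le_trans (modulusD _ _))//.
have t3 : modulus (f z * (g (z + h) - g z - b * h)) <= e / 3 * modulus h.
  rewrite modulusM -/M (@le_trans _ _ (M * (e / (3 * (M + 1)) * modulus h)))//.
    by rewrite ler_wpM2l.
  have -> : M * (e / (3 * (M + 1)) * modulus h) = (M / (M + 1)) * (e / 3 * modulus h).
    by field; lra.
  rewrite -[leRHS]mul1r ler_wpM2r ?mulr_ge0//; first lra.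
  by rewrite ler_pdivrMr; lra.
have t2 : modulus (a * h * (g (z + h) - g z)) <= e / 3 * modulus h.
  rewrite 2!modulusM -/A.
  have -> : e / 3 * modulus h = (A + 1) * modulus h * (e / (3 * (A + 1))).
    by field; lra.
  by apply: ler_pM; rewrite ?mulr_ge0 ?modulus_ge0//; [nra|lra].
have t1 : modulus ((f (z + h) - f z - a * h) * g (z + h)) <= e / 3 * modulus h.
  rewrite modulusM.
  have gN : modulus (g (z + h)) <= N + 1.
    by have := modulus_rev (g (z + h)) (g z); rewrite -/N; lra.
  have -> : e / 3 * modulus h = (e / (3 * (N + 1)) * modulus h) * (N + 1).
    by field; lra.
  by apply: ler_pM; rewrite ?modulus_ge0.
have := modulusD ((f (z + h) - f z - a * h) * g (z + h)) (a * h * (g (z + h) - g z)).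
lra.
Qed.

Lemma cderivV z : z != 0 -> cderiv GRing.inv z (- (z ^- 2)).
Proof.
move=> z0 e e0; have Z0 : 0 < modulus z by rewrite modulus_gt0.
set r := modulus z in Z0 *.
exists (Num.min (r / 2) (e * r ^+ 3 / 2)).
  by rewrite lt_min divr_gt0//= divr_gt0// mulr_gt0// exprn_gt0.
move=> h; rewrite lt_min => /andP[h1 h2].
have zh : r / 2 <= modulus (z + h).
  have := modulus_rev z (- h); rewrite modulusN opprK -/r; lra.
have zh0 : z + h != 0 by rewrite -modulus_gt0; lra.
have -> : (z + h)^-1 - z^-1 - - z ^- 2 * h = h ^+ 2 * ((z + h)^-1 * z ^- 2).
  by field; rewrite zh0 z0.
have -> : modulus (h ^+ 2 * ((z + h)^-1 * z ^- 2)) =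
    modulus h ^+ 2 * ((modulus (z + h))^-1 * r ^- 2).
  by rewrite modulusM modulusX modulusM !modulusV modulusX.
rewrite expr2.
have H0 := modulus_ge0 h.
rewrite mulrAC ler_wpM2r//.
apply: (@le_trans _ _ (modulus h * ((r / 2)^-1 * r ^- 2))).
  rewrite ler_wpM2l//; apply: ler_wpM2r; first by rewrite invr_ge0 exprn_ge0// ltW.
  by rewrite lef_pV2 ?posrE; lra.
have -> : modulus h * ((r / 2)^-1 * r ^- 2) = modulus h / (r ^+ 3 / 2).
  by field; lra.
by rewrite ler_pdivrMr ?divr_gt0 ?exprn_gt0// mulrA ltW.
Qed.

Lemma cderivZ (a : C) f z d : cderiv f z d -> cderiv (fun w => a * f w) z (a * d).
Proof.
move=> F; have := cderivM (cderiv_cst a z) F.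
by rewrite mul0r add0r.
Qed.

Lemma cderivX z n : cderiv (fun w => w ^+ n) z (n%:R * z ^+ n.-1).
Proof.
elim: n => [|n IH]; first by rewrite mul0r; exact: cderiv_cst.
have := cderivM (cderiv_id z) IH; rewrite mul1r /=.
have -> : z ^+ n + z * (n%:R * z ^+ n.-1) = n.+1%:R * z ^+ n.
  by case: n {IH} => [|n]; rewrite ?mul0r ?mulr0 ?addr0 ?mul1r// mulrSr exprS/=; ring.
by under eq_fun do rewrite -exprS.
Qed.

End ComplexBasics.

(** * Circulations and Goursat's theorem *)

Section RealCalculus.
Context {R : realType}.
Local Notation mu := (@lebesgue_measure R).
Implicit Types (u v : R -> R) (a b c d x y t : R).

Definition RI a b u : R := \int[mu]_(t in `[a, b]) u t.

(** Two-sided continuity also at the end points: the functions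
    integrated below are continuous across them, so that no one-sided limit occurs. *)
Definition cont_on a b u := forall x, a <= x <= b -> {for x, continuous u}.

Lemma cont_on_integrable a b u : cont_on a b u -> mu.-integrable `[a, b] (EFin \o u).
Proof.
move=> H; apply: continuous_compact_integrable; first exact: segment_compact.
apply: continuous_in_subspaceT => x; rewrite inE/= in_itv/=; exact: H.
Qed.

Lemma cont_onS a b c d u : a <= c -> d <= b -> cont_on a b u -> cont_on c d u.
Proof. by move=> ac db H x /andP[cx xd]; apply: H; lra. Qed.

Lemma continuous_cont_on a b u : continuous u -> cont_on a b u.
Proof. by move=> H x _; exact: H. Qed.

Lemma RI_split a m b u : cont_on a b u -> a <= m <= b ->
  RI a b u = RI a m u + RI m b u.
Proof.
move=> H /andP[am mb]; rewrite /RI -(@Rintegral_itv_obnd_cbnd _ m).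
  rewrite -(@Rintegral_itvB _ _ (BLeft a) (BRight b)) ?bnd_simp//.
    by rewrite addrC subrK.
  exact: cont_on_integrable.
have := cont_on_integrable (cont_onS am (lexx b) H).
move=> /integrableS; apply => //.
exact: subset_itv_oc_cc.
Qed.

Lemma RIB a b u v : cont_on a b u -> cont_on a b v ->
  RI a b (fun t => u t - v t) = RI a b u - RI a b v.
Proof. by move=> U V; rewrite /RI RintegralB//; exact: cont_on_integrable. Qed.

Lemma RID a b u v : cont_on a b u -> cont_on a b v ->
  RI a b (fun t => u t + v t) = RI a b u + RI a b v.
Proof. by move=> U V; rewrite /RI RintegralD//; exact: cont_on_integrable. Qed.

Lemma RIZ a b k u : cont_on a b u -> RI a b (fun t => k * u t) = k * RI a b u.
Proof. by move=> U; rewrite /RI RintegralZl//; exact: cont_on_integrable. Qed.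

Lemma RI_cst a b k : a <= b -> RI a b (fun=> k) = k * (b - a).
Proof.
move=> ab; rewrite /RI Rintegral_cst//= lebesgue_measure_itv/= lte_fin.
case: ltP => // ba; have -> : a = b by lra.
by rewrite subrr.
Qed.

Lemma RI_ext a b u v : (forall t, a <= t <= b -> u t = v t) -> RI a b u = RI a b v.
Proof. by move=> H; apply: eq_Rintegral => t; rewrite inE/= in_itv/=; exact: H. Qed.

Lemma cont_cst (k : R) x : {for x, continuous (fun=> k : R)}.
Proof. exact: cst_continuous. Qed.

Lemma RI_le a b u v : cont_on a b u -> cont_on a b v ->
  (forall t, a <= t <= b -> u t <= v t) -> RI a b u <= RI a b v.
Proof.
move=> U V H; apply: le_Rintegral; [by []|exact: cont_on_integrable U|exact: cont_on_integrable V|].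
by move=> t /=; rewrite in_itv/=; exact: H.
Qed.

Lemma RI_bound a b u M : a <= b -> cont_on a b u ->
  (forall t, a <= t <= b -> `|u t| <= M) -> `|RI a b u| <= M * (b - a).
Proof.
move=> ab U H.
have h1 : RI a b u <= M * (b - a).
  rewrite -RI_cst//; apply: RI_le => //; first by move=> x _; exact: cont_cst.
  by move=> t /H; rewrite ler_norml => /andP[].
have h2 : - M * (b - a) <= RI a b u.
  rewrite -RI_cst//; apply: RI_le => //; first by move=> x _; exact: cont_cst.
  by move=> t /H; rewrite ler_norml => /andP[].
by rewrite ler_norml; lra.
Qed.

Lemma cont_epsP u x : {for x, continuous u} <->
  forall e : R, 0 < e -> exists2 del : R, 0 < del &
    forall y, `|y - x| < del -> `|u y - u x| < e.
Proof.
split.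
  move=> /cvgrPdist_lt H e /H /nbhs_ballP[del /= d0 D]; exists del => // y yd.
  by rewrite distrC; apply: D; rewrite /ball/= distrC.
move=> H; apply/cvgrPdist_lt => e /H[del d0 D]; apply/nbhs_ballP; exists del => //= y.
by rewrite /ball/= distrC => /D; rewrite distrC.
Qed.

Lemma is_derive_epsP u x d : is_derive x 1 u d <->
  forall e : R, 0 < e -> exists2 del : R, 0 < del &
    forall h, `|h| < del -> `|u (x + h) - u x - d * h| <= e * `|h|.
Proof.
split=> [[ud du]|H].
  move=> e e0; have : h^-1 *: ((u \o shift x) (h *: 1) - u x) @[h --> 0^'] --> (d : R).
    by move: ud; rewrite /derivable; rewrite -du.
  move=> /cvgrPdist_lt /(_ _ e0) /nbhs_ballP[del /= d0 D]; exists del => // h hd.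
  have [->|h0] := eqVneq h 0; first by rewrite addr0 mulr0 subrr subr0 normr0 mulr0.
  have := D h; rewrite /ball/= sub0r normrN => /(_ hd h0).
  rewrite /GRing.scale/= mulr1 (addrC h).
  have -> : d - h^-1 * (u (x + h) - u x) = - h^-1 * (u (x + h) - u x - d * h).
    by field.
  by rewrite normrM normrN normfV mulrC ltr_pdivrMr ?normr_gt0// => /ltW.
have L : h^-1 *: ((u \o shift x) (h *: 1) - u x) @[h --> 0^'] --> (d : R).
  apply/cvgrPdist_le => e /H[del d0 D]; apply/nbhs_ballP; exists del => //= h.
  rewrite /ball/= sub0r normrN => hd h0.
  rewrite /GRing.scale/= mulr1 (addrC h).
  have -> : d - h^-1 * (u (x + h) - u x) = - h^-1 * (u (x + h) - u x - d * h).
    by field.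
  by rewrite normrM normrN normfV mulrC ler_pdivrMr ?normr_gt0// D.
split; first by apply/cvg_ex; exists d.
exact: (cvg_lim _ L).
Qed.

Lemma is_derive_cont u x d : is_derive x 1 u d -> {for x, continuous u}.
Proof. by move=> [ud _]; apply: differentiable_continuous; apply/derivable1_diffP. Qed.

End RealCalculus.

Section Goursat.
Context {R : realType}.
Implicit Types (P Q : R -> R -> R) (a b c d x y : R).

(** Differentiability in both variables jointly, which partial derivatives alone do
    not give. *)
Definition fdiff P x y p q := forall e : R, 0 < e -> exists2 del : R, 0 < del &
  forall h k, `|h| < del -> `|k| < del ->
    `|P (x + h) (y + k) - P x y - p * h - q * k| <= e * (`|h| + `|k|).

Lemma fdiff_cont1 P x y p q : fdiff P x y p q -> {for x, continuous (P ^~ y)}.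
Proof.
move=> H; apply: (@is_derive_cont _ _ _ p); apply/is_derive_epsP => e /H[del d0 D].
exists del => // h hd; have := D h 0 hd; rewrite normr0 => /(_ d0).
by rewrite !addr0 mulr0 subr0.
Qed.

Lemma fdiff_cont2 P x y p q : fdiff P x y p q -> {for y, continuous (P x)}.
Proof.
move=> H; apply: (@is_derive_cont _ _ _ q); apply/is_derive_epsP => e /H[del d0 D].
exists del => // h hd; have := D 0 h; rewrite normr0 => /(_ d0 hd).
by rewrite !addr0 mulr0 subr0 add0r.
Qed.

(** The circulation of [P dx + Q dy] around the rectangle [a,b] x [c,d]. *)
Definition circulation P Q a b c d :=
  RI a b (P ^~ c) + RI c d (Q b) - RI a b (P ^~ d) - RI c d (Q a).

(** [P dx + Q dy] is differentiable and closed at every point, the partial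
    derivatives being allowed to be discontinuous. *)
Definition closed_form P Q a b c d := forall x y, a <= x <= b -> c <= y <= d ->
  exists p q r, fdiff P x y p q /\ fdiff Q x y q r.

Lemma closed_formS P Q a b c d a' b' c' d' : a <= a' -> b' <= b -> c <= c' -> d' <= d ->
  closed_form P Q a b c d -> closed_form P Q a' b' c' d'.
Proof. by move=> ? ? ? ? H x y /andP[? ?] /andP[? ?]; apply: H; lra. Qed.

Lemma closed_form_contP P Q a b c d y : closed_form P Q a b c d -> c <= y <= d ->
  cont_on a b (P ^~ y).
Proof. by move=> H ycd x xab; have [p [q [r [D _]]]] := H _ _ xab ycd; exact: fdiff_cont1 D. Qed.

Lemma closed_form_contQ P Q a b c d x : closed_form P Q a b c d -> a <= x <= b ->
  cont_on c d (Q x).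
Proof. by move=> H xab y ycd; have [p [q [r [_ D]]]] := H _ _ xab ycd; exact: fdiff_cont2 D. Qed.

Lemma circulation_splitx P Q a m b c d : a <= m <= b -> c <= d -> closed_form P Q a b c d ->
  circulation P Q a b c d = circulation P Q a m c d + circulation P Q m b c d.
Proof.
move=> mab cd H; rewrite /circulation.
rewrite (@RI_split _ a m b (P ^~ c))//; last by apply: closed_form_contP H _; rewrite lexx.
rewrite (@RI_split _ a m b (P ^~ d))//; last by apply: closed_form_contP H _; rewrite lexx andbT.
ring.
Qed.

Lemma circulation_splity P Q a b c m d : c <= m <= d -> a <= b -> closed_form P Q a b c d ->
  circulation P Q a b c d = circulation P Q a b c m + circulation P Q a b m d.
Proof.
move=> mab cd H; rewrite /circulation.
rewrite (@RI_split _ c m d (Q a))//; last by apply: closed_form_contQ H _; rewrite lexx.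
rewrite (@RI_split _ c m d (Q b))//; last by apply: closed_form_contQ H _; rewrite lexx andbT.
ring.
Qed.

(** The affine part of a closed form has zero circulation, so that only the error of
    the linear approximation contributes, along sides as short as the rectangle. *)
Lemma circulation_local P Q x y p q r e : 0 < e -> fdiff P x y p q -> fdiff Q x y q r ->
  exists2 del : R, 0 < del & forall a b c d, a <= x <= b -> c <= y <= d ->
    b - a < del -> d - c < del -> closed_form P Q a b c d ->
    `|circulation P Q a b c d| <= e * ((b - a) + (d - c)) ^+ 2.
Proof.
move=> e0 DP DQ; have e2 : 0 < e / 2 by lra.
have [d1 d10 D1] := DP _ e2; have [d2 d20 D2] := DQ _ e2.
exists (Num.min d1 d2); first by rewrite lt_min d10.
move=> a b c d /andP[ax xb] /andP[cy yd]; rewrite !lt_min => /andP[ba1 ba2] /andP[dc1 dc2] H.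
have ab : a <= b by lra.
have cd : c <= d by lra.
have -> : circulation P Q a b c d =
  RI a b (fun t => P t c - P t d - q * (c - d)) + RI c d (fun t => Q b t - Q a t - q * (b - a)).
  have cPc : cont_on a b (P ^~ c) by apply: closed_form_contP H _; rewrite lexx.
  have cPd : cont_on a b (P ^~ d) by apply: closed_form_contP H _; rewrite lexx andbT.
  have cQa : cont_on c d (Q a) by apply: closed_form_contQ H _; rewrite lexx.
  have cQb : cont_on c d (Q b) by apply: closed_form_contQ H _; rewrite lexx andbT.
  rewrite !RIB ?RI_cst// /circulation; first ring.
  all: try (by move=> t _; exact: cont_cst).
    by move=> t tcd; apply: continuousB; [exact: cQb|exact: cQa].
  by move=> t tcd; apply: continuousB; [exact: cPc|exact: cPd].
have PB t s : a <= t <= b -> c <= s <= d ->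
    `|P t s - P x y - p * (t - x) - q * (s - y)| <= e / 2 * ((b - a) + (d - c)).
  move=> /andP[at1 tb] /andP[cs sd].
  have h1 : `|t - x| <= b - a by rewrite ler_norml; lra.
  have h2 : `|s - y| <= d - c by rewrite ler_norml; lra.
  have := D1 (t - x) (s - y); rewrite (_ : x + (t - x) = t) 1?(_ : y + (s - y) = s);
    [|ring|ring] => /(_ _ _)/le_trans; apply.
  - exact: le_lt_trans ba1.
  - exact: le_lt_trans dc1.
  - by apply: ler_wpM2l; [exact: ltW|exact: lerD].
have QB t s : a <= t <= b -> c <= s <= d ->
    `|Q t s - Q x y - q * (t - x) - r * (s - y)| <= e / 2 * ((b - a) + (d - c)).
  move=> /andP[at1 tb] /andP[cs sd].
  have h1 : `|t - x| <= b - a by rewrite ler_norml; lra.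
  have h2 : `|s - y| <= d - c by rewrite ler_norml; lra.
  have := D2 (t - x) (s - y); rewrite (_ : x + (t - x) = t) 1?(_ : y + (s - y) = s);
    [|ring|ring] => /(_ _ _)/le_trans; apply.
  - exact: le_lt_trans ba2.
  - exact: le_lt_trans dc2.
  - by apply: ler_wpM2l; [exact: ltW|exact: lerD].
have b1 : `|RI a b (fun t => P t c - P t d - q * (c - d))| <= e * ((b - a) + (d - c)) * (b - a).
  apply: RI_bound => //.
    move=> t tab; apply: continuousB; last exact: cont_cst.
    by apply: continuousB; [apply: (closed_form_contP H) tab|apply: (closed_form_contP H) tab]; lra.
  move=> t tab.
  have cc : c <= c <= d by lra.
  have dd : c <= d <= d by lra.
  have := PB _ _ tab cc; have := PB _ _ tab dd.
  rewrite !ler_norml => /andP[h1 h2] /andP[h3 h4]; apply/andP; split; lra.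
have b2 : `|RI c d (fun t => Q b t - Q a t - q * (b - a))| <= e * ((b - a) + (d - c)) * (d - c).
  apply: RI_bound => //.
    move=> t tab; apply: continuousB; last exact: cont_cst.
    by apply: continuousB; [apply: (closed_form_contQ H) tab|apply: (closed_form_contQ H) tab]; lra.
  move=> t tab.
  have cc : a <= a <= b by lra.
  have dd : a <= b <= b by lra.
  have := QB _ _ cc tab; have := QB _ _ dd tab.
  rewrite !ler_norml => /andP[h1 h2] /andP[h3 h4]; apply/andP; split; lra.
rewrite (le_trans (ler_normD _ _))// (le_trans (lerD b1 b2))//.
by rewrite le_eqVlt; apply/orP; left; apply/eqP; ring.
Qed.

(** One step of the bisection: a quarter of the rectangle carries at least a
    quarter of the circulation. *)
Lemma circulation_quarter P Q a b c d : a <= b -> c <= d -> closed_form P Q a b c d ->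
  exists r : R * R, [/\ a <= r.1 & r.1 + (b - a) / 2 <= b] /\
   [/\ c <= r.2, r.2 + (d - c) / 2 <= d &
   `|circulation P Q a b c d| <=
     4 * `|circulation P Q r.1 (r.1 + (b - a) / 2) r.2 (r.2 + (d - c) / 2)|].
Proof.
move=> ab cd H; pose m := a + (b - a) / 2; pose n := c + (d - c) / 2.
have mab : a <= m <= b by rewrite /m; lra.
have ncd : c <= n <= d by rewrite /n; lra.
have E : circulation P Q a b c d =
  circulation P Q a m c n + circulation P Q a m n d +
  (circulation P Q m b c n + circulation P Q m b n d).
  rewrite (circulation_splitx mab cd H); congr (_ + _); apply: circulation_splity => //.
  - lra.
  - by apply: closed_formS H => //; lra.
  - lra.
  - by apply: closed_formS H => //; lra.
have mb : m + (b - a) / 2 = b by rewrite /m; lra.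
have nd : n + (d - c) / 2 = d by rewrite /n; lra.
set A1 := circulation P Q a m c n in E; set A2 := circulation P Q a m n d in E.
set A3 := circulation P Q m b c n in E; set A4 := circulation P Q m b n d in E.
have T : `|circulation P Q a b c d| <= `|A1| + `|A2| + (`|A3| + `|A4|).
  rewrite E (le_trans (ler_normD _ _))// lerD//; exact: ler_normD.
set I := `|circulation P Q a b c d| in T *.
have [h1|h1] := leP I (4 * `|A1|); first by exists (a, c); rewrite /=; split; split => //; lra.
have [h2|h2] := leP I (4 * `|A2|).
  by exists (a, n); rewrite /= nd; split; split => //; lra.
have [h3|h3] := leP I (4 * `|A3|).
  by exists (m, c); rewrite /= mb; split; split => //; lra.
have [h4|h4] := leP I (4 * `|A4|).
  by exists (m, n); rewrite /= mb nd; split; split => //; lra.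
exfalso; lra.
Qed.

Lemma nested_seq (a : nat -> R) (l : nat -> R) : (forall n, a n <= a n.+1) ->
  (forall n, a n.+1 + l n.+1 <= a n + l n) -> (forall n, 0 <= l n) ->
  exists x, forall n, a n <= x <= a n + l n.
Proof.
move=> ha hl l0.
have amono n m : (n <= m)%N -> a n <= a m.
  elim: m => [|m IH]; first by rewrite leqn0 => /eqP->.
  by rewrite leq_eqVlt => /orP[/eqP->//|/IH/le_trans]; apply.
have lmono n m : (n <= m)%N -> a m + l m <= a n + l n.
  elim: m => [|m IH]; first by rewrite leqn0 => /eqP->.
  by rewrite leq_eqVlt => /orP[/eqP->//|/IH h]; apply: le_trans (hl _) h.
have ub n m : a m <= a n + l n.
  have [nm|/ltnW mn] := leqP n m; first by have := lmono _ _ nm; have := l0 m; lra.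
  by have := amono _ _ mn; have := l0 n; lra.
exists (sup (range a)) => n; apply/andP; split.
  apply: ub_le_sup; last by exists n.
  by exists (a 0%N + l 0%N) => _ [m _ <-]; exact: ub.
apply: ge_sup; first by exists (a 0%N); exists 0%N.
by move=> _ [m _ <-]; exact: ub.
Qed.

(** Goursat's argument: the circulation on a small rectangle is of lower order
    than its area, hence bisection forces the total circulation to vanish. *)
Lemma goursat P Q a b c d : a <= b -> c <= d -> closed_form P Q a b c d ->
  circulation P Q a b c d = 0.
Proof.
move=> ab cd H.
set L := (b - a); set M := (d - c).
pose w n := L / 2 ^+ n; pose v n := M / 2 ^+ n.
have w0 n : 0 <= w n by rewrite /w divr_ge0 ?exprn_ge0// /L; lra.
have v0 n : 0 <= v n by rewrite /v divr_ge0 ?exprn_ge0// /M; lra.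
have wS n : w n / 2 = w n.+1 by rewrite /w exprS invfM; ring.
have vS n : v n / 2 = v n.+1 by rewrite /v exprS invfM; ring.
pose ok n (r : R * R) := [/\ a <= r.1, r.1 + w n <= b, c <= r.2 & r.2 + v n <= d].
have step (nr : nat * (R * R)) : exists r', ok nr.1 nr.2 ->
   [/\ ok nr.1.+1 r', nr.2.1 <= r'.1, r'.1 + w nr.1.+1 <= nr.2.1 + w nr.1,
       nr.2.2 <= r'.2 & r'.2 + v nr.1.+1 <= nr.2.2 + v nr.1] /\
   `|circulation P Q nr.2.1 (nr.2.1 + w nr.1) nr.2.2 (nr.2.2 + v nr.1)| <=
   4 * `|circulation P Q r'.1 (r'.1 + w nr.1.+1) r'.2 (r'.2 + v nr.1.+1)|.
  case: nr => n [x y] /=.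
  have [[k1 k2 k3 k4]|nok] := pselect (ok n (x, y)); last by exists (x, y) => /nok.
  rewrite /= in k1 k2 k3 k4.
  have := @circulation_quarter P Q x (x + w n) y (y + v n).
  have -> : x + w n - x = w n by ring.
  have -> : y + v n - y = v n by ring.
  rewrite wS vS => /(_ _ _ _)[|||r' [[q1 q2] [q3 q4 q5]]].
  - by rewrite lerDl.
  - by rewrite lerDl.
  - by apply: closed_formS H.
  by exists r' => _; split => //; split => //; rewrite /ok; split; lra.
have [F HF] := choice step.
pose r := fix r n := match n with 0%N => (a, c) | m.+1 => F (m, r m) end.
have okr n : ok n (r n).
  elim: n => [|n IH]; first by rewrite /ok /w /v !expr0 !divr1 /L /M/=; split; lra.
  by have [[]] := HF (n, r n) IH.
have HS n := HF (n, r n) (okr n).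
have [x0 hx0] : exists x, forall n, (r n).1 <= x <= (r n).1 + w n.
  by apply: nested_seq => // n; have [[]] := HS n.
have [y0 hy0] : exists x, forall n, (r n).2 <= x <= (r n).2 + v n.
  by apply: nested_seq => // n; have [[]] := HS n.
have grow n : `|circulation P Q a b c d| <=
    4 ^+ n * `|circulation P Q (r n).1 ((r n).1 + w n) (r n).2 ((r n).2 + v n)|.
  elim: n => [|n IH].
    rewrite expr0 mul1r /= /w /v !expr0 !divr1 /L /M.
    by rewrite (_ : a + (b - a) = b) 1?(_ : c + (d - c) = d)//; ring.
  rewrite (le_trans IH)// exprSr -mulrA ler_wpM2l ?exprn_ge0//.
  by have [] := HS n.
have x0ab : a <= x0 <= b by have := hx0 0%N; have [] := okr 0%N; lra.
have y0cd : c <= y0 <= d by have := hy0 0%N; have [] := okr 0%N; lra.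
have [p [q [s [DP DQ]]]] := H _ _ x0ab y0cd.
apply/eqP; rewrite -normr_le0; apply/ler_addgt0Pr => e e0; rewrite add0r.
pose K := 1 + (L + M) ^+ 2.
have K0 : 0 < K by rewrite /K ltr_pwDl// sqr_ge0.
have [del del0 D] := circulation_local (divr_gt0 e0 K0) DP DQ.
have LM0 : 0 <= L + M by rewrite /L /M; lra.
have [n hn] : exists n, (L + M) / 2 ^+ n < del.
  exists (Num.truncn ((L + M) / del)).
  rewrite ltr_pdivrMr ?exprn_gt0// mulrC -ltr_pdivrMr//.
  apply: lt_le_trans (truncnS_gt _) _.
  by rewrite -natrX ler_nat ltn_expl.
have wv : w n + v n = (L + M) / 2 ^+ n by rewrite /w /v -mulrDl.
have [k1 k2 k3 k4] := okr n.
have := D _ _ _ _ (hx0 n) (hy0 n).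
have -> : (r n).1 + w n - (r n).1 = w n by ring.
have -> : (r n).2 + v n - (r n).2 = v n by ring.
move=> /(_ _ _ _)/[!wv] B.
apply: le_trans (grow n) _.
apply: (@le_trans _ _ (4 ^+ n * (e / K * ((L + M) / 2 ^+ n) ^+ 2))).
  rewrite ler_wpM2l ?exprn_ge0//; apply: B.
  - by have := v0 n; lra.
  - by have := w0 n; lra.
  - by apply: closed_formS H.
rewrite expr_div_n -exprM mulnC exprM (_ : 2 ^+ 2 = 4 :> R); last by ring.
have -> : 4 ^+ n * (e / K * ((L + M) ^+ 2 / 4 ^+ n)) = e * ((L + M) ^+ 2 / K).
  by field; rewrite (gt_eqF K0) expf_neq0.
rewrite -[leRHS]mulr1 ler_wpM2l ?ltW// ltr_pdivrMr// /K; lra.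
Qed.

End Goursat.

(** * Mean values on circles *)

Section ComplexExp.
Context {R : realType}.
Local Notation C := (Cplx R).
Implicit Types (z w h : C) (t s a b : R).

Definition tau : R := 2 * pi.
Lemma tau_gt0 : 0 < tau. Proof. by rewrite /tau mulr_gt0// pi_gt0. Qed.

Definition cis t : C := Complex (cos t) (sin t).
Definition cexp z : C := RtoC (expR (cre z)) * cis (cim z).

Lemma cis0 : cis 0 = 1. Proof. by apply: C_ext; rewrite /= ?cos0 ?sin0. Qed.
Lemma cisD s t : cis (s + t) = cis s * cis t.
Proof. by apply: C_ext; rewrite !cE/= ?cosD ?sinD; ring. Qed.
Lemma modulus_cis t : modulus (cis t) = 1.
Proof. by rewrite modulusE /= cos2Dsin2 sqrtr1. Qed.
Lemma cis_neq0 t : cis t != 0.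
Proof. by rewrite -modulus_gt0 modulus_cis. Qed.
Lemma cisDtau t : cis (t + tau) = cis t.
Proof.
rewrite /tau mulr2n mulrDl mul1r addrA.
by apply: C_ext; rewrite /= ?cosDpi ?sinDpi opprK.
Qed.
Lemma cis_tau : cis tau = 1. Proof. by rewrite -(add0r tau) cisDtau cis0. Qed.
Lemma cisN t : cis (- t) = (cis t)^*.
Proof. by apply: C_ext; rewrite /= ?cosN ?sinN. Qed.
Lemma cis_conj t : cis t * (cis t)^* = 1.
Proof. by rewrite mulC_conj modulus_cis expr1n RtoC1. Qed.
Lemma cisV t : (cis t)^-1 = (cis t)^*.
Proof. by apply: (mulfI (cis_neq0 t)); rewrite mulfV ?cis_neq0// cis_conj. Qed.
Lemma cisX t n : cis t ^+ n = cis (n%:R * t).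
Proof.
elim: n => [|n IH]; first by rewrite mul0r cis0.
by rewrite exprS IH -cisD mulrSr mulrDl mul1r addrC.
Qed.

Lemma cexpD z w : cexp (z + w) = cexp z * cexp w.
Proof. by rewrite /cexp !cE expRD RtoCM cisD; ring. Qed.
Lemma cexp0 : cexp 0 = 1. Proof. by rewrite /cexp !cE expR0 cis0 RtoC1 mulr1. Qed.
Lemma modulus_cexp z : modulus (cexp z) = expR (cre z).
Proof. by rewrite modulusM modulus_cis mulr1 modulusR gtr0_norm ?expR_gt0. Qed.
Lemma cexp_neq0 z : cexp z != 0.
Proof. by rewrite -modulus_gt0 modulus_cexp expR_gt0. Qed.
Lemma cre_cexp z : cre (cexp z) = expR (cre z) * cos (cim z).
Proof. by rewrite creZ. Qed.

Lemma cexp_deriv0 (e : R) : 0 < e -> exists2 del : R, 0 < del &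
  forall h, modulus h < del -> modulus (cexp h - 1 - h) <= e * modulus h.
Proof.
move=> e0; pose e' := Num.min (1/2) (e / 9).
have e'0 : 0 < e' by rewrite lt_min; apply/andP; split; lra.
have e'1 : e' <= 1/2 by rewrite /e' ge_min lexx.
have e'9 : e' <= e / 9 by rewrite /e' ge_min lexx orbT.
clearbody e'.
have /is_derive_epsP/(_ _ e'0)[d1 d10 D1] := is_derive_expR (0 : R).
have /is_derive_epsP/(_ _ e'0)[d2 d20 D2] := is_derive_cos (0 : R).
have /is_derive_epsP/(_ _ e'0)[d3 d30 D3] := is_derive_sin (0 : R).
exists (Num.min e' (Num.min d1 (Num.min d2 d3))); first by rewrite !lt_min e'0 d10 d20.
move=> h; rewrite !lt_min => /and4P[he h1 h2 h3].
have ar := cre_le_modulus h; have br := cim_le_modulus h.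
set m := modulus h in he h1 h2 h3 ar br *.
set a := cre h in ar; set b := cim h in br.
have := D1 a (le_lt_trans ar h1); have := D2 b (le_lt_trans br h2).
have := D3 b (le_lt_trans br h3).
rewrite !add0r expR0 cos0 sin0 subr0 mul1r mul1r oppr0 mul0r subr0.
move=> S3 S2 S1.
have U1 : `|expR a - 1 - a| <= e' * m by rewrite (le_trans S1)// ler_wpM2l// ltW.
have U2 : `|cos b - 1| <= e' * m by rewrite (le_trans S2)// ler_wpM2l// ltW.
have U3 : `|sin b - b| <= e' * m by rewrite (le_trans S3)// ler_wpM2l// ltW.
have m0 : 0 <= m by exact: modulus_ge0.
have V : `|expR a - 1| <= 2 * m.
  rewrite (_ : expR a - 1 = (expR a - 1 - a) + a); last ring.
  rewrite (le_trans (ler_normD _ _))//; nra.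
have E2 : `|expR a| <= 2.
  rewrite (_ : expR a = (expR a - 1) + 1); last ring.
  rewrite (le_trans (ler_normD _ _))// normr1; lra.
apply: le_trans (modulus_le _) _.
have -> : cre (cexp h - 1 - h) = (expR a - 1 - a) + expR a * (cos b - 1).
  by rewrite !creB cre_cexp cre1 -/a -/b; ring.
have -> : cim (cexp h - 1 - h) = expR a * (sin b - b) + (expR a - 1) * b.
  by rewrite !cimB cimZ cim1 -/a -/b /=; ring.
have W1 : `|expR a * (cos b - 1)| <= 2 * (e' * m).
  by rewrite normrM; apply: ler_pM.
have W2 : `|expR a * (sin b - b)| <= 2 * (e' * m).
  by rewrite normrM; apply: ler_pM.
have W3 : `|(expR a - 1) * b| <= 2 * m * e'.
  by rewrite normrM; apply: ler_pM => //; rewrite (le_trans br)// ltW.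
have X1 := ler_normD (expR a - 1 - a) (expR a * (cos b - 1)).
(* The remainders of exp, cos and sin at 0 enter with total weight at most 9. *)
have X2 := ler_normD (expR a * (sin b - b)) ((expR a - 1) * b).
apply: (@le_trans _ _ (9 * e' * m)); first by nra.
by rewrite ler_wpM2r//; lra.
Qed.

Lemma cderiv_cexp z : cderiv cexp z (cexp z).
Proof.
move=> e e0; have z0 : 0 < modulus (cexp z) by rewrite modulus_gt0 cexp_neq0.
have [d d0 D] := cexp_deriv0 (divr_gt0 e0 z0); exists d => // h /D hd.
have -> : cexp (z + h) - cexp z - cexp z * h = cexp z * (cexp h - 1 - h).
  by rewrite cexpD; ring.
rewrite modulusM (le_trans (ler_wpM2l (ltW z0) hd))//.
by rewrite mulrA [_ * (e / _)]mulrC divfK// gt_eqF.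
Qed.

Definition rccont (g : R -> C) t := forall e : R, 0 < e -> exists2 del : R, 0 < del &
  forall s, `|s - t| < del -> modulus (g s - g t) < e.

Lemma rccont_re (g : R -> C) t : rccont g t -> {for t, continuous (fun s => cre (g s))}.
Proof.
move=> H; apply/cont_epsP => e /H[d d0 D]; exists d => // s /D.
by apply: le_lt_trans; rewrite -creB cre_le_modulus.
Qed.
Lemma rccont_im (g : R -> C) t : rccont g t -> {for t, continuous (fun s => cim (g s))}.
Proof.
move=> H; apply/cont_epsP => e /H[d d0 D]; exists d => // s /D.
by apply: le_lt_trans; rewrite -cimB cim_le_modulus.
Qed.
Lemma rccontP (g : R -> C) t : {for t, continuous (fun s => cre (g s))} ->
  {for t, continuous (fun s => cim (g s))} -> rccont g t.
Proof.
move=> /cont_epsP A /cont_epsP B e e0; have e2 : 0 < e / 2 by lra.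
have [d1 d10 D1] := A _ e2; have [d2 d20 D2] := B _ e2.
exists (Num.min d1 d2); first by rewrite lt_min d10.
move=> s; rewrite lt_min => /andP[/D1 h1 /D2 h2].
apply: le_lt_trans (modulus_le _) _; rewrite creB cimB; lra.
Qed.
Lemma rccont_cis t : rccont cis t.
Proof. by apply: rccontP => /=; [exact: continuous_cos|exact: continuous_sin]. Qed.
Lemma rccont_comp (f : C -> C) (g : R -> C) t : rccont g t -> ccont f (g t) ->
  rccont (fun s => f (g s)) t.
Proof.
move=> G F e /F[d d0 D]; have [d' d'0 D'] := G _ d0.
by exists d' => // s /D'; exact: D.
Qed.
Lemma rccont_cst (a : C) t : rccont (fun=> a) t.
Proof. by move=> e e0; exists 1 => // s _; rewrite subrr modulus0. Qed.
Lemma rccontD (f g : R -> C) t : rccont f t -> rccont g t -> rccont (fun s => f s + g s) t.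
Proof.
move=> F G; apply: rccontP.
  rewrite (_ : (fun s => _) = fun s => cre (f s) + cre (g s)).
    by apply: continuousD; exact: rccont_re.
  by apply/funext => s; rewrite creD.
rewrite (_ : (fun s => _) = fun s => cim (f s) + cim (g s)).
  by apply: continuousD; exact: rccont_im.
by apply/funext => s; rewrite cimD.
Qed.
Lemma rccontM (f g : R -> C) t : rccont f t -> rccont g t -> rccont (fun s => f s * g s) t.
Proof.
move=> F G; have [F1 F2] := (rccont_re F, rccont_im F).
have [G1 G2] := (rccont_re G, rccont_im G); apply: rccontP.
  rewrite (_ : (fun s => _) = fun s => cre (f s) * cre (g s) - cim (f s) * cim (g s)).
    by apply: continuousB; exact: continuousM.
  by apply/funext => s; rewrite creM.
rewrite (_ : (fun s => _) = fun s => cre (f s) * cim (g s) + cim (f s) * cre (g s)).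
  by apply: continuousD; exact: continuousM.
by apply/funext => s; rewrite cimM.
Qed.
Lemma rccontB (f g : R -> C) t : rccont f t -> rccont g t -> rccont (fun s => f s - g s) t.
Proof.
move=> F G; apply: rccontP.
  rewrite (_ : (fun s => _) = fun s => cre (f s) - cre (g s)).
    by apply: continuousB; exact: rccont_re.
  by apply/funext => s; rewrite creB.
rewrite (_ : (fun s => _) = fun s => cim (f s) - cim (g s)).
  by apply: continuousB; exact: rccont_im.
by apply/funext => s; rewrite cimB.
Qed.
Lemma rccont_circle (w z : C) t : rccont (fun s => w + z * cis s) t.
Proof. by apply: rccontD (rccont_cst _ _) (rccontM (rccont_cst _ _) (rccont_cis _)). Qed.
Lemma rccontX (f : R -> C) t n : rccont f t -> rccont (fun s => f s ^+ n) t.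
Proof.
move=> F; apply: (rccont_comp F (f := fun z => z ^+ n)).
exact: cderiv_ccont (cderivX _ _).
Qed.

Definition ccurve (g : R -> C) := forall t, rccont g t.

Definition circint (g : R -> C) : C :=
  Complex (RI 0 tau (fun t => cre (g t))) (RI 0 tau (fun t => cim (g t))).

Lemma ccurve_re a b g : ccurve g -> cont_on a b (fun t => cre (g t)).
Proof. by move=> H t _; exact: rccont_re. Qed.
Lemma ccurve_im a b g : ccurve g -> cont_on a b (fun t => cim (g t)).
Proof. by move=> H t _; exact: rccont_im. Qed.

Lemma circint_ext f g : f =1 g -> circint f = circint g.
Proof. by move=> /funext ->. Qed.

Lemma circintD f g : ccurve f -> ccurve g ->
  circint (fun t => f t + g t) = circint f + circint g.
Proof.
move=> F G; apply: C_ext; rewrite /= ?creD ?cimD /=.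
  by under eq_fun do rewrite creD; rewrite RID//; exact: ccurve_re.
by under eq_fun do rewrite cimD; rewrite RID//; exact: ccurve_im.
Qed.

Lemma circintB f g : ccurve f -> ccurve g ->
  circint (fun t => f t - g t) = circint f - circint g.
Proof.
move=> F G; apply: C_ext; rewrite /= ?creB ?cimB /=.
  by under eq_fun do rewrite creB; rewrite RIB//; exact: ccurve_re.
by under eq_fun do rewrite cimB; rewrite RIB//; exact: ccurve_im.
Qed.

Lemma cont_onZ a b k u : cont_on a b u -> cont_on a b (fun t => k * u t :> R).
Proof. by move=> U t tab; apply: continuousM; [exact: cont_cst|exact: U]. Qed.

Lemma circintZ (k : C) g : ccurve g -> circint (fun t => k * g t) = k * circint g.
Proof.
move=> G; have Gr a b := @ccurve_re a b _ G; have Gi a b := @ccurve_im a b _ G.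
apply: C_ext; rewrite ?creM ?cimM /=.
  under eq_fun do rewrite creM.
  by rewrite RIB ?RIZ//; exact: cont_onZ.
under eq_fun do rewrite cimM.
by rewrite RID ?RIZ//; exact: cont_onZ.
Qed.

Lemma circint_cst (k : C) : circint (fun=> k) = RtoC tau * k.
Proof.
by apply: C_ext; rewrite ?creZ ?cimZ /= RI_cst ?subr0 ?(mulrC k)// ?ltW ?tau_gt0// mulrC.
Qed.

(** The factor 2 comes from estimating the real and the imaginary part separately. *)
Lemma circint_bound g (M : R) : ccurve g -> (forall t, modulus (g t) <= M) ->
  modulus (circint g) <= 2 * M * tau.
Proof.
move=> G H; have t0 := tau_gt0; apply: le_trans (modulus_le _) _ => /=.
have h1 : `|RI 0 tau (fun t => cre (g t))| <= M * (tau - 0).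
  apply: RI_bound; [exact: ltW|exact: ccurve_re|].
  by move=> t _; exact: le_trans (cre_le_modulus _) (H t).
have h2 : `|RI 0 tau (fun t => cim (g t))| <= M * (tau - 0).
  apply: RI_bound; [exact: ltW|exact: ccurve_im|].
  by move=> t _; exact: le_trans (cim_le_modulus _) (H t).
by rewrite subr0 in h1 h2; lra.
Qed.

End ComplexExp.

Section Cauchy.
Context {R : realType}.
Local Notation C := (Cplx R).
Local Notation tau := (@tau R).
Implicit Types (f g G : C -> C) (z w u v h : C) (t s a b : R).

Lemma fdiff_re (K : C -> C) x y (D : C) : cderiv K (Complex x y) D ->
  fdiff (fun x y => cre (K (Complex x y))) x y (cre D) (- cim D).
Proof.
move=> H e e0; have [d d0 HD] := H _ e0; exists (d / 2); first lra.
move=> h k hd kd; have m : modulus (Complex h k : C) <= `|h| + `|k| := modulus_le _.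
have /HD B : modulus (Complex h k : C) < d by lra.
apply: (@le_trans _ _ (e * modulus (Complex h k : C))); last first.
  by apply: ler_wpM2l; [exact: ltW|exact: m].
apply: le_trans _ B; apply: le_trans _ (cre_le_modulus _).
by rewrite !creB creM /=; rewrite le_eqVlt; apply/orP; left; apply/eqP; congr `|_|; ring.
Qed.

Lemma fdiff_im (K : C -> C) x y (D : C) : cderiv K (Complex x y) D ->
  fdiff (fun x y => cim (K (Complex x y))) x y (cim D) (cre D).
Proof.
move=> H e e0; have [d d0 HD] := H _ e0; exists (d / 2); first lra.
move=> h k hd kd; have m : modulus (Complex h k : C) <= `|h| + `|k| := modulus_le _.
have /HD B : modulus (Complex h k : C) < d by lra.
apply: (@le_trans _ _ (e * modulus (Complex h k : C))); last first.
  by apply: ler_wpM2l; [exact: ltW|exact: m].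
apply: le_trans _ B; apply: le_trans _ (cim_le_modulus _).
by rewrite !cimB cimM /=; rewrite le_eqVlt; apply/orP; left; apply/eqP; congr `|_|; ring.
Qed.

(** Goursat's theorem on the rectangle [a, b] x [0, tau]: periodicity cancels the two
    horizontal sides. *)
Lemma period_re (K : C -> C) a b : a <= b ->
  (forall x y, a <= x <= b -> exists d, cderiv K (Complex x y) d) ->
  (forall x, K (Complex x tau) = K (Complex x 0)) ->
  RI 0 tau (fun t => cre (K (Complex a t))) = RI 0 tau (fun t => cre (K (Complex b t))).
Proof.
move=> ab H per.
have := @goursat _ (fun x y => cim (K (Complex x y))) (fun x y => cre (K (Complex x y)))
  a b 0 tau ab (ltW tau_gt0).
have cf : closed_form (fun x y => cim (K (Complex x y))) (fun x y => cre (K (Complex x y)))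
    a b 0 tau.
  move=> x y xab _; have [D HD] := H _ y xab.
  by exists (cim D), (cre D), (- cim D); split; [exact: fdiff_im|exact: fdiff_re].
move=> /(_ cf); rewrite /circulation.
have -> : (fun x => cim (K (Complex x tau))) = (fun x => cim (K (Complex x 0))).
  by apply/funext => x; rewrite per.
by move=> h; lra.
Qed.

(** Integrating over a period strip of the exponential map turns Goursat's theorem
    into the invariance of circle integrals under change of radius. *)
Lemma circint_radius G w z (r : R) : 0 < r <= 1 ->
  (forall u, r * modulus z <= modulus (u - w) <= modulus z -> exists d, cderiv G u d) ->
  circint (fun t => G (w + RtoC r * z * cis t)) = circint (fun t => G (w + z * cis t)).
Proof.
move=> /andP[r0 r1] H.
pose K (zeta : C) := G (w + z * cexp zeta).
have lr : ln r <= 0 by rewrite ln_le0.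
have KE x t : K (Complex x t) = G (w + RtoC (expR x) * z * cis t).
  by rewrite /K /cexp /=; congr (G (_ + _)); ring.
have HK x y : ln r <= x <= 0 -> exists d, cderiv K (Complex x y) d.
  move=> /andP[lx x0].
  have [|d Hd] := H (w + z * cexp (Complex x y)).
    rewrite addrC addKr modulusM modulus_cexp /= mulrC.
    apply/andP; split.
      by rewrite ler_wpM2l ?modulus_ge0// -ler_ln ?posrE ?expR_gt0// expRK.
    by rewrite -[leRHS]mulr1 ler_wpM2l ?modulus_ge0// -expR0 ler_expR.
  have S := cderivD (cderiv_cst w (Complex x y)) (cderivZ z (cderiv_cexp (Complex x y))).
  by eexists; exact: (cderiv_comp S Hd).
have per x : K (Complex x tau) = K (Complex x 0).
  by rewrite !KE cis_tau cis0.
have cE1 : circint (fun t => G (w + RtoC r * z * cis t)) = circint (fun t => K (Complex (ln r) t)).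
  by apply: circint_ext => t; rewrite KE lnK.
have cE2 : circint (fun t => G (w + z * cis t)) = circint (fun t => K (Complex 0 t)).
  by apply: circint_ext => t; rewrite KE expR0 RtoC1 mul1r.
rewrite cE1 cE2; apply: C_ext => /=; first exact: period_re HK per.
(* The imaginary part of [K] is the real part of [- i K]. *)
pose K' zeta := Complex 0 (-1) * K zeta.
have := @period_re K' _ _ lr.
have E x : (fun t => cre (K' (Complex x t))) = (fun t => cim (K (Complex x t))).
  by apply/funext => t; rewrite /K' creM /= mul0r add0r mulN1r opprK.
rewrite !E; apply.
  by move=> x y /(HK _ y)[d Hd]; exists (Complex 0 (-1) * d); exact: cderivZ.
by move=> x; rewrite /K' per.
Qed.

Lemma circle_ccurve f w z : (forall t, ccont f (w + z * cis t)) ->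
  ccurve (fun t => f (w + z * cis t)).
Proof. by move=> H t; apply: rccont_comp (rccont_circle _ _ _) _. Qed.

(** Shrinking the radius does not change the integral, and on small circles [G] is
    close to [L]. *)
Lemma circint_limit G w z (L : C) : z != 0 ->
  (forall u, 0 < modulus (u - w) <= modulus z -> exists d, cderiv G u d) ->
  (forall e : R, 0 < e -> exists2 del : R, 0 < del &
    forall u, 0 < modulus (u - w) < del -> modulus (G u - L) <= e) ->
  circint (fun t => G (w + z * cis t)) = RtoC tau * L.
Proof.
move=> z0 H HL; have Z0 : 0 < modulus z by rewrite modulus_gt0.
apply/eqP; rewrite -subr_eq0 -modulus_eq0 eq_le modulus_ge0 andbT.
apply/ler_addgt0Pr => e e0; rewrite add0r.
have t0 := @tau_gt0 R.
have e1 : 0 < e / (2 * tau) by apply: divr_gt0 => //; lra.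
have [del d0 D] := HL _ e1.
pose r := Num.min 1 (del / (2 * modulus z)).
have r0 : 0 < r by rewrite lt_min ltr01/= divr_gt0//; lra.
have r1 : r <= 1 by rewrite /r ge_min lexx.
have rz : r * modulus z < del.
  apply: (@le_lt_trans _ _ (del / 2)); last lra.
  rewrite -ler_pdivlMr// /r ge_min; apply/orP; right.
  by rewrite le_eqVlt; apply/orP; left; apply/eqP; field; lra.
rewrite -(@circint_radius G w z r); last first.
- by move=> u /andP[u1 u2]; apply: H; rewrite u2 andbT; apply: lt_le_trans u1; exact: mulr_gt0.
- by rewrite r0.
have uu t : modulus (w + RtoC r * z * cis t - w) = r * modulus z.
  by rewrite addrC addKr !modulusM modulus_cis mulr1 modulusR gtr0_norm.
have cc : ccurve (fun t => G (w + RtoC r * z * cis t)).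
  apply: circle_ccurve => t; have [|d Hd] := H (w + RtoC r * z * cis t).
    by rewrite uu mulr_gt0//= -[leRHS]mul1r ler_wpM2r// ltW.
  exact: cderiv_ccont Hd.
rewrite -circint_cst -circintB//; last by move=> t; exact: rccont_cst.
apply: le_trans (circint_bound (M := e / (2 * tau)) _ _) _.
- by move=> t; apply: rccontB (cc t) (rccont_cst _ _).
- by move=> t; apply: D; rewrite uu mulr_gt0.
- by rewrite le_eqVlt; apply/orP; left; apply/eqP; field; lra.
Qed.

Lemma mean_value f w z : z != 0 ->
  (forall u, modulus (u - w) <= modulus z -> exists d, cderiv f u d) ->
  circint (fun t => f (w + z * cis t)) = RtoC tau * f w.
Proof.
move=> z0 H; apply: circint_limit => //.
  by move=> u /andP[_]; exact: H.
have [d Hd] : exists d, cderiv f w d by apply: H; rewrite subrr modulus0 modulus_ge0.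
move=> e /(cderiv_ccont Hd)[del d0 D]; exists del => // u /andP[_ /D]; exact: ltW.
Qed.

(** The difference quotient extends continuously to [w], by the derivative. *)
Lemma mean_derive f w z d : z != 0 -> cderiv f w d ->
  (forall u, modulus (u - w) <= modulus z -> exists d, cderiv f u d) ->
  circint (fun t => (f (w + z * cis t) - f w) / (z * cis t)) = RtoC tau * d.
Proof.
move=> z0 Hd H.
rewrite -(@circint_limit (fun u => (f u - f w) / (u - w)) w z d z0).
- by apply: circint_ext => t; congr (_ / _); rewrite addrC addKr.
- move=> u /andP[u0 uz]; have [du Du] := H _ uz.
  have uw : u - w != 0 by rewrite -modulus_gt0.
  have sub1 : cderiv (fun v => f v - f w) u (du + 0) := cderivD Du (cderiv_cst (- f w) u).
  have sub2 : cderiv (fun v => v - w) u (1 + 0) := cderivD (cderiv_id u) (cderiv_cst (- w) u).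
  have inv2 := cderiv_comp sub2 (cderivV uw).
  by eexists; exact: (cderivM sub1 inv2).
- move=> e /Hd[del d0 D]; exists del => // u /andP[u0 ud].
  have uw : u - w != 0 by rewrite -modulus_gt0.
  have := D _ ud; rewrite [w + _]addrC subrK => B.
  rewrite -(ler_pM2r u0) -modulusM; apply: le_trans B.
  by rewrite mulrBl divfK.
Qed.

(** Cauchy's estimate, read off from [mean_derive]. *)
Lemma derive_bound f w d (rho M : R) : 0 < rho -> cderiv f w d ->
  (forall u, modulus (u - w) <= rho -> exists d, cderiv f u d) ->
  (forall u, modulus (u - w) <= rho -> modulus (f u - f w) <= M) ->
  modulus d <= 2 * M / rho.
Proof.
move=> r0 Hd H HM; have t0 := @tau_gt0 R.
have zr : modulus (RtoC rho) = rho by rewrite modulusR gtr0_norm.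
have z0 : RtoC rho != 0 by rewrite -modulus_gt0 zr.
have := @mean_derive f w (RtoC rho) d z0 Hd; rewrite zr => /(_ H) E.
have ut t : modulus (w + RtoC rho * cis t - w) = rho.
  by rewrite addrC addKr modulusM modulus_cis mulr1.
have B : modulus (circint (fun t => (f (w + RtoC rho * cis t) - f w) / (RtoC rho * cis t))) <=
    2 * (M / rho) * tau.
  apply: circint_bound.
    move=> t; apply: rccontM.
      apply: rccontB (rccont_cst _ _); apply: circle_ccurve => s.
      by have [|d' /cderiv_ccont//] := H (w + RtoC rho * cis s); rewrite ut.
    apply: (rccont_comp (f := GRing.inv)); first exact: rccontM (rccont_cst _ _) (rccont_cis _).
    by apply: cderiv_ccont (cderivV _); rewrite mulf_neq0 ?cis_neq0.
  move=> t; rewrite modulusM modulusV modulusM modulus_cis mulr1 zr.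
  by apply: ler_wpM2r; [rewrite invr_ge0 ltW|rewrite HM// ut].
move: B; rewrite E modulusM modulusR gtr0_norm// => B.
rewrite -(ler_pM2l t0); apply: le_trans B _.
by rewrite le_eqVlt; apply/orP; left; apply/eqP; ring.
Qed.

Lemma is_derive_path f u v t d : cderiv f (v + RtoC t * u) d ->
  is_derive t 1 (fun s => cre (f (v + RtoC s * u))) (cre (d * u)) /\
  is_derive t 1 (fun s => cim (f (v + RtoC s * u))) (cim (d * u)).
Proof.
move=> H.
have K : forall e : R, 0 < e -> exists2 del : R, 0 < del & forall h : R, `|h| < del ->
   modulus (f (v + RtoC (t + h) * u) - f (v + RtoC t * u) - RtoC h * (d * u)) <= e * `|h|.
  move=> e e0; have U0 := modulus_ge0 u.
  have U1 : 0 < modulus u + 1 by lra.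
  have [del d0 D] := H _ (divr_gt0 e0 U1).
  exists (del / (modulus u + 1)); first exact: divr_gt0.
  move=> h; rewrite ltr_pdivlMr// => hd.
  have E : modulus (RtoC h * u) = `|h| * modulus u by rewrite modulusM modulusR.
  have /D : modulus (RtoC h * u) < del.
    by rewrite E; apply: le_lt_trans hd; rewrite ler_wpM2l//; lra.
  have -> : v + RtoC t * u + RtoC h * u = v + RtoC (t + h) * u by rewrite RtoCD; ring.
  have -> : d * (RtoC h * u) = RtoC h * (d * u) by ring.
  move/le_trans; apply; rewrite E.
  have -> : e / (modulus u + 1) * (`|h| * modulus u) = e * `|h| * (modulus u / (modulus u + 1)).
    by field; lra.
  rewrite -[leRHS]mulr1 ler_wpM2l ?mulr_ge0// ?(ltW e0)//.
  by rewrite ler_pdivrMr//; lra.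
split; apply/is_derive_epsP => e /K[del d0 D]; exists del => // h /D B.
  by apply: le_trans B; apply: le_trans (cre_le_modulus _); rewrite !creB creZ (mulrC h).
by apply: le_trans B; apply: le_trans (cim_le_modulus _); rewrite !cimB cimZ (mulrC h).
Qed.

(** The real mean value theorem along the segment, for the real and for the imaginary
    part; hence the factor 2. *)
Lemma complex_mvt f (f' : C -> C) u v (K : R) :
  (forall t, 0 <= t <= 1 -> cderiv f (v + RtoC t * (u - v)) (f' (v + RtoC t * (u - v))) /\
     modulus (f' (v + RtoC t * (u - v))) <= K) ->
  modulus (f u - f v) <= 2 * K * modulus (u - v).
Proof.
move=> H.
pose p t := v + RtoC t * (u - v).
have p1 : p 1 = u by rewrite /p RtoC1 mul1r addrC subrK.
have p0 : p 0 = v by rewrite /p RtoC0 mul0r addr0.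
have HD t : 0 <= t <= 1 -> cderiv f (p t) (f' (p t)) by move=> /H[].
have HK t : 0 <= t <= 1 -> modulus (f' (p t)) <= K by move=> /H[].
have hre : `|cre (f u - f v)| <= K * modulus (u - v).
  have [||c] := @MVT_segment _ (fun s => cre (f (p s))) (fun s => cre (f' (p s) * (u - v))) 0 1 ler01.
  - move=> x; rewrite in_itv/= => /andP[x0 x1].
    have [|q _] := @is_derive_path f (u - v) v x (f' (p x)); first by apply: HD; lra.
    exact: q.
  - apply: continuous_in_subspaceT => x; rewrite inE/= in_itv/= => x01.
    have [|q _] := @is_derive_path f (u - v) v x (f' (p x)); first exact: HD.
    exact: is_derive_cont q.
  rewrite in_itv/= p1 p0 subr0 mulr1 creB => c01 ->.
  apply: le_trans (cre_le_modulus _) _; rewrite modulusM ler_wpM2r ?modulus_ge0//.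
  exact: HK.
have him : `|cim (f u - f v)| <= K * modulus (u - v).
  have [||c] := @MVT_segment _ (fun s => cim (f (p s))) (fun s => cim (f' (p s) * (u - v))) 0 1 ler01.
  - move=> x; rewrite in_itv/= => /andP[x0 x1].
    have [|_ q] := @is_derive_path f (u - v) v x (f' (p x)); first by apply: HD; lra.
    exact: q.
  - apply: continuous_in_subspaceT => x; rewrite inE/= in_itv/= => x01.
    have [|_ q] := @is_derive_path f (u - v) v x (f' (p x)); first exact: HD.
    exact: is_derive_cont q.
  rewrite in_itv/= p1 p0 subr0 mulr1 cimB => c01 ->.
  apply: le_trans (cim_le_modulus _) _; rewrite modulusM ler_wpM2r ?modulus_ge0//.
  exact: HK.
apply: le_trans (modulus_le _) _; lra.
Qed.

End Cauchy.

(** * Derivatives of holomorphic functions are holomorphic *)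

Section Regularity.
Context {R : realType}.
Local Notation C := (Cplx R).
Local Notation tau := (@tau R).
Implicit Types (f g G : C -> C) (z w u v h : C) (t s a b : R).

Lemma path_ball w u v (rho t : R) : modulus (u - w) <= rho -> modulus (v - w) <= rho ->
  0 <= t <= 1 -> modulus (v + RtoC t * (u - v) - w) <= rho.
Proof.
move=> uw vw /andP[t0 t1].
have -> : v + RtoC t * (u - v) - w = RtoC (1 - t) * (v - w) + RtoC t * (u - w).
  by rewrite RtoCD RtoC1 (_ : RtoC (- t) = - RtoC t); [ring|apply: C_ext; rewrite !cE ?oppr0].
apply: le_trans (modulusD _ _) _; rewrite !modulusM !modulusR !ger0_norm//; last lra.
nra.
Qed.

(** Goursat's theorem that a complex derivative is automatically holomorphic: the
    mean value formula for [f'] makes it locally bounded, then [f] is locally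
    Lipschitz, then so is [f'], and the same formula can be differentiated. *)
Lemma holo_derive f g w (rho : R) : 0 < rho ->
  (forall u, modulus (u - w) < rho -> cderiv f u (g u)) -> exists d, cderiv g w d.
Proof.
move=> rho0 Hg; have t0 := @tau_gt0 R.
have H u : modulus (u - w) < rho -> exists d, cderiv f u d by move=> /Hg; exists (g u).
have [d0 [d00 d0rho Bf]] : exists d : R, [/\ 0 < d, d <= rho &
    forall u, modulus (u - w) < d -> modulus (f u - f w) < 1/2].
  have e0 : 0 < 1/2 :> R by lra.
  have ww : modulus (w - w) < rho by rewrite subrr modulus0.
  have [d d0 D] := cderiv_ccont (Hg _ ww) e0.
  exists (Num.min d rho); rewrite lt_min d0 rho0 ge_min lexx orbT; split => // u.
  by rewrite lt_min => /andP[/D].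
pose r := d0 / 8; have r0 : 0 < r by rewrite /r; lra.
have r8 : d0 = 8 * r by rewrite /r; lra.
have tri u v (a b : R) : modulus (u - w) <= a -> modulus (v - u) <= b ->
    modulus (v - w) <= a + b.
  by move=> ua vb; apply: le_trans (modulus_triangle v u w) _; lra.
have HH u : modulus (u - w) <= 7 * r -> exists d, cderiv f u d.
  by move=> uw; apply: H; apply: le_lt_trans uw _; lra.
have HHg u : modulus (u - w) <= 7 * r -> cderiv f u (g u).
  by move=> uw; apply: Hg; apply: le_lt_trans uw _; lra.
(* Cauchy's estimate bounds [g] on the disc of radius [4 r], so [f] is Lipschitz there. *)
have gK u : modulus (u - w) <= 4 * r -> modulus (g u) <= 2 / r.
  move=> uw; rewrite -[2]mulr1; apply: (@derive_bound _ f u (g u) r 1 r0).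
  - by apply: HHg; lra.
  - by move=> v vu; apply: HH; have := tri _ _ _ _ uw vu; lra.
  - move=> v vu; have vw := tri _ _ _ _ uw vu.
    have h1 : modulus (f v - f w) < 1/2 by apply: Bf; apply: le_lt_trans vw _; lra.
    have h2 : modulus (f u - f w) < 1/2 by apply: Bf; apply: le_lt_trans uw _; lra.
    rewrite modulus_distC in h2; have := modulus_triangle (f v) (f w) (f u); lra.
pose K2 := 2 * (2 / r).
have K20 : 0 <= K2 by rewrite /K2 !mulr_ge0// invr_ge0 ltW.
have fL u v : modulus (u - w) <= 4 * r -> modulus (v - w) <= 4 * r ->
    modulus (f u - f v) <= K2 * modulus (u - v).
  move=> uw vw; apply: (@complex_mvt _ f g) => t t01.
  have := path_ball uw vw t01 => p4; split; last exact: gK.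
  by apply: HHg; lra.
have zr : modulus (RtoC r) = r by rewrite modulusR gtr0_norm.
have z0 : RtoC r != 0 by rewrite -modulus_gt0 zr.
pose c t := RtoC r * cis t.
have c0 t : c t != 0 by rewrite mulf_neq0// cis_neq0.
have cm t : modulus (c t) = r by rewrite /c modulusM modulus_cis mulr1.
have uc u t : modulus (u + c t - u) = r by rewrite addrC addKr cm.
have cc t : rccont (fun s => (c s)^-1) t.
  apply: (rccont_comp (f := GRing.inv)); last exact: cderiv_ccont (cderivV (c0 t)).
  exact: rccontM (rccont_cst _ _) (rccont_cis _).
have fc u t : modulus (u - w) <= 3 * r -> rccont (fun s => f (u + c s) - f u) t.
  move=> uw; apply: rccontB (rccont_cst _ _).
  apply: (rccont_comp (f := f)); first exact: rccont_circle.
  apply: cderiv_ccont (HHg _ _).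
  have ut := uc u t; have : modulus (u + c t - u) <= r by rewrite ut.
  by move=> /(tri _ _ _ _ uw); lra.
have gE u : modulus (u - w) <= 3 * r ->
    RtoC tau * g u = circint (fun t => (f (u + c t) - f u) / c t).
  move=> uw; rewrite (mean_derive z0 (d := g u))//; first by apply: HHg; lra.
  by move=> v; rewrite zr => vu; apply: HH; have := tri _ _ _ _ uw vu; lra.
have intc u t : modulus (u - w) <= 3 * r -> rccont (fun s => (f (u + c s) - f u) / c s) t.
  by move=> uw; apply: rccontM (fc _ _ uw) (cc t).
(* The Lipschitz bound passes from [f] to [g] through the mean value formula [gE]. *)
pose K3 := 2 * (2 * K2 / r).
have K30 : 0 <= K3.
  by apply: mulr_ge0 => //; apply: divr_ge0; [exact: mulr_ge0|exact: ltW].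
have gL u v : modulus (u - w) <= 3 * r -> modulus (v - w) <= 3 * r ->
    modulus (g u - g v) <= K3 * modulus (u - v).
  move=> uw vw.
  have : modulus (RtoC tau * (g u - g v)) <= 2 * (2 * K2 / r * modulus (u - v)) * tau.
    rewrite mulrBr (gE _ uw) (gE _ vw).
    rewrite -(circintB (fun t => intc _ t uw) (fun t => intc _ t vw)).
    apply: circint_bound; first by move=> t; exact: rccontB (intc _ t uw) (intc _ t vw).
    move=> t; rewrite -mulrBl modulusM modulusV cm mulrAC.
    apply: ler_wpM2r; first by rewrite invr_ge0 ltW.
    have hu : modulus (u + c t - w) <= 4 * r.
      by have := @tri u (u + c t) _ r uw; rewrite uc lexx => /(_ isT); lra.
    have hv : modulus (v + c t - w) <= 4 * r.
      by have := @tri v (v + c t) _ r vw; rewrite uc lexx => /(_ isT); lra.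
    have l1 := fL _ _ hu hv.
    have u4 : modulus (u - w) <= 4 * r by lra.
    have v4 : modulus (v - w) <= 4 * r by lra.
    have l2 := fL _ _ u4 v4.
    rewrite (_ : f (u + c t) - f u - (f (v + c t) - f v) =
      (f (u + c t) - f (v + c t)) - (f u - f v)); last ring.
    apply: le_trans (modulusB _ _) _.
    rewrite (_ : u + c t - (v + c t) = u - v) in l1; last ring.
    lra.
  rewrite modulusM modulusR gtr0_norm// => B; rewrite -(ler_pM2l t0).
  by apply: le_trans B _; rewrite /K3 le_eqVlt; apply/orP; left; apply/eqP; ring.
(* As [g] is Lipschitz, the Taylor remainder of [f] is quadratic. *)
pose Rem z h := f (z + h) - f z - g z * h.
have RemB z h : modulus (z - w) <= 2 * r -> modulus h <= r ->
    modulus (Rem z h) <= 2 * K3 * modulus h ^+ 2.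
  move=> zw hr.
  pose F xi := f xi - g z * xi.
  have -> : Rem z h = F (z + h) - F z by rewrite /Rem /F; ring.
  rewrite (_ : 2 * K3 * modulus h ^+ 2 = 2 * (K3 * modulus h) * modulus (z + h - z)); last first.
    by rewrite (_ : z + h - z = h); ring.
  apply: (@complex_mvt _ F (fun xi => g xi - g z)) => t t01.
  set p := z + RtoC t * (z + h - z).
  have pz : modulus (p - z) <= modulus h.
    rewrite /p (_ : _ - z = RtoC t * h); last ring.
    rewrite modulusM modulusR ger0_norm; last by lra.
    by have := modulus_ge0 h; nra.
  have pz' : modulus (p - z) <= r by lra.
  have pw : modulus (p - w) <= 3 * r by have := tri _ _ _ _ zw pz'; lra.
  split.
    have p7 : modulus (p - w) <= 7 * r by lra.
    have E1 := cderivD (HHg _ p7) (cderivZ (- g z) (cderiv_id p)).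
    rewrite mulr1 in E1; rewrite /F.
    by rewrite (_ : (fun xi => f xi - g z * xi) = fun xi => f xi + - g z * xi)//;
      apply/funext => xi; rewrite mulNr.
  have z3 : modulus (z - w) <= 3 * r by lra.
  by apply: le_trans (gL _ _ pw z3) _; rewrite ler_wpM2l.
have w3 : modulus (w - w) <= 3 * r by rewrite subrr modulus0 mulr_ge0// ltW.
have w2 : modulus (w - w) <= 2 * r by rewrite subrr modulus0 mulr_ge0// ltW.
have wc t : modulus (w + c t - w) <= 2 * r by rewrite uc; lra.
have gcont t : rccont (fun s => g (w + c s)) t.
  apply: (rccont_comp (f := g)); first exact: rccont_circle.
  move=> e e0; exists (Num.min (r / 2) (e / (K3 + 1))).
    by rewrite lt_min !divr_gt0//; lra.
  move=> v; rewrite lt_min => /andP[v1]; rewrite ltr_pdivlMr => [v2|]; last lra.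
  have vw : modulus (v - w) <= 3 * r.
    by have := @tri (w + c t) v (2 * r) (r / 2) (wc t) (ltW v1); lra.
  have wc3 : modulus (w + c t - w) <= 3 * r by rewrite uc; lra.
  apply: le_lt_trans (gL _ _ vw wc3) _.
  by apply: le_lt_trans v2; have := modulus_ge0 (v - (w + c t)); nra.
(* The derivative of [g], found by differentiating [gE] under the integral sign. *)
pose A := RtoC tau^-1 * circint (fun t => (g (w + c t) - g w) / c t).
exists A => e e0.
pose L := 2 * (4 * K3 / r).
have L0 : 0 <= L.
  by apply: mulr_ge0 => //; apply: divr_ge0; [exact: mulr_ge0|exact: ltW].
exists (Num.min r (e / (L + 1))).
  by rewrite lt_min r0 divr_gt0//; lra.
move=> h; rewrite lt_min => /andP[hr]; rewrite ltr_pdivlMr => [he|]; last lra.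
have hw3 : modulus (w + h - w) <= 3 * r by rewrite addrC addKr; lra.
have iB t : rccont (fun s => (g (w + c s) - g w) / c s) t.
  apply: rccontM (cc t); apply: rccontB (rccont_cst _ _); exact: gcont.
have E : RtoC tau * (g (w + h) - g w - A * h) =
    circint (fun t => (Rem (w + c t) h - Rem w h) / c t).
  have tA : RtoC tau * (A * h) = circint (fun t => h * ((g (w + c t) - g w) / c t)).
    rewrite circintZ// /A mulrA mulrA -RtoCM divff ?gt_eqF// RtoC1 mul1r mulrC//.
  rewrite mulrBr mulrBr tA (gE _ hw3) (gE _ w3).
  rewrite -(circintB (fun t => intc _ t hw3) (fun t => intc _ t w3)).
  rewrite -(circintB (fun t => rccontB (intc _ t hw3) (intc _ t w3))
    (fun t => rccontM (rccont_cst h t) (iB t))).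
  apply: circint_ext => t; rewrite /Rem.
  rewrite (_ : w + h + c t = w + c t + h); last ring.
  by field; rewrite c0.
have hr2 : modulus (RtoC tau * (g (w + h) - g w - A * h)) <= 2 * (4 * K3 * modulus h ^+ 2 / r) * tau.
  rewrite E; apply: circint_bound.
    move=> t.
    have -> : (fun s => (Rem (w + c s) h - Rem w h) / c s) = fun s =>
       ((f (w + h + c s) - f (w + h)) / c s - (f (w + c s) - f w) / c s) -
        h * ((g (w + c s) - g w) / c s).
      apply/funext => s; rewrite /Rem (_ : w + h + c s = w + c s + h); last ring.
      by field; rewrite c0.
    exact: rccontB (rccontB (intc _ t hw3) (intc _ t w3)) (rccontM (rccont_cst h t) (iB t)).
  move=> t; rewrite modulusM modulusV cm.
  apply: ler_wpM2r; first by rewrite invr_ge0 ltW.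
  apply: le_trans (modulusB _ _) _.
  have := RemB _ _ (wc t) (ltW hr); have := RemB _ _ w2 (ltW hr); lra.
move: hr2; rewrite modulusM modulusR gtr0_norm// => hr2.
have {hr2} : modulus (g (w + h) - g w - A * h) <= L * modulus h * modulus h.
  rewrite -(ler_pM2l t0); apply: le_trans hr2 _.
  by rewrite /L le_eqVlt; apply/orP; left; apply/eqP; ring.
move/le_trans; apply; have h0 := modulus_ge0 h.
by apply: ler_wpM2r => //; nra.
Qed.

End Regularity.

(** * Planar measure and rotations *)

Section PlanarMeasure.
Context {R : realType}.
Local Notation C := (Cplx R).
Local Notation tau := (@tau R).
Local Notation mu := (@lebesgue_measure R).
Local Notation RR := (measurableTypeR R * measurableTypeR R)%type.
Local Notation mu2 := (@lebesgue_measure R \x @lebesgue_measure R)%E.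

(** The product measure, packed as a sigma-finite measure so that Fubini's theorem
    can be applied to it together with a third variable. *)
Definition area : set RR -> \bar R := mu2.
HB.instance Definition _ := Measure.copy area mu2.

Lemma area_sigma_finite : sigma_finite setT area.
Proof.
exists (fun n => `]- n%:R, n%:R[%classic `*` `]- n%:R, n%:R[%classic).
  apply/seteqP; split=> // -[x y] _.
  exists (Num.truncn (`|x| + `|y|)).+1 => //=.
  have := truncnS_gt (`|x| + `|y|); set n := _.+1%:R => h.
  have := ler_norm x; have := ler_norm (- x); have := ler_norm y; have := ler_norm (- y).
  by rewrite !normrN !in_itv/=; have := normr_ge0 x; have := normr_ge0 y; split; lra.
move=> n; split; first exact: measurableX.
rewrite /area product_measure1E//= lebesgue_measure_itv/= lte_fin.
by case: ifP => _; rewrite ?mule0 -?EFinB -?EFinM ?ltry.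
Qed.

HB.instance Definition _ := Measure_isSigmaFinite.Build _ _ _ area area_sigma_finite.

Lemma lebesgue_measure_shift (a : R) (A : set R) : measurable A ->
  pushforward mu ((fun x => x + a) : _ -> measurableTypeR R) A = mu A.
Proof.
move=> mA; apply/esym/lebesgue_measure_unique => //=.
  exact: measurable_funD.
move=> _ _ [[c b]] _ <-; rewrite /pushforward.
have -> : (fun x => x + a) @^-1` `]c, b]%classic = `]c - a, b - a]%classic.
  by apply/seteqP; split=> x /=; rewrite !in_itv/= ltrBlDr lerBrDr.
rewrite !lebesgue_measure_itv/= !lte_fin ltrD2r.
by case: ifP => // _; rewrite -!EFinB; congr (_%:E); ring.
Qed.

Definition area_preserving (phi : RR -> RR) := measurable_fun setT phi /\
  forall X, measurable X -> area (phi @^-1` X) = area X.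

Lemma area_preserving_comp phi psi : area_preserving phi -> area_preserving psi -> area_preserving
  (phi \o psi).
Proof.
move=> [m1 h1] [m2 h2]; split; first exact: measurableT_comp.
move=> X mX; rewrite comp_preimage h2 ?h1//.
by rewrite -[X in measurable X]setTI; exact: m1.
Qed.

(** A measure on the plane is determined by its values on rectangles. *)
Lemma area_preserving_rect phi : measurable_fun setT phi ->
  (forall A B, measurable A -> measurable B -> area (phi @^-1` (A `*` B)) = (mu A * mu B)%E) ->
  area_preserving phi.
Proof.
move=> mphi H; split => // X mX; apply/esym.
exact: (product_measure_unique (m' := pushforward area phi)).
Qed.

(** By Tonelli's theorem: the vertical sections of the preimage of a rectangle are
    translates of its vertical side. *)
Lemma area_preserving_shear (b : R -> R) : measurable_fun setT b ->
  area_preserving (fun p => (p.1, p.2 + b p.1)).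
Proof.
move=> mb; apply: area_preserving_rect.
  apply: measurable_fun_pair => //; apply: measurable_funD => //.
  exact: measurableT_comp.
move=> A B mA mB.
rewrite /area /product_measure1 -[RHS]muleC -(integral_cst mu mA (mu B)).
rewrite [RHS]integral_mkcond; apply: eq_integral => x _.
rewrite patchE /=; case: ifPn => xA.
  rewrite (_ : xsection _ x = [set y | B (y + b x)]).
    exact: lebesgue_measure_shift.
  apply/seteqP; split => y; rewrite /xsection/= inE/=; first by case.
  by move=> By; split => //; rewrite inE in xA.
rewrite (_ : xsection _ x = set0) ?measure0//.
by apply/seteqP; split => y //; rewrite /xsection/= inE/= => -[]; rewrite notin_setE in xA.
Qed.

Lemma area_preserving_swap : area_preserving (fun p => (p.2, p.1)).
Proof.
apply: area_preserving_rect; first exact: measurable_swap.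
move=> A B mA mB; rewrite (_ : _ @^-1` _ = B `*` A); first by rewrite /area product_measure1E// muleC.
by apply/seteqP; split => -[x y] [].
Qed.

Lemma area_preserving_ext phi psi : phi =1 psi -> area_preserving phi -> area_preserving psi.
Proof. by move=> /funext ->. Qed.

Lemma area_preserving_shear1 (b : R) : area_preserving (fun p => (p.1 + b * p.2, p.2)).
Proof.
have mb : measurable_fun setT (fun x : measurableTypeR R => b * x : measurableTypeR R).
  exact: measurable_funM.
apply: area_preserving_ext (area_preserving_comp area_preserving_swap (area_preserving_comp
  (area_preserving_shear mb) area_preserving_swap)).
by case.
Qed.

Lemma area_preserving_shear2 (b : R) : area_preserving (fun p => (p.1, p.2 + b * p.1)).
Proof. by apply: area_preserving_shear; exact: measurable_funM. Qed.

Lemma area_preserving_translation (a b : R) : area_preserving (fun p => (p.1 + a, p.2 + b)).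
Proof.
have m k : measurable_fun setT (fun _ : measurableTypeR R => k : measurableTypeR R).
  exact: measurable_cst.
have := area_preserving_comp area_preserving_swap (area_preserving_comp (area_preserving_shear (m
  a)) (area_preserving_comp area_preserving_swap (area_preserving_shear (m b)))).
by apply: area_preserving_ext; case.
Qed.

(** A rotation is a product of three shears, the half turn a product of two
    quarter turns. *)
Lemma area_preserving_rotation (c s : R) : c ^+ 2 + s ^+ 2 = 1 ->
  area_preserving (fun p => (c * p.1 - s * p.2, s * p.1 + c * p.2)).
Proof.
have main (u v : R) : u ^+ 2 + v ^+ 2 = 1 -> u != -1 ->
    area_preserving (fun p => (u * p.1 - v * p.2, v * p.1 + u * p.2)).
  move=> uv u1; have u10 : 1 + u != 0 by apply/eqP => h; case/eqP: u1; lra.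
  (* The tangent of half the angle. *)
  pose t := v / (1 + u).
  apply: area_preserving_ext (area_preserving_comp (area_preserving_shear1 (- t))
    (area_preserving_comp (area_preserving_shear2 v) (area_preserving_shear1 (- t)))).
  case=> x y /=.
  have tv : t * (1 + u) = v by rewrite divfK.
  have vt : v * t = 1 - u.
    apply: (mulIf u10); rewrite -mulrA tv; lra.
  congr (_, _).
    transitivity ((1 - v * t) * x - (t * (1 + (1 - v * t))) * y); first by ring.
    rewrite vt (_ : 1 - (1 - u) = u); last ring.
    by rewrite tv.
  transitivity (v * x + (1 - v * t) * y); first by ring.
  by rewrite vt; ring.
move=> cs; have [c1|c1] := eqVneq c (-1); last exact: main.
have s0 : s = 0.
  by apply/eqP; rewrite -sqrf_eq0; apply/eqP; rewrite c1 in cs; lra.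
have q : area_preserving (fun p => (0 * p.1 - 1 * p.2, 1 * p.1 + 0 * p.2)).
  by apply: main; [rewrite expr0n expr1n add0r|rewrite eq_sym oppr_eq0 oner_eq0].
apply: area_preserving_ext (area_preserving_comp q q) => -[x y] /=.
by rewrite c1 s0; congr (_, _); ring.
Qed.

Lemma area_preserving_integral phi (F : RR -> \bar R) : area_preserving phi -> measurable_fun setT F ->
  (forall p, 0 <= F p)%E -> (\int[area]_p F (phi p) = \int[area]_p F p)%E.
Proof.
move=> [mphi H] mF F0.
transitivity (\int[pushforward area phi]_p F p)%E.
  by rewrite ge0_integral_pushforward.
by apply: eq_measure_integral => X mX _; exact: H.
Qed.

Definition rot (t : R) (p : RR) : RR :=
  (cos t * p.1 - sin t * p.2, sin t * p.1 + cos t * p.2).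

Lemma plane_rot t p : plane (rot t p) = plane p * cis t :> C.
Proof. by case: p => x y; apply: C_ext; rewrite !cE /=; ring. Qed.

Lemma area_preserving_rot t : area_preserving (rot t).
Proof. by apply: area_preserving_rotation; exact: cos2Dsin2. Qed.

Lemma measurable_rot_joint : measurable_fun setT (fun q : RR * measurableTypeR R => rot q.2 q.1).
Proof.
have mc : measurable_fun setT (fun q : RR * measurableTypeR R => cos q.2 : measurableTypeR R).
  apply: (@measurableT_comp _ _ _ _ _ _ (@cos R)) => //.
  exact: continuous_measurable_fun (@continuous_cos R).
have ms : measurable_fun setT (fun q : RR * measurableTypeR R => sin q.2 : measurableTypeR R).
  apply: (@measurableT_comp _ _ _ _ _ _ (@sin R)) => //.
  exact: continuous_measurable_fun (@continuous_sin R).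
have m1 : measurable_fun setT (fun q : RR * measurableTypeR R => q.1.1).
  exact: (measurableT_comp measurable_fst measurable_fst).
have m2 : measurable_fun setT (fun q : RR * measurableTypeR R => q.1.2).
  exact: (measurableT_comp measurable_snd measurable_fst).
apply: measurable_fun_pair.
  by apply: measurable_funB; exact: measurable_funM.
by apply: measurable_funD; exact: measurable_funM.
Qed.

(** Multiplying by the indicator of a period lets Fubini's theorem run over the whole
    line of angles. *)
Definition period_ind (t : R) : \bar R := (\1_(`[0, tau]%classic) t)%:E.

Lemma period_ind_integral : (\int[mu]_t period_ind t = tau%:E)%E.
Proof.
rewrite /period_ind integral_indic; [|by []|exact: measurable_itv].
rewrite setIT; have := @lebesgue_measure_itv R `[0, tau].
by rewrite /= lte_fin tau_gt0 -EFinB subr0.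
Qed.

Lemma measurable_avg (F : RR -> \bar R) : measurable_fun setT F ->
  measurable_fun setT (fun q : RR * measurableTypeR R => F (rot q.2 q.1) * period_ind q.2)%E.
Proof.
move=> mF; apply: emeasurable_funM; first exact: measurableT_comp measurable_rot_joint.
apply/measurable_EFinP.
apply: (@measurableT_comp _ _ _ _ _ _ (\1_(`[0, tau]%classic : set (measurableTypeR R)) : _ -> R)) => //.
Qed.

Lemma period_indE (f : R -> \bar R) :
  (\int[mu]_t (f t * period_ind t) = \int[mu]_(t in `[0%R, tau]) f t)%E.
Proof.
rewrite [RHS]integral_mkcond; apply: eq_integral => t _.
rewrite patchE /period_ind indicE; case: ifP => _; first by rewrite mule1.
by rewrite mule0.
Qed.

(** For each angle the rotated function has the same integral; exchange the order of
    integration. *)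
Lemma rotation_average_ge0 (F : RR -> \bar R) : measurable_fun setT F ->
  (forall p, 0 <= F p)%E ->
  (tau%:E * \int[area]_p F p = \int[area]_p \int[mu]_(t in `[0%R, tau]) F (rot t p))%E.
Proof.
move=> mF F0.
have ti0 t : (0 <= period_ind t)%E by rewrite lee_fin.
pose f (q : RR * measurableTypeR R) := (F (rot q.2 q.1) * period_ind q.2)%E.
have := @fubini_tonelli _ _ _ _ R area mu f (measurable_avg mF) _.
rewrite /f /= => /(_ (fun q => mule_ge0 (F0 _) (ti0 _))) E.
under [RHS]eq_integral do rewrite -period_indE.
rewrite E; transitivity ((\int[mu]_t period_ind t) * \int[area]_p F p)%E.
  by rewrite period_ind_integral.
rewrite -ge0_integralZr//; last first.
- by apply: integral_ge0 => p _; exact: F0.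
- apply/measurable_EFinP; exact: measurable_indic.
apply: eq_integral => t _.
rewrite ge0_integralZr//; last first.
  apply: measurableT_comp => //; exact: (area_preserving_rot t).1.
rewrite (area_preserving_integral (area_preserving_rot t))// muleC//.
Qed.

Lemma rotation_average (F : RR -> \bar R) : area.-integrable setT F ->
  (tau%:E * \int[area]_p F p = \int[area]_p \int[mu]_(t in `[0%R, tau]) F (rot t p))%E.
Proof.
move=> iF; have mF : measurable_fun setT F by exact: measurable_int iF.
pose f (q : RR * measurableTypeR R) := (F (rot q.2 q.1) * period_ind q.2)%E.
have ti0 t : (0 <= period_ind t)%E by rewrite lee_fin.
have mabs : measurable_fun setT (fun p => `|F p|%E) by exact: measurableT_comp.
have If : (area \x mu)%E.-integrable setT f.
  apply/integrable12ltyP; first exact: measurable_avg.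
  rewrite /f /=.
  under eq_integral do under eq_integral do rewrite abseM (gee0_abs (ti0 _)).
  under eq_integral do rewrite (period_indE (fun t => `|F (rot t _)|%E)).
  have := rotation_average_ge0 mabs => /(_ (fun p => abse_ge0 _)) E.
  rewrite -E.
  by apply: lte_mul_pinfty; rewrite ?lee_fin ?ltW ?tau_gt0//; case/integrableP: iF.
under [RHS]eq_integral do rewrite -period_indE.
rewrite (Fubini If) /f /=.
have fin : (\int[area]_p F p)%E \is a fin_num by exact: integrable_fin_num iF.
have shift t : (\int[area]_p F (rot t p) = \int[area]_p F p)%E.
  rewrite integralE [RHS]integralE; congr (_ - _)%E.
    rewrite -(area_preserving_integral (area_preserving_rot t) (measurable_funepos mF))//.
    by apply: eq_integral => p _; rewrite !funeposE.
  rewrite -(area_preserving_integral (area_preserving_rot t) (measurable_funeneg mF))//.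
  by apply: eq_integral => p _; rewrite !funenegE.
under [RHS]eq_integral => t _.
  rewrite (_ : (\int[area]_p (F (rot t p) * period_ind t) = \int[area]_p F p * period_ind t)%E); last first.
    rewrite /period_ind indicE; case: (t \in _) => /=.
      by under eq_integral do rewrite mule1; rewrite mule1 shift.
    by under eq_integral do rewrite mule0; rewrite mule0 integral0.
  over.
rewrite -(fineK fin) integralZl//; first by rewrite period_ind_integral muleC.
apply/integrableP; split; first by apply/measurable_EFinP; exact: measurable_indic.
under eq_integral do rewrite (gee0_abs (ti0 _)).
by rewrite period_ind_integral ltry.
Qed.

End PlanarMeasure.

(** * Averages over discs *)

Section PlaneContinuity.
Context {R : realType}.
Local Notation C := (Cplx R).
Local Notation tau := (@tau R).
Local Notation mu := (@lebesgue_measure R).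
Local Notation RR := (measurableTypeR R * measurableTypeR R)%type.
Local Notation area := (@area R).
Implicit Types (f g : C -> C) (z w u v : C).

Definition openC (U : set C) := forall z, U z -> exists2 e : R, 0 < e &
  forall w, modulus (w - z) < e -> U w.

(** An open set is the union of the countably many squares with rational data that it
    contains. *)
Lemma openC_measurable (U : set C) : openC U -> measurable (plane @^-1` U : set RR).
Proof.
move=> oU.
pose box (q : rat * rat * rat) : set RR :=
  `]ratr q.1.1 - ratr q.2, ratr q.1.1 + ratr q.2[%classic `*`
  `]ratr q.1.2 - ratr q.2, ratr q.1.2 + ratr q.2[%classic.
pose F q := if `[< box q `<=` plane @^-1` U >] then box q else set0.
have -> : plane @^-1` U = \bigcup_q F q.
  apply/seteqP; split=> [[x y] /= Uxy|p [q _]]; last first.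
    by rewrite /F; case: asboolP => // bq /bq.
  have [e e0 eU] := oU _ Uxy.
  have [r] : exists r : rat, ratr r \in `](e / 8)%R, (e / 4)%R[ by apply: rat_in_itvoo; lra.
  rewrite in_itv/= => /andP[r1 r2].
  have [q1] : exists r' : rat, ratr r' \in `](x - ratr r)%R, (x + ratr r)%R[ by apply: rat_in_itvoo; lra.
  have [q2] : exists r' : rat, ratr r' \in `](y - ratr r)%R, (y + ratr r)%R[ by apply: rat_in_itvoo; lra.
  rewrite !in_itv/= => /andP[y1 y2] /andP[x1 x2].
  exists (q1, q2, r) => //; rewrite /F asboolT.
    by rewrite /box/= !in_itv/=; split; lra.
  move=> [a b]; rewrite /box /= !in_itv/= => -[/andP[a1 a2] /andP[b1 b2]].
  apply: eU; apply: le_lt_trans (modulus_le _) _; rewrite creB cimB /=.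
  have h1 : `|a - x| <= 2 * ratr r by rewrite ler_norml; lra.
  have h2 : `|b - y| <= 2 * ratr r by rewrite ler_norml; lra.
  lra.
apply: countable_bigcupT_measurable; first exact: countableP.
by move=> q; rewrite /F; case: ifP => // _; exact: measurableX.
Qed.

Definition rcontC (h : C -> R) z := forall e : R, 0 < e -> exists2 del : R, 0 < del &
  forall w, modulus (w - z) < del -> `|h w - h z| < e.

Lemma rcontC_re f z : ccont f z -> rcontC (fun w => cre (f w)) z.
Proof.
move=> H e /H[d d0 D]; exists d => // w /D; apply: le_lt_trans.
by rewrite -creB cre_le_modulus.
Qed.
Lemma rcontC_im f z : ccont f z -> rcontC (fun w => cim (f w)) z.
Proof.
move=> H e /H[d d0 D]; exists d => // w /D; apply: le_lt_trans.
by rewrite -cimB cim_le_modulus.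
Qed.
Lemma rcontC_modulus f z : ccont f z -> rcontC (fun w => modulus (f w)) z.
Proof.
move=> H e /H[d d0 D]; exists d => // w /D; apply: le_lt_trans.
have := modulus_rev (f w) (f z); have := modulus_rev (f z) (f w).
by rewrite (modulus_distC (f z)) ler_norml => *; lra.
Qed.
Lemma rcontCM (h k : C -> R) z : rcontC h z -> rcontC k z -> rcontC (fun w => h w * k w) z.
Proof.
move=> H K e e0; set A := `|h z|; set B := `|k z|.
have A0 : 0 <= A by exact: normr_ge0.
have B0 : 0 <= B by exact: normr_ge0.
have e1 : 0 < Num.min 1 (e / (2 * (B + 1))) by rewrite lt_min ltr01 divr_gt0//; lra.
have e2 : 0 < e / (2 * (A + 1)) by rewrite divr_gt0//; lra.
have [d1 d10 D1] := H _ e1; have [d2 d20 D2] := K _ e2.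
exists (Num.min d1 d2); first by rewrite lt_min d10.
move=> w; rewrite lt_min => /andP[/D1 + /D2].
rewrite lt_min => /andP[h1 h2] h3.
have -> : h w * k w - h z * k z = h w * (k w - k z) + (h w - h z) * k z by ring.
have hA : `|h w| <= A + 1.
  by rewrite -(subrK (h z) (h w)) (le_trans (ler_normD _ _))// addrC lerD2l ltW.
rewrite (le_lt_trans (ler_normD _ _))// !normrM -/B.
rewrite ltr_pdivlMr in h2; last lra; rewrite ltr_pdivlMr in h3; last lra.
have := normr_ge0 (h w - h z); have := normr_ge0 (k w - k z); have := normr_ge0 (h w).
by nra.
Qed.
Lemma rcontC_sqr (h : C -> R) z : rcontC h z -> rcontC (fun w => h w ^+ 2) z.
Proof. by move=> H; have := rcontCM H H; under eq_fun do rewrite -expr2. Qed.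

Lemma rcontC_curve (h : C -> R) (g : R -> C) t : rccont g t -> rcontC h (g t) ->
  {for t, continuous (fun s => h (g s))}.
Proof.
move=> G H; apply/cont_epsP => e /H[d d0 D]; have [d' d'0 D'] := G _ d0.
by exists d' => // s /D' /D.
Qed.

Lemma rcontC_measurable (U : set C) (h : C -> R) : openC U ->
  (forall z, U z -> rcontC h z) ->
  measurable_fun (plane @^-1` U : set RR) (fun p => h (plane p)).
Proof.
move=> oU hc.
apply: (measurability _ (RGenOInfty.measurableE R)).
move=> _ [_ [x ->] <-].
rewrite (_ : _ `&` _ = plane @^-1` [set z | U z /\ x < h z]); last first.
  by apply/seteqP; split=> p; rewrite /= in_itv/= andbT.
apply: openC_measurable => z [Uz xz].
have [e1 e10 E1] := oU _ Uz.
have xz0 : 0 < h z - x by lra.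
have [e2 e20 E2] := hc _ Uz _ xz0.
exists (Num.min e1 e2); first by rewrite lt_min e10.
move=> w; rewrite lt_min => /andP[/E1 Uw /E2 hw]; split => //.
by move: hw; rewrite ltr_norml => /andP[? ?]; lra.
Qed.

Definition plane_ball (rho : R) : set RR := [set p | modulus (plane p : C) < rho].

Lemma openC_ball (w : C) (rho : R) : openC [set z | modulus (z - w) < rho].
Proof.
move=> z /= zw; exists (rho - modulus (z - w)); first lra.
by move=> v /= vz; have := modulus_triangle v z w; lra.
Qed.
Lemma openC_disc (rho : R) : openC [set z : C | modulus z < rho].
Proof.
rewrite (_ : [set z | modulus z < rho] = [set z | modulus (z - 0) < rho]).
  exact: openC_ball.
by apply/seteqP; split=> z /=; rewrite subr0.
Qed.

Lemma measurable_plane_ball rho : measurable (plane_ball rho).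
Proof. exact: (openC_measurable (@openC_disc rho)). Qed.

Lemma plane_ball_rot rho t p : plane_ball rho (rot t p) = plane_ball rho p.
Proof. by rewrite /plane_ball /mkset plane_rot modulusM modulus_cis mulr1. Qed.

Lemma int_cont a b (u : R -> R) : cont_on a b u ->
  (\int[mu]_(t in `[a, b]) (u t)%:E = (RI a b u)%:E)%E.
Proof.
by move=> U; rewrite /RI /Rintegral fineK// integrable_fin_num//; exact: cont_on_integrable.
Qed.

(** The integral of a nonnegative function is the supremum of the integrals of the
    simple functions below it, and this is monotone without any measurability. It
    spares the measurability of every function that is only estimated from above. *)
Lemma le_integral_nonmeasurable d (T : measurableType d) (m : {measure set T -> \bar R})
    (D : set T) (f g : T -> \bar R) : (forall x, D x -> 0 <= f x)%E ->
  (forall x, D x -> f x <= g x)%E -> (\int[m]_(x in D) f x <= \int[m]_(x in D) g x)%E.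
Proof.
move=> f0 fg; have g0 x : D x -> (0 <= g x)%E by move=> Dx; exact: le_trans (f0 _ Dx) (fg _ Dx).
rewrite !ge0_integralE//; apply: ereal_sup_le => _ [k kf <-]; exists k => // x.
apply: le_trans (kf x) _; rewrite !patchE; case: ifPn => // xD.
by apply: fg; rewrite inE in xD.
Qed.

Section average.
Variables (rho : R) (h : C -> R).
Hypothesis hc : forall z, modulus z < rho -> rcontC h z.
Let F : RR -> \bar R := (fun p => (h (plane p))%:E) \_ (plane_ball rho).

Let mF : measurable_fun setT F.
Proof.
apply/(measurable_restrictT _ (measurable_plane_ball rho)).
by apply/measurable_EFinP; apply: (rcontC_measurable (@openC_disc rho)).
Qed.

Let avgE : (\int[area]_p \int[mu]_(t in `[0%R, tau]) F (rot t p) =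
  \int[area]_(p in plane_ball rho) (RI 0 tau (fun t => h (plane p * cis t)))%:E)%E.
Proof.
rewrite [RHS]integral_mkcond; apply: eq_integral => p _; rewrite patchE.
case: ifPn => pD; rewrite ?inE ?notin_setE in pD.
  rewrite -int_cont.
    apply: eq_integral => t _; rewrite /F patchE mem_set ?plane_ball_rot//.
    by rewrite plane_rot.
  move=> t _; apply: rcontC_curve; first exact: rccontM (rccont_cst _ _) (rccont_cis _).
  by apply: hc; rewrite modulusM modulus_cis mulr1.
rewrite integral0_eq// => t _; rewrite /F patchE memNset//.
by rewrite plane_ball_rot.
Qed.

Lemma average_ge0 : (forall z, 0 <= h z) ->
  (tau%:E * \int[area]_(p in plane_ball rho) (h (plane p))%:E =
   \int[area]_(p in plane_ball rho) (RI 0 tau (fun t => h (plane p * cis t)))%:E)%E.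
Proof.
move=> h0; rewrite integral_mkcond -avgE; apply: (rotation_average_ge0 mF) => p.
by rewrite /F patchE; case: ifP => //; rewrite lee_fin.
Qed.

Lemma average_integrable : area.-integrable (plane_ball rho) (fun p => (h (plane p))%:E) ->
  (tau%:E * \int[area]_(p in plane_ball rho) (h (plane p))%:E =
   \int[area]_(p in plane_ball rho) (RI 0 tau (fun t => h (plane p * cis t)))%:E)%E.
Proof.
move=> ih; rewrite integral_mkcond -avgE; apply: rotation_average.
by apply/integrable_restrict; rewrite ?setTI//; exact: measurable_plane_ball.
Qed.
End average.

Lemma area_ball_lt (rho : R) : (area (plane_ball rho) < +oo)%E.
Proof.
have [r0|r0] := leP rho 0.
  rewrite (_ : plane_ball rho = set0) ?measure0 ?ltry//.
  apply/seteqP; split=> // p /= h; have := modulus_ge0 (plane p : C).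
  by move: h; rewrite /plane_ball /mkset; lra.
apply: (@le_lt_trans _ _ (area (`]- rho, rho[%classic `*` `]- rho, rho[%classic))).
  apply: le_measure; rewrite ?inE; [exact: measurable_plane_ball|exact: measurableX|].
  move=> [x y]; rewrite /plane_ball/= => h; have := cre_le_modulus (plane (x, y) : C).
  have := cim_le_modulus (plane (x, y) : C); rewrite /= !in_itv/= !ler_norml.
  by move=> /andP[? ?] /andP[? ?]; split; lra.
rewrite /area product_measure1E//= lebesgue_measure_itv/= lte_fin.
by case: ifP => _; rewrite ?mule0 -?EFinB -?EFinM ?ltry.
Qed.

(** The square of side [rho] centred at the origin fits into the disc. *)
Lemma area_ball_ge (rho : R) : 0 <= rho -> ((rho ^+ 2)%:E <= area (plane_ball rho))%E.
Proof.
move=> r0; pose a := rho / 2.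
have : area (`]- a, a[%classic `*` `]- a, a[%classic) = (rho ^+ 2)%:E.
  rewrite /area product_measure1E//= lebesgue_measure_itv/= lte_fin.
  case: ifPn => h; first by rewrite -EFinB -EFinM; congr (_%:E); rewrite /a; field.
  have -> : rho = 0 by rewrite /a in h; lra.
  by rewrite mule0 expr0n.
move=> <-; apply: le_measure; rewrite ?inE; [exact: measurableX|exact: measurable_plane_ball|].
move=> [x y]; rewrite /= !in_itv/= => -[/andP[x1 x2] /andP[y1 y2]].
rewrite /plane_ball /mkset; apply: le_lt_trans (modulus_le _) _ => /=.
have h1 : `|x| < a by rewrite ltr_norml; lra.
have h2 : `|y| < a by rewrite ltr_norml; lra.
by rewrite /a in h1 h2; lra.
Qed.

Lemma RI_ge0 a b (u : R -> R) : (forall t, a <= t <= b -> 0 <= u t) -> 0 <= RI a b u.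
Proof. by move=> H; apply: Rintegral_ge0 => t /=; rewrite in_itv/=; exact: H. Qed.

Lemma cont_on_sqr a b (u : R -> R) : cont_on a b u -> cont_on a b (fun t => u t ^+ 2).
Proof.
move=> U t th; rewrite (_ : (fun t => u t ^+ 2) = fun t => u t * u t).
  by apply: continuousM; exact: U.
by apply/funext.
Qed.

(** The variance of [u] over a period is nonnegative. *)
Lemma RI_sqr (u : R -> R) : cont_on 0 tau u ->
  (RI 0 tau u) ^+ 2 <= tau * RI 0 tau (fun t => u t ^+ 2).
Proof.
move=> U; have t0 := @tau_gt0 R; set I := RI 0 tau u; pose m := I / tau.
have U2 : cont_on 0 tau (fun t => u t ^+ 2) by exact: cont_on_sqr.
have cm : cont_on 0 tau (fun t => 2 * m * u t) by exact: cont_onZ.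
have cc : cont_on 0 tau (fun=> m ^+ 2) by move=> t _; exact: cont_cst.
have c1 : cont_on 0 tau (fun t => u t ^+ 2 - 2 * m * u t).
  by move=> t th; apply: continuousB; [exact: U2|exact: cm].
have c2 : cont_on 0 tau (fun t => u t ^+ 2 - 2 * m * u t + m ^+ 2).
  by move=> t th; apply: continuousD; [exact: c1|exact: cc].
have : 0 <= RI 0 tau (fun t => u t ^+ 2 - 2 * m * u t + m ^+ 2).
  by apply: RI_ge0 => t _; rewrite (_ : _ + _ = (u t - m) ^+ 2) ?sqr_ge0//; ring.
rewrite RID// RIB// RIZ// RI_cst ?(ltW t0)// -/I subr0 /m.
set Q := RI 0 tau _ => h.
have : 0 <= tau * (Q - 2 * (I / tau) * I + (I / tau) ^+ 2 * tau) by rewrite mulr_ge0// ltW.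
rewrite (_ : tau * _ = tau * Q - I ^+ 2); first by rewrite subr_ge0.
by field; rewrite gt_eqF.
Qed.

(** Subharmonicity of [|g|^2], from the mean value property on each circle and
    [RI_sqr]. *)
Lemma area_mean_ge g w (rho : R) : 0 <= rho ->
  (forall u, modulus (u - w) < rho -> exists d, cderiv g u d) ->
  ((rho ^+ 2 * modulus (g w) ^+ 2)%:E <=
   \int[area]_(p in plane_ball rho) (modulus (g (w + plane p)) ^+ 2)%:E)%E.
Proof.
move=> r0 H; have t0 := @tau_gt0 R.
have gc z : modulus z < rho -> ccont (fun v => g (w + v)) z.
  move=> zr; have [|d Hd] := H (w + z); first by rewrite addrC addKr.
  have Hs := cderivD (cderiv_cst w z) (cderiv_id z).
  exact: cderiv_ccont (cderiv_comp Hs Hd).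
pose h z := modulus (g (w + z)) ^+ 2.
have hc z : modulus z < rho -> rcontC h z.
  by move=> /gc G; apply: rcontC_sqr; exact: rcontC_modulus.
have h0 z : 0 <= h z by exact: sqr_ge0.
have E := average_ge0 hc h0.
rewrite -(@lee_pmul2l _ tau%:E) ?lte_fin// E.
apply: (@le_trans _ _ (\int[area]_(p in plane_ball rho) (tau * modulus (g w) ^+ 2)%:E)%E).
  rewrite integral_cst; last exact: measurable_plane_ball.
  rewrite -EFinM mulrCA [in leRHS]muleC EFinM lee_pmul ?lee_fin//.
  - exact: sqr_ge0.
  - by rewrite mulr_ge0 ?sqr_ge0// ltW.
  - exact: area_ball_ge.
have hcv z : modulus z < rho -> forall t, {for t, continuous (fun t => h (z * cis t))}.
  move=> zr t; apply: rcontC_curve; first exact: rccontM (rccont_cst _ _) (rccont_cis _).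
  by apply: hc; rewrite modulusM modulus_cis mulr1.
apply: le_integral_nonmeasurable => [p _|p pr].
  by rewrite lee_fin mulr_ge0 ?sqr_ge0// ltW.
rewrite lee_fin; set z := plane p.
have zr : modulus z < rho by exact: pr.
have [z0|z0] := eqVneq z 0.
  rewrite z0; under RI_ext do rewrite mul0r.
  by rewrite RI_cst ?(ltW t0)// /h addr0 subr0 [leRHS]mulrC.
have gcv : ccurve (fun t => g (w + z * cis t)).
  move=> t; apply: (rccont_comp (f := fun v => g (w + v))).
    exact: rccontM (rccont_cst _ _) (rccont_cis _).
  by apply: gc; rewrite modulusM modulus_cis mulr1.
have M := mean_value z0 (fun u (uz : modulus (u - w) <= modulus z) => H u (le_lt_trans uz zr)).
have cr : cont_on 0 tau (fun t => cre (g (w + z * cis t))) by exact: ccurve_re.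
have ci : cont_on 0 tau (fun t => cim (g (w + z * cis t))) by exact: ccurve_im.
have E2 : RI 0 tau (fun t => h (z * cis t)) =
    RI 0 tau (fun t => cre (g (w + z * cis t)) ^+ 2) + RI 0 tau (fun t => cim (g (w + z * cis t)) ^+ 2).
  by rewrite -RID; [apply: RI_ext => t _; rewrite /h modulus_sqr|exact: cont_on_sqr|exact: cont_on_sqr].
have Mr : RI 0 tau (fun t => cre (g (w + z * cis t))) = tau * cre (g w).
  by have := congr1 cre M; rewrite creZ.
have Mi : RI 0 tau (fun t => cim (g (w + z * cis t))) = tau * cim (g w).
  by have := congr1 cim M; rewrite cimZ.
have := RI_sqr cr; have := RI_sqr ci; rewrite Mr Mi E2 modulus_sqr.
have sq (x : R) : (tau * x) ^+ 2 = tau * (tau * x ^+ 2) by ring.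
rewrite !sq; set A := RI _ _ _; set B := RI _ _ _ => h1 h2.
rewrite -(ler_pM2l t0); lra.
Qed.

End PlaneContinuity.

(** * Functions with vanishing circle coefficients *)

Section Completeness.
Context {R : realType}.
Local Notation C := (Cplx R).
Local Notation tau := (@tau R).
Local Notation mu := (@lebesgue_measure R).
Local Notation RR := (measurableTypeR R * measurableTypeR R)%type.
Local Notation area := (@area R).
Implicit Types (f g : C -> C) (z w u v : C).

Lemma cis_surj z : modulus z = 1 -> exists t : R, [/\ 0 <= t, t < tau & z = cis t].
Proof.
move=> z1; have := modulus_sqr z; rewrite z1 expr1n => /esym zz.
set c := cre z in zz *; set s := cim z in zz *.
have c1 : -1 <= c <= 1.
  by have := cre_le_modulus z; rewrite z1 ler_norml.
have [a0 api] : 0 <= acos c /\ acos c <= pi by rewrite acos_ge0// acos_lepi.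
have ca : cos (acos c) = c by rewrite acosK// in_itv.
have sa : sin (acos c) = `|s|.
  rewrite sin_acos// -sqrtr_sqr; congr Num.sqrt; lra.
have p0 := pi_gt0 R.
have [s0|s0] := leP 0 s.
  exists (acos c); split => //; first by rewrite /tau; lra.
  by apply: C_ext; rewrite /= ?ca ?sa ?ger0_norm.
exists (tau - acos c); rewrite /tau; split; first lra.
  have : acos c != 0 by apply/eqP => h; move: sa; rewrite h sin0 ltr0_norm// => sa; lra.
  move=> h; have a00 : 0 < acos c by rewrite lt_def h a0.
  lra.
have E : cis (2 * pi - acos c) = (cis (acos c))^* :> C.
  by rewrite addrC -/tau cisDtau cisN.
by rewrite E; apply: C_ext; rewrite !cE /= ?ca ?sa// ltr0_norm// opprK.
Qed.

Lemma RI_translate a b (s : R) (u : R -> R) : continuous u ->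
  RI a b (fun t => u (t + s)) = RI (a + s) (b + s) u.
Proof.
move=> U; rewrite /RI /Rintegral; congr fine; apply/esym.
have m : measurable_fun setT ((fun x => x + s) : measurableTypeR R -> measurableTypeR R).
  exact: measurable_funD.
have pre : (fun x : measurableTypeR R => x + s) @^-1` `[a + s, b + s]%classic = `[a, b]%classic.
  by apply/seteqP; split=> x /=; rewrite !in_itv/= !lerD2r.
transitivity (\int[pushforward mu ((fun x => (x + s)%R) : _ -> measurableTypeR R)]_(t in `[(a +
  s)%R, (b + s)%R]) (u t)%:E)%E.
  by apply: eq_measure_integral => A mA _; exact/esym/lebesgue_measure_shift.
rewrite integral_pushforward//.
- by rewrite pre.
- by apply/measurable_EFinP; exact: continuous_measurable_fun.
- rewrite pre; apply: (cont_on_integrable (u := fun t => u (t + s))) => t _.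
  apply: (continuous_comp (f := fun t => t + s)); last exact: U.
  by apply: continuousD => //; exact: cst_continuous.
Qed.

Lemma RI_periodic (s : R) (u : R -> R) : continuous u -> (forall t, u (t + tau) = u t) ->
  0 <= s <= tau -> RI 0 tau (fun t => u (t + s)) = RI 0 tau u.
Proof.
move=> U P /andP[s0 s1]; rewrite RI_translate// add0r.
have cu a b : cont_on a b u by exact: continuous_cont_on.
rewrite (@RI_split _ s tau (tau + s))//; last by rewrite s1 lerDl.
rewrite (@RI_split _ 0 s tau)//; last by rewrite s0.
rewrite addrC; congr (_ + _).
have := @RI_translate 0 s tau u U; rewrite add0r (addrC s) => <-.
by apply: RI_ext => t _; rewrite P.
Qed.

Lemma circint_rotate (g : R -> C) (s : R) : ccurve g -> (forall t, g (t + tau) = g t) ->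
  0 <= s <= tau -> circint (fun t => g (t + s)) = circint g.
Proof.
move=> G P sr; apply: C_ext => /=.
  apply: (RI_periodic (u := fun t => cre (g t))) => //; last by move=> t; rewrite P.
  by move=> t; exact: rccont_re.
apply: (RI_periodic (u := fun t => cim (g t))) => //; last by move=> t; rewrite P.
by move=> t; exact: rccont_im.
Qed.

(** The circle integral of a function holomorphic on the punctured disc depends
    neither on the radius nor on the starting point. *)
Lemma circint_indep f z v : z != 0 -> v != 0 -> modulus z < 1 -> modulus v < 1 ->
  (forall u, 0 < modulus u < 1 -> exists d, cderiv f u d) ->
  circint (fun t => f (z * cis t)) = circint (fun t => f (v * cis t)).
Proof.
have radial u (r : R) : u != 0 -> modulus u < 1 -> 0 < r <= 1 ->
    (forall u, 0 < modulus u < 1 -> exists d, cderiv f u d) ->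
    circint (fun t => f (RtoC r * u * cis t)) = circint (fun t => f (u * cis t)).
  move=> u0 u1 r01 H; have [r0 r1] := andP r01.
  have := @circint_radius R f 0 u r r01.
  have e1 : (fun t => f (0 + RtoC r * u * cis t)) = (fun t => f (RtoC r * u * cis t)).
    by apply/funext => t; rewrite add0r.
  have e2 : (fun t => f (0 + u * cis t)) = (fun t => f (u * cis t)).
    by apply/funext => t; rewrite add0r.
  rewrite e1 e2; apply => w; rewrite subr0 => /andP[w1 w2]; apply: H.
  rewrite (le_lt_trans w2)// andbT; apply: lt_le_trans w1.
  by rewrite mulr_gt0// modulus_gt0.
wlog : z v / modulus v <= modulus z.
  move=> W z0 v0 z1 v1 H; have [vz|/ltW zv] := leP (modulus v) (modulus z).
    exact: W.
  by apply/esym; apply: W.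
move=> vz z0 v0 z1 v1 H.
have Z0 : 0 < modulus z by rewrite modulus_gt0.
have V0 : 0 < modulus v by rewrite modulus_gt0.
pose r := modulus v / modulus z.
have r01 : 0 < r <= 1 by rewrite /r divr_gt0//= ler_pdivrMr// mul1r.
rewrite -(radial z r)//.
have [r0 r1] := andP r01.
have mrz : modulus (RtoC r * z) = modulus v.
  by rewrite modulusM modulusR gtr0_norm// /r divfK// gt_eqF.
have rz0 : RtoC r * z != 0 by rewrite -modulus_gt0 mrz.
have [s [s0 s1 sE]] : exists t : R, [/\ 0 <= t, t < tau & v / (RtoC r * z) = cis t].
  by apply: cis_surj; rewrite modulusM modulusV mrz divff// gt_eqF.
have {sE}vE : v = RtoC r * z * cis s by rewrite -sE mulrC divfK.
rewrite vE -(@circint_rotate (fun t => f (RtoC r * z * cis t)) s).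
- by apply: circint_ext => t; rewrite addrC cisD mulrA.
- move=> t; apply: (rccont_comp (f := f)); first exact: rccontM (rccont_cst _ _) (rccont_cis _).
  have [|d Hd] := H (RtoC r * z * cis t); last exact: cderiv_ccont Hd.
  by rewrite modulusM modulus_cis mulr1 mrz V0.
- by move=> t; rewrite cisDtau.
- by rewrite s0 ltW.
Qed.

Lemma rccont_conj (f : R -> C) t : rccont f t -> rccont (fun s => (f s)^*) t.
Proof.
by move=> F e /F[d d0 D]; exists d => // s /D; rewrite -rmorphB modulusC.
Qed.

Lemma circint_conj (g : R -> C) : ccurve g -> circint (fun t => (g t)^*) = (circint g)^*.
Proof.
move=> G; apply: C_ext; rewrite ?creC ?cimC /=.
  by apply: RI_ext => t _; rewrite creC.
rewrite -mulN1r -RIZ; last exact: ccurve_im.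
by apply: RI_ext => t _; rewrite cimC mulN1r.
Qed.

Lemma circint_cisX j : (0 < j)%N -> circint (fun t => (cis t : C) ^+ j) = 0.
Proof.
move=> j0; have := @mean_value R (fun u => u ^+ j) 0 1 (oner_neq0 _).
rewrite expr0n eqn0Ngt j0/= mulr0 => <-.
  by apply: circint_ext => t; rewrite add0r mul1r.
by move=> u _; eexists; exact: cderivX.
Qed.

Lemma circint_sum (I : Type) (r : seq I) (F : I -> R -> C) : (forall i, ccurve (F i)) ->
  circint (fun t => \sum_(i <- r) F i t) = \sum_(i <- r) circint (F i) /\
  ccurve (fun t => \sum_(i <- r) F i t).
Proof.
move=> H; elim: r => [|i r [IH c]].
  split; last first.
    by under eq_fun do rewrite big_nil; move=> t; exact: rccont_cst.
  by rewrite big_nil; under circint_ext do rewrite big_nil; rewrite circint_cst mulr0.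
have E : (fun t => \sum_(j <- i :: r) F j t) = fun t => F i t + \sum_(j <- r) F j t.
  by apply/funext => t; rewrite big_cons.
rewrite E big_cons circintD// IH; split=> // t.
by apply: rccontD; [exact: H|exact: c].
Qed.

(** The difference quotient at [a] is holomorphic across [a], by second order
    Taylor expansion. *)
Lemma quotient_holo g a : (forall u, modulus u < 1 -> exists d, cderiv g u d) ->
  modulus a < 1 -> exists2 G : C -> C, (forall u, u != a -> G u = (g u - g a) / (u - a)) &
    forall u, modulus u < 1 -> exists d, cderiv G u d.
Proof.
move=> H a1; pose g1 : C -> C := derive1 g.
have Hg u : modulus u < 1 -> cderiv g u (g1 u).
  by move=> /H[d Hd]; rewrite /g1 (cderiv_derive1 Hd).
clearbody g1.
pose rho := 1 - modulus a; have rho0 : 0 < rho by rewrite /rho; lra.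
have near u : modulus (u - a) < rho -> modulus u < 1.
  by have := modulus_rev u a; rewrite /rho => *; lra.
have [g2 Hg2] : exists d, cderiv g1 a d.
  by apply: (@holo_derive R g g1 a rho) => // u /near; exact: Hg.
exists (fun u => if u == a then g1 a else (g u - g a) / (u - a)).
  by move=> u /negPf ->.
move=> u u1; have [->{u u1}|ua] := eqVneq u a.
  exists (g2 / 2) => e e0.
  have e2 : 0 < e / 2 by lra.
  have [d d0 D] := Hg2 _ e2.
  exists (Num.min d rho); first by rewrite lt_min d0.
  move=> h; rewrite lt_min => /andP[hd hr].
  rewrite eqxx; have [h0|h0] := eqVneq h 0.
    by rewrite h0 addr0 eqxx mulr0 subrr subr0 modulus0 mulr0.
  have -> : (a + h == a) = false by rewrite -subr_eq0 addrC addKr (negPf h0).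
  have H0 : 0 < modulus h by rewrite modulus_gt0.
  (* Removing the Taylor polynomial of order two leaves a function whose derivative
     is [o(|v - a|)]. *)
  pose k v := g v - g1 a * v - g2 / 2 * (v - a) ^+ 2.
  have kE : k (a + h) - k a = (g (a + h) - g a - g1 a * h - g2 / 2 * h ^+ 2).
    by rewrite /k subrr expr0n /=; ring.
  have : modulus (k (a + h) - k a) <= 2 * (e / 2 * modulus h) * modulus (a + h - a).
    apply: (@complex_mvt R k (fun v => g1 v - g1 a - g2 * (v - a))) => t /andP[t0 t1].
    set p := a + _.
    have pE : p = a + RtoC t * h by rewrite /p; congr (_ + _ * _); ring.
    have pa : modulus (RtoC t * h) <= modulus h.
      by rewrite modulusM modulusR ger0_norm// -[leRHS]mul1r ler_wpM2r// ltW.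
    have pr : modulus (p - a) < rho by rewrite pE addrC addKr; apply: le_lt_trans pa hr.
    split.
      have d1 := Hg _ (near _ pr).
      have d2 := cderivZ (- g1 a) (cderiv_id p).
      have d3 := cderivD (cderiv_id p) (cderiv_cst (- a) p).
      have d4 := cderivZ (- (g2 / 2)) (cderivM d3 d3).
      have := cderivD (cderivD d1 d2) d4.
      rewrite (_ : g1 p + _ + _ = g1 p - g1 a - g2 * (p - a)); last by field.
      rewrite (_ : (fun w => _) = k)//; apply/funext => v; rewrite /k expr2; ring.
    have /D B : modulus (RtoC t * h) < d by apply: le_lt_trans pa hd.
    rewrite pE (_ : a + RtoC t * h - a = RtoC t * h); last by rewrite addrC addKr.
    by apply: le_trans B _; rewrite ler_wpM2l// ltW.
  rewrite (_ : a + h - a = h); last by rewrite addrC addKr.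
  rewrite kE => B; rewrite -(ler_pM2r H0) -modulusM.
  rewrite (_ : _ * h = g (a + h) - g a - g1 a * h - g2 / 2 * h ^+ 2); last first.
    by field; rewrite h0.
  by apply: le_trans B _; rewrite le_eqVlt; apply/orP; left; apply/eqP; field.
have d1 := cderivD (Hg _ u1) (cderiv_cst (- g a) u).
have d2 := cderivD (cderiv_id u) (cderiv_cst (- a) u).
have ua0 : u - a != 0 by rewrite subr_eq0.
have d3 := cderivM d1 (cderiv_comp d2 (cderivV ua0)).
eexists; apply: (@cderiv_ext R _ _ u _ (modulus (u - a)) _ _ d3); first by rewrite modulus_gt0.
move=> w wu; case: eqVneq => // wa; move: wu.
by rewrite wa modulus_distC ltxx.
Qed.

Lemma small_pow (q e : R) : 0 <= q < 1 -> 0 < e -> exists n, q ^+ n < e.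
Proof.
move=> /andP[q0 q1] e0; have q1' : `|q| < 1 by rewrite ger0_norm.
have /cvgrPdist_lt/(_ _ e0)[N _ HN] := cvg_expr q1'.
exists N; have := HN N (leqnn N).
by rewrite /= sub0r normrN ger0_norm// exprn_ge0.
Qed.

Lemma circint_bound_itv (g : R -> C) (M : R) : ccurve g ->
  (forall t, 0 <= t <= tau -> modulus (g t) <= M) -> modulus (circint g) <= 2 * M * tau.
Proof.
move=> G H; have t0 := @tau_gt0 R; apply: le_trans (modulus_le _) _ => /=.
have h1 : `|RI 0 tau (fun t => cre (g t))| <= M * (tau - 0).
  apply: RI_bound; [exact: ltW|exact: ccurve_re|].
  by move=> t th; exact: le_trans (cre_le_modulus _) (H t th).
have h2 : `|RI 0 tau (fun t => cim (g t))| <= M * (tau - 0).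
  apply: RI_bound; [exact: ltW|exact: ccurve_im|].
  by move=> t th; exact: le_trans (cim_le_modulus _) (H t th).
by rewrite subr0 in h1 h2; lra.
Qed.

Lemma ccurve_bounded (g : R -> C) : ccurve g ->
  exists2 M : R, 0 <= M & forall t, 0 <= t <= tau -> modulus (g t) <= M.
Proof.
move=> G; have [|c _ Hc] := @EVT_max R (fun t => modulus (g t)) 0 tau (ltW (@tau_gt0 R)).
  apply: continuous_in_subspaceT => t _.
  apply: (rcontC_curve (h := @modulus R)); first exact: G.
  by apply: (@rcontC_modulus R id); exact: cderiv_ccont (cderiv_id _).
by exists (modulus (g c)); [exact: modulus_ge0|move=> t th; apply: Hc; rewrite in_itv].
Qed.

(** Expanding the Cauchy kernel at [a] in powers of [a / u], the vanishing
    coefficients leave only a geometrically small remainder. *)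
Lemma circle_coefficients0 g : (forall u, modulus u < 1 -> exists d, cderiv g u d) ->
  (forall z j, z != 0 -> modulus z < 1 -> circint (fun t => g (z * cis t) / (z * cis t) ^+ j) = 0) ->
  forall a, modulus a < 1 -> g a = 0.
Proof.
move=> H Hj a a1; have a0 := modulus_ge0 a.
have [G GE HG] := quotient_holo H a1.
pose rr := (1 + modulus a) / 2; pose z := RtoC rr.
have mz : modulus z = rr by rewrite /z modulusR ger0_norm// /rr; lra.
have z0 : z != 0 by rewrite -modulus_gt0 mz /rr; lra.
have z1 : modulus z < 1 by rewrite mz /rr; lra.
have az : modulus a < modulus z by rewrite mz /rr; lra.
have Z0 : 0 < modulus z by rewrite modulus_gt0.
pose u t := z * cis t.
have mu_ t : modulus (u t) = modulus z by rewrite /u modulusM modulus_cis mulr1.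
have u0 t : u t != 0 by rewrite mulf_neq0// cis_neq0.
have ua t : u t != a by apply: contraTneq az => <-; rewrite mu_ ltxx.
have uc t : rccont u t by exact: rccontM (rccont_cst _ _) (rccont_cis _).
have comp f t : (exists d, cderiv f (u t) d) -> rccont (fun t => f (u t)) t.
  by move=> [d Hd]; apply: (rccont_comp (f := f)) (uc t) _; exact: cderiv_ccont Hd.
have u1 t : modulus (u t) < 1 by rewrite mu_.
have gc : ccurve (fun t => g (u t)) by move=> t; apply: comp; exact: H.
pose x t := a / u t.
have ic t : rccont (fun t => (u t)^-1) t by apply: comp; eexists; exact: cderivV (u0 t).
have xc t : rccont x t by apply: rccontM (rccont_cst _ _) (ic t).
pose q := modulus a / modulus z.
have q01 : 0 <= q < 1 
  by apply/andP; split; [exact: divr_ge0 a0 (ltW Z0)|rewrite /q ltr_pdivrMr// mul1r].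
have mx t : modulus (x t) = q by rewrite /x modulusM modulusV mu_.
have x1 t : 1 - x t != 0.
  by rewrite subr_eq0 eq_sym; apply/eqP => /(congr1 (@modulus R)); rewrite mx modulus1; lra.
(* Cauchy's formula for [g - g a] at [a]: the integrand is [w * G w], which vanishes
   at the centre. *)
have cauchy0 : circint (fun t => (g (u t) - g a) / (1 - x t)) = 0.
  have := @mean_value R (fun w => w * G w) 0 z z0; rewrite mul0r mulr0 => <-.
    apply: circint_ext => t; rewrite add0r -/(u t) GE//.
    have ua0 : u t - a != 0 by rewrite subr_eq0.
    have -> : 1 - x t = (u t - a) / u t by rewrite /x mulrBl divff.
    by field; rewrite ?u0 ?ua0.
  move=> w; rewrite subr0 => wz; have [d Hd] := HG _ (le_lt_trans wz z1).
  by eexists; exact: cderivM (cderiv_id w) Hd.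
have gac t : rccont (fun t => g (u t) - g a) t by apply: rccontB (gc t) (rccont_cst _ _).
have invc t : rccont (fun t => (1 - x t)^-1) t.
  have h : rccont (fun t => 1 - x t) t by apply: rccontB (rccont_cst _ _) (xc t).
  by apply: (rccont_comp (f := GRing.inv)) h _; exact: cderiv_ccont (cderivV (x1 t)).
have key n : RtoC tau * g a = circint (fun t => (g (u t) - g a) * x t ^+ n.+1 / (1 - x t)).
  have xXc j t : rccont (fun t => x t ^+ j) t by exact: rccontX.
  have tc j : ccurve (fun t => (g (u t) - g a) * x t ^+ j).
    by move=> t; apply: rccontM (gac t) (xXc j t).
  have [sumE sumc] := @circint_sum nat (iota 0 n.+1) _ tc.
  have S : circint (fun t => \sum_(j <- iota 0 n.+1) (g (u t) - g a) * x t ^+ j) = - (RtoC tau * g a).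
    rewrite sumE.
    have term j : circint (fun t => (g (u t) - g a) * x t ^+ j) =
        if j == 0%N then - (RtoC tau * g a) else 0.
      have -> : (fun t => (g (u t) - g a) * x t ^+ j) =
          (fun t => a ^+ j * (g (u t) / u t ^+ j) - g a * x t ^+ j).
        by apply/funext => t; rewrite /x exprMn exprVn; ring.
      have c1 t : rccont (fun t => g (u t) / u t ^+ j) t.
        apply: rccontM (gc t) _; under eq_fun do rewrite -exprVn.
        exact: rccontX.
      rewrite circintB; last 2 first.
      - by move=> t; apply: rccontM (rccont_cst _ _) (c1 t).
      - by move=> t; apply: rccontM (rccont_cst _ _) (xXc j t).
      rewrite (circintZ _ c1) (circintZ _ (xXc j)).
      rewrite Hj// mulr0 sub0r; case: eqVneq => [->|j0].
        by under circint_ext do rewrite expr0; rewrite circint_cst mulr1 mulrC.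
      have -> : (fun t => x t ^+ j) = (fun t => (a / z) ^+ j * (cis t ^+ j)^*).
        apply/funext => t; rewrite /x /u invfM cisV conjCX mulrA exprMn//.
      rewrite circintZ; last first.
        by move=> t; apply: rccont_conj; apply: rccontX; exact: rccont_cis.
      rewrite circint_conj; last by move=> t; apply: rccontX; exact: rccont_cis.
      by rewrite circint_cisX ?lt0n// rmorph0 mulr0 mulr0 oppr0.
    rewrite (eq_bigr (fun j => if j == 0%N then - (RtoC tau * g a) else 0)) => [|j _]; last exact: term.
    rewrite [iota _ _]/= big_cons /= big1_seq ?addr0// => j /andP[_]; rewrite mem_iota => /andP[j1 _].
    by rewrite gtn_eqF.
  have E t : (g (u t) - g a) / (1 - x t) =
      \sum_(j <- iota 0 n.+1) (g (u t) - g a) * x t ^+ j + (g (u t) - g a) * x t ^+ n.+1 / (1 - x t).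
    rewrite -mulr_sumr.
    have := subrX1 (x t) n.+1.
    have -> : \sum_(i < n.+1) x t ^+ i = \sum_(j <- iota 0 n.+1) x t ^+ j.
      by rewrite -(big_mkord xpredT (fun i => x t ^+ i)) /index_iota subn0.
    set T := \sum_(j <- _) _ => HT.
    have -> : x t ^+ n.+1 = 1 + (x t - 1) * T by rewrite -HT; ring.
    by field; rewrite x1.
  move: cauchy0; under circint_ext do rewrite E.
  rewrite circintD; last 2 first.
  - exact: sumc.
  - move=> t; apply: rccontM (invc t); apply: rccontM (gac t) (xXc _ t).
  by rewrite S addrC => /eqP; rewrite subr_eq0 => /eqP ->.
have [M M0 HM] := ccurve_bounded gac.
apply/eqP; rewrite -modulus_eq0 eq_le modulus_ge0 andbT leNgt; apply/negP => ga0.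
have t0 := @tau_gt0 R; have q1 : 0 < 1 - q by lra.
pose A := 2 * (M + 1) / (1 - q).
have A0 : 0 < A by rewrite /A divr_gt0//; lra.
have [n Hn] := small_pow q01 (divr_gt0 ga0 A0).
have := circint_bound_itv (g := fun t => (g (u t) - g a) * x t ^+ n.+1 / (1 - x t)) (M := (M + 1) *
  q ^+ n.+1 / (1 - q)).
rewrite -key modulusM modulusR gtr0_norm// => /(_ _ _)B.
have {}B : tau * modulus (g a) <= 2 * ((M + 1) * q ^+ n.+1 / (1 - q)) * tau.
  apply: B => [t|t th].
    by apply: rccontM (invc t); apply: rccontM (gac t) _; exact: rccontX.
  rewrite modulusM modulusM modulusX mx modulusV.
  apply: ler_pM; rewrite ?mulr_ge0 ?modulus_ge0 ?invr_ge0 ?modulus_ge0 ?exprn_ge0//; try lra.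
    by apply: ler_wpM2r; rewrite ?exprn_ge0//; [lra|have := HM _ th; lra].
  rewrite lef_pV2 ?posrE ?modulus_gt0 ?x1//.
  by have := modulus_rev 1 (x t); rewrite modulus1 mx.
have : modulus (g a) <= A * q ^+ n.+1.
  rewrite -(ler_pM2l t0); apply: le_trans B _.
  by rewrite /A le_eqVlt; apply/orP; left; apply/eqP; ring.
apply/negP; rewrite -ltNge; apply: (@le_lt_trans _ _ (A * q ^+ n)).
  rewrite ler_wpM2l ?(ltW A0)// exprS -[leRHS]mul1r ler_wpM2r ?exprn_ge0//; lra.
by rewrite mulrC -ltr_pdivlMr.
Qed.

End Completeness.

(** * Moments of the disc and completeness of monomials *)

Section Moments.
Context {R : realType}.
Local Notation C := (Cplx R).
Local Notation tau := (@tau R).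
Local Notation mu := (@lebesgue_measure R).
Local Notation RR := (measurableTypeR R * measurableTypeR R)%type.
Local Notation area := (@area R).
Implicit Types (f g : C -> C) (z w u v : C).

(** The area enters the norms below as a common factor. *)
Definition discarea : R := fine (area (plane_ball 1)).

Lemma area_disc : area (plane_ball 1) = discarea%:E.
Proof.
rewrite /discarea fineK//; apply/fin_numPlt; rewrite (area_ball_lt 1) andbT.
by apply: lt_le_trans (measure_ge0 _ _); rewrite ltNye.
Qed.

Lemma discarea_ge1 : 1 <= discarea.
Proof. by have := @area_ball_ge R 1 ler01; rewrite expr1n area_disc lee_fin. Qed.

Lemma RI_FTC_on (a b : R) (u U : R -> R) : a < b -> cont_on a b u ->
  (forall x : R, a <= x <= b -> is_derive x 1 U (u x)) -> RI a b u = U b - U a.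
Proof.
move=> ab uc HU.
have Uc x : a <= x <= b -> {for x, continuous U} by move=> /HU; exact: is_derive_cont.
have := @continuous_FTC2 R u U a b ab.
rewrite /RI /Rintegral => ->; first by rewrite -EFinB.
- by apply: continuous_in_subspaceT => x; rewrite inE/= in_itv/=; exact: uc.
- split.
  + move=> x; rewrite in_itv/= => /andP[x1 x2].
    by apply: ex_derive; apply: HU; rewrite !ltW.
  + by apply: cvg_at_right_filter; apply: Uc; rewrite lexx ltW.
  + by apply: cvg_at_left_filter; apply: Uc; rewrite lexx ltW.
- move=> x; rewrite in_itv/= => /andP[x1 x2].
  have Dx : is_derive x 1 U (u x) by apply: HU; rewrite !ltW.
  by rewrite derive1E derive_val.
Qed.

Lemma RI_FTC (a b : R) (u U : R -> R) : a < b -> continuous u ->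
  (forall x : R, is_derive x 1 U (u x)) -> RI a b u = U b - U a.
Proof.
move=> ab uc HU.
by apply: (RI_FTC_on ab); exact: continuous_cont_on.
Qed.

(** The partial derivative in [x] of [x * (x ^+ 2 + y ^+ 2) ^+ n]. *)
Definition moment_x (n : nat) (x y : R) : R :=
  (x ^+ 2 + y ^+ 2) ^+ n + n%:R * (2 * x ^+ 2) * (x ^+ 2 + y ^+ 2) ^+ n.-1.

Lemma moment_x_derive (n : nat) (y x : R) :
  is_derive x 1 (fun x : R => x * (x ^+ 2 + y ^+ 2) ^+ n) (moment_x n x y).
Proof.
have D2 : is_derive x 1 (fun x : R => x ^+ 2 + y ^+ 2) (2 * x).
  have := is_deriveD (is_deriveX 2 (is_derive_id x 1)) (is_derive_cst (y ^+ 2) x (1 : R)).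
  move=> h; apply: (is_derive_eq h).
  by rewrite addr0 expr1 /GRing.scale/= mulr1 -mulr_natl; ring.
have h := is_deriveM (is_derive_id x 1) (is_deriveX n D2).
rewrite (_ : (fun x => _) = id * (fun x : R => x ^+ 2 + y ^+ 2) ^+ n); last first.
  by apply/funext => s; rewrite fctE exprfctE.
apply: (is_derive_eq h); set A := x ^+ 2 + y ^+ 2.
have e : ((fun x0 : R => x0 ^+ 2 + y ^+ 2) ^+ n) x = A ^+ n by rewrite exprfctE.
rewrite e /moment_x -/A.
change (x * (n%:R * A ^+ n.-1 * (2 * x)) + A ^+ n * 1 = A ^+ n + n%:R * (2 * x ^+ 2) * A ^+ n.-1).
clearbody A; move: (A ^+ n) (A ^+ n.-1) => a b; ring.
Qed.

Lemma moment_x_cont (n : nat) (y : R) : continuous (moment_x n ^~ y).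
Proof.
have c1 m : continuous (fun x : R => (x ^+ 2 + y ^+ 2) ^+ m).
  move=> x; apply: (@continuous_comp R R R (fun x : R => x ^+ 2 + y ^+ 2) (fun v : R => v ^+ m)).
    apply: continuousD; last exact: cst_continuous.
    exact: exprn_continuous.
  exact: exprn_continuous.
have -> : moment_x n ^~ y = (fun x : R => (x ^+ 2 + y ^+ 2) ^+ n) \+
  (((cst n%:R) \* ((cst 2) \* (fun x => x ^+ 2))) \* (fun x : R => (x ^+ 2 + y ^+ 2) ^+ n.-1)) by [].
move=> x; apply: continuousD; first exact: c1.
apply: continuousM; last exact: c1.
apply: continuousM; first exact: cst_continuous.
apply: continuousM; first exact: cst_continuous.
exact: exprn_continuous.
Qed.

Lemma moment_x_ge0 n x y : 0 <= moment_x n x y.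
Proof.
have h : 0 <= x ^+ 2 + y ^+ 2 by rewrite addr_ge0 ?sqr_ge0.
by rewrite /moment_x addr_ge0 ?exprn_ge0// mulr_ge0 ?exprn_ge0// mulr_ge0// mulr_ge0 ?sqr_ge0.
Qed.

Definition mslice n : RR -> \bar R :=
  (fun p => (moment_x n p.1 p.2)%:E) \_ (plane_ball 1).

Lemma plane_ball1E (x y : R) : plane_ball 1 (x, y) <-> x ^+ 2 + y ^+ 2 < 1.
Proof.
have E : modulus (plane (x, y) : C) ^+ 2 = x ^+ 2 + y ^+ 2 := modulus_sqr _.
have m0 := modulus_ge0 (plane (x, y) : C).
rewrite /plane_ball /mkset -E; move: m0; set m := modulus _ => m0.
split=> h; first by nra.
by rewrite ltNge; apply/negP => h1; nra.
Qed.

(** By the fundamental theorem of calculus every horizontal slice contributes the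
    length of the chord, whatever [n]. *)
Lemma slice_integral n (y : R) :
  (\int[mu]_x mslice n (x, y) = (2 * Num.sqrt (1 - y ^+ 2))%:E)%E.
Proof.
set c := Num.sqrt _.
have [y1|y1] := leP 1 (y ^+ 2).
  have -> : c = 0 by apply: ler0_sqrtr; lra.
  rewrite mulr0 integral0_eq// => x _; rewrite /mslice patchE memNset// plane_ball1E.
  by have := sqr_ge0 x; lra.
have c0 : 0 < c by rewrite sqrtr_gt0; lra.
have c2 : c ^+ 2 = 1 - y ^+ 2 by rewrite sqr_sqrtr//; lra.
have E : [set x | plane_ball 1 (x, y)] = `](- c)%R, c[%classic.
  apply/seteqP; split=> x /=; rewrite plane_ball1E in_itv/= -ltr_norml.
    move=> h; rewrite -ltr_sqr ?nnegrE// ?ltW// real_normK ?num_real// c2; lra.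
  move=> h; have : `|x| ^+ 2 < c ^+ 2 by rewrite ltr_sqr ?nnegrE// ltW.
  by rewrite real_normK ?num_real// c2; lra.
transitivity (\int[mu]_(x in `](- c)%R, c[) (moment_x n x y)%:E)%E.
  rewrite [RHS]integral_mkcond; apply: eq_integral => x _.
  by rewrite /mslice !patchE -E; congr (if _ then _ else _); apply/idP/idP; rewrite !inE.
have mm : measurable_fun setT (EFin \o (moment_x n ^~ y) : measurableTypeR R -> \bar R).
  by apply/measurable_EFinP; apply: continuous_measurable_fun; exact: moment_x_cont.
rewrite integral_itv_bndo_bndc ?integral_itv_obnd_cbnd; [|exact: measurable_funTS mm..].
rewrite (int_cont (u := moment_x n ^~ y)); last first.
  by apply: continuous_cont_on; exact: moment_x_cont.
have cc : - c < c by lra.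
rewrite (RI_FTC cc (@moment_x_cont n y) (@moment_x_derive n y)).
by rewrite sqrrN c2 subrK expr1n; congr (_%:E); ring.
Qed.

Lemma measurable_moment n : measurable_fun setT (fun p : RR => moment_x n p.1 p.2).
Proof.
have mx : measurable_fun setT (fun p : RR => p.1 ^+ 2) by exact: measurable_funX.
have ms m : measurable_fun setT (fun p : RR => (p.1 ^+ 2 + p.2 ^+ 2) ^+ m).
  apply: measurable_funX; apply: measurable_funD => //; exact: measurable_funX.
apply: measurable_funD => //; apply: measurable_funM => //.
apply: measurable_funM => //; exact: measurable_funM.
Qed.

Lemma mslice_measurable n : measurable_fun setT (mslice n).
Proof.
apply/(measurable_restrictT _ (measurable_plane_ball 1)).
apply/measurable_EFinP; apply: measurable_funTS; exact: measurable_moment.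
Qed.

Lemma mslice_ge0 n p : (0 <= mslice n p)%E.
Proof. by rewrite /mslice patchE; case: ifP => // _; rewrite lee_fin moment_x_ge0. Qed.

Lemma mslice_integral n : (\int[area]_p mslice n p = discarea%:E)%E.
Proof.
have S m : (\int[area]_p mslice m p = \int[mu]_y (2 * Num.sqrt (1 - y ^+ 2))%:E)%E.
  have := @fubini_tonelli2 _ _ _ _ R mu mu (mslice m) (mslice_measurable m) (mslice_ge0 m).
  by move=> ->; apply: eq_integral => y _; exact: slice_integral.
rewrite S -(S 0%N) -area_disc /mslice -integral_mkcond.
under eq_integral do rewrite /moment_x expr0 !mul0r addr0.
by rewrite integral_cst ?mul1e//; exact: measurable_plane_ball.
Qed.

Lemma measurable_mod n :
  measurable_fun (plane_ball 1 : set RR) (fun p => modulus (plane p : C) ^+ 2 ^+ n).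
Proof.
apply: measurable_funX; apply: (rcontC_measurable (h := fun z => modulus z ^+ 2) (@openC_disc R 1)) => z _.
by apply: rcontC_sqr; apply: (@rcontC_modulus R id); exact: cderiv_ccont (cderiv_id _).
Qed.

(** Add the horizontal and the vertical slices: the two densities sum to
    [2 (n + 1) |z|^(2n)], and each of them integrates to the area of the disc. *)
Lemma disc_moment n : (\int[area]_(p in plane_ball 1) (modulus (plane p : C) ^+ 2 ^+ n)%:E =
  (discarea / n.+1%:R)%:E)%E.
Proof.
set J := integral _ _ _.
have sw : (\int[area]_p mslice n (p.2, p.1) = discarea%:E)%E.
  rewrite -(mslice_integral n).
  exact: (area_preserving_integral (@area_preserving_swap R) (mslice_measurable n) (mslice_ge0 n)).
have : ((2 * n.+1%:R)%:E * J = (2 * discarea)%:E)%E.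
  rewrite (_ : 2 * discarea = discarea + discarea); last ring.
  rewrite EFinD -{1}(mslice_integral n) -sw -ge0_integralD//; last 4 first.
  - by move=> p _; exact: mslice_ge0.
  - exact: mslice_measurable.
  - by move=> p _; exact: mslice_ge0.
  - exact: measurableT_comp (mslice_measurable n) (@measurable_swap _ _ _ _).
  rewrite /J [X in (_ * X)%E]integral_mkcond -ge0_integralZl//; last 2 first.
  - by apply/(measurable_restrictT _ (measurable_plane_ball 1)); have /measurable_EFinP := measurable_mod n.
  - by move=> p _; rewrite patchE; case: ifP => // _; rewrite lee_fin exprn_ge0// sqr_ge0.
  apply: eq_integral => -[x y] _; rewrite /mslice !patchE /=.
  have -> : ((y, x) \in plane_ball 1) = ((x, y) \in plane_ball 1 :> bool).
    by apply/idP/idP; rewrite !inE !plane_ball1E addrC.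
  case: ifP => _; last by rewrite mule0 adde0.
  rewrite -EFinM -EFinD sqr_sqrtr ?addr_ge0 ?sqr_ge0// /moment_x (addrC (y ^+ 2)); congr (_%:E).
  clear J sw; case: n => [|n]; first by rewrite !expr0; ring.
  rewrite [n.+1.-1]/= exprS -(natr1 n.+1); move: (n.+1%:R : R) ((_ + _) ^+ n) => a b; ring.
have Jfin : J \is a fin_num.
  apply: (@integrable_fin_num _ _ _ area (plane_ball 1)); first exact: measurable_plane_ball.
  apply: (@le_integrable _ _ _ area (plane_ball 1) (measurable_plane_ball 1) _ (cst 1%E)).
  - by have /measurable_EFinP := measurable_mod n.
  - move=> p; rewrite /plane_ball /mkset => h; rewrite /= lee_fin normr1 ger0_norm ?exprn_ge0 ?sqr_ge0//.
    by rewrite exprn_ile1 ?exprn_ge0 ?modulus_ge0// exprn_ile1 ?modulus_ge0// ltW.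
  - apply/integrableP; split => //.
    under eq_integral do rewrite /= normr1.
    rewrite integral_cst ?mul1e; [exact: area_ball_lt|exact: measurable_plane_ball].
rewrite -(fineK Jfin) -EFinM => -[h]; congr (_%:E).
have n0 : n.+1%:R != 0 :> R by rewrite pnatr_eq0.
by apply: (mulfI n0); rewrite mulrCA divff// mulr1; lra.
Qed.

End Moments.

Section Bergman.
Context {R : realType}.
Local Notation C := (Cplx R).
Local Notation tau := (@tau R).
Local Notation mu := (@lebesgue_measure R).
Local Notation RR := (measurableTypeR R * measurableTypeR R)%type.
Local Notation area := (@area R).
Implicit Types (f g : C -> C) (z w u v : C).

Lemma rcontCD (h k : C -> R) z : rcontC h z -> rcontC k z -> rcontC (fun w => h w + k w) z.
Proof.
move=> H K e e0; have e2 : 0 < e / 2 by lra.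
have [d1 d10 D1] := H _ e2; have [d2 d20 D2] := K _ e2.
exists (Num.min d1 d2); first by rewrite lt_min d10.
move=> w; rewrite lt_min => /andP[/D1 h1 /D2 h2].
rewrite (_ : _ - _ = (h w - h z) + (k w - k z)); last ring.
by rewrite (le_lt_trans (ler_normD _ _))//; lra.
Qed.
Lemma rcontC_cst (a : R) z : rcontC (fun=> a) z.
Proof. by move=> e e0; exists 1 => // w _; rewrite subrr normr0. Qed.
Lemma rcontCN (h : C -> R) z : rcontC h z -> rcontC (fun w => - h w) z.
Proof. by move=> H e /H[d d0 D]; exists d => // w /D; rewrite -opprD normrN. Qed.
Lemma ccontP f z : rcontC (fun w => cre (f w)) z -> rcontC (fun w => cim (f w)) z -> ccont f z.
Proof.
move=> A B e e0; have e2 : 0 < e / 2 by lra.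
have [d1 d10 D1] := A _ e2; have [d2 d20 D2] := B _ e2.
exists (Num.min d1 d2); first by rewrite lt_min d10.
move=> s; rewrite lt_min => /andP[/D1 h1 /D2 h2].
apply: le_lt_trans (modulus_le _) _; rewrite creB cimB; lra.
Qed.
Lemma ccontM f g z : ccont f z -> ccont g z -> ccont (fun w => f w * g w) z.
Proof.
move=> F G; have [F1 F2] := (rcontC_re F, rcontC_im F).
have [G1 G2] := (rcontC_re G, rcontC_im G); apply: ccontP.
  rewrite (_ : (fun w => _) = fun w => cre (f w) * cre (g w) + - (cim (f w) * cim (g w))).
    by apply: rcontCD; [|apply: rcontCN]; exact: rcontCM.
  by apply/funext => s; rewrite creM.
rewrite (_ : (fun w => _) = fun s => cre (f s) * cim (g s) + cim (f s) * cre (g s)).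
  by apply: rcontCD; exact: rcontCM.
by apply/funext => s; rewrite cimM.
Qed.
Lemma ccont_conj f z : ccont f z -> ccont (fun w => (f w)^*) z.
Proof. by move=> F e /F[d d0 D]; exists d => // s /D; rewrite -rmorphB modulusC. Qed.
Lemma ccontX f z n : ccont f z -> ccont (fun w => f w ^+ n) z.
Proof.
move=> F; elim: n => [|n IH].
  by move=> e e0; exists 1 => // w _; rewrite !expr0 subrr modulus0.
by under eq_fun do rewrite exprS; exact: ccontM.
Qed.
Lemma ccont_id z : ccont id z.
Proof. exact: cderiv_ccont (cderiv_id z). Qed.

(** The majorant has the form [1 + k] because a square integrable [g] satisfies
    [|g| <= 1 + |g|^2] and the disc has finite area. *)
Lemma disc_integrable (h : C -> R) (k : C -> R) :
  (forall z, modulus z < 1 -> rcontC h z) -> (forall z, modulus z < 1 -> rcontC k z) ->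
  (forall z, modulus z < 1 -> `|h z| <= 1 + k z) -> (forall z, 0 <= k z) ->
  (\int[area]_(p in plane_ball 1) (k (plane p))%:E < +oo)%E ->
  area.-integrable (plane_ball 1) (fun p => (h (plane p))%:E).
Proof.
move=> hc kc hk k0 kfin; have mb := @measurable_plane_ball R 1.
have mk : measurable_fun (plane_ball 1 : set RR) (fun p => k (plane p)).
  exact: (rcontC_measurable (@openC_disc R 1)).
have ik : area.-integrable (plane_ball 1) (fun p => (k (plane p))%:E).
  apply/integrableP; split; first exact/measurable_EFinP.
  by under eq_integral do rewrite gee0_abs ?lee_fin//.
have i1 : area.-integrable (plane_ball 1) (cst 1%E).
  apply/integrableP; split => //.
  under eq_integral do rewrite /= normr1.
  by rewrite integral_cst ?mul1e//; exact: area_ball_lt.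
apply: (@le_integrable _ _ _ area (plane_ball 1) mb _ (fun p => 1%E + (k (plane p))%:E)%E).
- by apply/measurable_EFinP; exact: (rcontC_measurable (@openC_disc R 1)).
- move=> p pb; rewrite -EFinD /= lee_fin.
  by rewrite [leRHS]ger0_norm ?addr_ge0// hk.
- exact: (integrableD mb i1 ik).
Qed.

(** By averaging over rotations, the moment of [g] against the [j]-th power of the
    conjugate variable is a positive multiple of the [j]-th coefficient of [g] on any
    circle; so all these coefficients vanish. *)
Lemma bergman_complete g : (forall u, modulus u < 1 -> exists d, cderiv g u d) ->
  (\int[area]_(p in plane_ball 1) (modulus (g (plane p)) ^+ 2)%:E < +oo)%E ->
  (forall j, cintegral area (plane_ball 1) (fun p => g (plane p) * (plane p)^* ^+ j) = 0) ->
  forall a, modulus a < 1 -> g a = 0.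
Proof.
move=> H Hfin Horth.
have gc z : modulus z < 1 -> ccont g z by move=> /H[d]; exact: cderiv_ccont.
pose G j z := g z * z^* ^+ j.
have Gc j z : modulus z < 1 -> ccont (G j) z.
  by move=> /gc c; apply: ccontM c _; apply: ccontX; apply: (@ccont_conj id); exact: ccont_id.
have kc z : modulus z < 1 -> rcontC (fun z => modulus (g z) ^+ 2) z.
  by move=> /gc c; apply: rcontC_sqr; exact: rcontC_modulus.
have Gb j z : modulus z < 1 -> modulus (G j z) <= 1 + modulus (g z) ^+ 2.
  move=> z1; rewrite /G modulusM modulusX modulusC.
  have h1 : modulus z ^+ j <= 1 by rewrite exprn_ile1 ?modulus_ge0// ltW.
  have h2 : 0 <= modulus z ^+ j by rewrite exprn_ge0 ?modulus_ge0.
  have := modulus_ge0 (g z); set m := modulus (g z) => m0.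
  apply: (@le_trans _ _ m); first by nra.
  by have := sqr_ge0 (m - 1); nra.
have half0 : (RtoC (1/2) : C) != 0 by rewrite -modulus_gt0 modulusR gtr0_norm; lra.
have half1 : modulus (RtoC (1/2) : C) < 1 by rewrite modulusR ger0_norm; lra.
(* The coefficients of [g], computed on the circle of radius 1/2. *)
pose beta j := circint (fun t => g (RtoC (1/2) * cis t) / (RtoC (1/2) * cis t) ^+ j).
have holq j u : 0 < modulus u < 1 -> exists d, cderiv (fun u => g u / u ^+ j) u d.
  move=> /andP[u0 u1]; have [d Hd] := H _ u1; rewrite modulus_gt0 in u0.
  have uj : u ^+ j != 0 by rewrite expf_neq0.
  by eexists; exact: cderivM Hd (cderiv_comp (cderivX u j) (cderivV uj)).
have betaE j z : z != 0 -> modulus z < 1 ->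
    circint (fun t => g (z * cis t) / (z * cis t) ^+ j) = beta j.
  by move=> z0 z1; apply: (@circint_indep R (fun u => g u / u ^+ j)) => //; exact: holq.
have circG j z : modulus z < 1 ->
    circint (fun t => G j (z * cis t)) = RtoC (modulus z ^+ 2 ^+ j) * beta j.
  move=> z1; have [z0|z0] := eqVneq z 0.
    rewrite z0 modulus0; under circint_ext do rewrite mul0r; rewrite circint_cst /G.
    case: j => [|j]; last by rewrite rmorph0 expr0n/= expr0n/= expr0n/= !mulr0 RtoC0 mul0r.
    rewrite !expr0 mulr1 RtoC1 mul1r /beta.
    have := @mean_value R g 0 (RtoC (1/2)) half0.
    have e : (fun t => g (0 + RtoC (1 / 2) * cis t)) =
       (fun t => g (RtoC (1 / 2) * cis t) / (RtoC (1 / 2) * cis t) ^+ 0).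
      by apply/funext => t; rewrite add0r expr0 divr1.
    by rewrite e => -> // u; rewrite subr0 => ul; apply: H; exact: le_lt_trans half1.
  rewrite -(betaE j z z0 z1) -circintZ; last first.
    move=> t; apply: (rccont_comp (f := fun u => g u / u ^+ j)).
      exact: rccontM (rccont_cst _ _) (rccont_cis _).
    have [|d Hd] := holq j (z * cis t); last exact: cderiv_ccont Hd.
    by rewrite modulusM modulus_cis mulr1 modulus_gt0 z0.
  apply: circint_ext => t; rewrite /G; set u := z * cis t.
  have u0 : u != 0 by rewrite mulf_neq0// cis_neq0.
  have -> : modulus z = modulus u by rewrite /u modulusM modulus_cis mulr1.
  rewrite RtoCX -mulC_conj exprMn.
  by field; rewrite expf_neq0.
have J0 j : 0 < discarea / j.+1%:R :> R.
  by rewrite divr_gt0//; have := @discarea_ge1 R; lra.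
have t0 := @tau_gt0 R.
have ptw (h : C -> R) (j : nat) (b : R) : (forall z, modulus z < 1 -> rcontC h z) ->
    (forall z, modulus z < 1 -> `|h z| <= 1 + modulus (g z) ^+ 2) ->
    (forall z, modulus z < 1 -> RI 0 tau (fun t => h (z * cis t)) = modulus z ^+ 2 ^+ j * b) ->
    \int[area]_(p in plane_ball 1) h (plane p) = 0 -> b = 0.
  move=> hc hb hE h0.
  have ih := disc_integrable hc kc hb (fun z => sqr_ge0 _) Hfin.
  have := average_integrable hc ih.
  have -> : (\int[area]_(p in plane_ball 1) (h (plane p))%:E = 0)%E.
    rewrite -(fineK (integrable_fin_num (measurable_plane_ball 1) ih)).
    by move: h0; rewrite /Rintegral => ->.
  rewrite mule0.
  have -> : (\int[area]_(p in plane_ball 1) (RI 0 tau (fun t => h (plane p * cis t)))%:E =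
      \int[area]_(p in plane_ball 1) (b%:E * (modulus (plane p : C) ^+ 2 ^+ j)%:E))%E.
    apply: eq_integral => p; rewrite inE => pb.
    by rewrite hE// mulrC EFinM.
  rewrite integralZl; [|exact: measurable_plane_ball|]; last first.
    apply: (@disc_integrable (fun z => modulus z ^+ 2 ^+ j) (fun z => modulus (g z) ^+ 2)) => //.
    - move=> z _; have := @rcontC_modulus R (fun z => z ^+ 2 ^+ j) z.
      rewrite (_ : (fun w => modulus (w ^+ 2 ^+ j)) = fun z => modulus z ^+ 2 ^+ j); last first.
        by apply/funext => s; rewrite !modulusX.
      apply.
      by apply: ccontX; apply: ccontX; exact: ccont_id.
    - move=> z z1; rewrite ger0_norm ?exprn_ge0 ?sqr_ge0//.
      rewrite (@le_trans _ _ 1) ?lerDl ?sqr_ge0//.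
      by rewrite exprn_ile1 ?exprn_ge0 ?modulus_ge0// exprn_ile1 ?modulus_ge0// ltW.
    by exact: modulus_ge0.
    by move=> z; exact: sqr_ge0.
  rewrite disc_moment -EFinM => -[/esym/eqP]; rewrite mulf_eq0 => /orP[/eqP//|/eqP J00].
  by have := J0 j; rewrite J00 ltxx.
have beta0 j : beta j = 0.
  have := Horth j; rewrite /cintegral => -[re0 im0].
  apply: C_ext.
    apply: (@ptw (fun z => cre (G j z)) j) => //.
    - by move=> z z1; apply: rcontC_re; exact: Gc.
    - by move=> z z1; apply: le_trans (cre_le_modulus _) _; exact: Gb.
    - by move=> z /(circG j) /(congr1 cre); rewrite creZ.
  apply: (@ptw (fun z => cim (G j z)) j) => //.
  - by move=> z z1; apply: rcontC_im; exact: Gc.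
  - by move=> z z1; apply: le_trans (cim_le_modulus _) _; exact: Gb.
  - by move=> z /(circG j) /(congr1 cim); rewrite cimZ.
apply: circle_coefficients0 => // z j z0 z1.
by rewrite betaE.
Qed.

End Bergman.

(** * Hilbert-Schmidt composition operators *)

Section DirichletSpace.
Context {R : realType}.
Local Notation C := (Cplx R).
Local Notation tau := (@tau R).
Local Notation mu := (@lebesgue_measure R).
Local Notation RR := (measurableTypeR R * measurableTypeR R)%type.
Local Notation area := (@area R).
Local Notation discarea := (@discarea R).
Implicit Types (f g phi : C -> C) (z w u v : C).

(** The Dirichlet integral before normalisation by [pi]. *)
Definition dirichlet_area f : \bar R := (\int[area]_(p in plane_ball 1) (modulus (derive1 f (plane
  p)) ^+ 2)%:E)%E.

Lemma dirichlet_integralE f : dirichlet_integral f = ((pi^-1)%:E * dirichlet_area f)%E.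
Proof. by []. Qed.

Lemma pi_inv_gt0 : 0 < (pi : R)^-1.
Proof. by rewrite invr_gt0 pi_gt0. Qed.

Lemma discarea_gt0 : 0 < discarea.
Proof. by have := @discarea_ge1 R; lra. Qed.

Lemma holo_cderiv f z : holomorphic f -> modulus z < 1 -> cderiv f z (derive1 f z).
Proof. by move=> H z1; apply: derivable_cderiv; exact: H. Qed.

Lemma cderiv_holo f (f' : C -> C) : (forall z, modulus z < 1 -> cderiv f z (f' z)) ->
  holomorphic f.
Proof. by move=> H z z1; apply: cderiv_derivable; exact: H. Qed.

Lemma holo_derive1 f w : holomorphic f -> modulus w < 1 -> exists d, cderiv (derive1 f) w d.
Proof.
move=> H w1; apply: (@holo_derive R f (derive1 f) w (1 - modulus w)); first by lra.
move=> u uw; apply: holo_cderiv => //.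
have := modulusD (u - w) w; rewrite subrK; lra.
Qed.

Lemma holo_derive1_ccont f w : holomorphic f -> modulus w < 1 -> ccont (derive1 f) w.
Proof. by move=> H /(holo_derive1 H)[d]; exact: cderiv_ccont. Qed.

Lemma rcontC_measurable_disc (h : C -> R) : (forall z, modulus z < 1 -> rcontC h z) ->
  measurable_fun (plane_ball 1 : set RR) (fun p => h (plane p)).
Proof. by move=> hc; exact: (rcontC_measurable (@openC_disc R 1)). Qed.

Lemma dirichlet_area_ge0 f : (0 <= dirichlet_area f)%E.
Proof. by apply: integral_ge0 => p _; rewrite lee_fin sqr_ge0. Qed.

Lemma dirichlet_finP f : (dirichlet_integral f < +oo)%E <-> (dirichlet_area f < +oo)%E.
Proof.
rewrite dirichlet_integralE; have p0 := pi_inv_gt0.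
have := dirichlet_area_ge0 f; case: (dirichlet_area f) => [r| |] // _; first by rewrite -EFinM !ltry.
by rewrite gt0_muley.
Qed.

(** [area_mean_ge] on the largest disc around [w] inside the unit disc. *)
Lemma derive1_growth f w : holomorphic f -> modulus w < 1 ->
  ((modulus (derive1 f w) ^+ 2 * (1 - modulus w) ^+ 2)%:E <= dirichlet_area f)%E.
Proof.
move=> H w1; set g := derive1 f; set rho := 1 - modulus w.
have r0 : 0 <= rho by rewrite /rho; lra.
have inb u : modulus u < rho -> modulus (w + u) < 1.
  by move=> h; apply: le_lt_trans (modulusD _ _) _; move: h; rewrite /rho; lra.
have := @area_mean_ge R g w rho r0; rewrite mulrC => h.
apply: le_trans (h _) _.
  move=> u uw; apply: holo_derive1 => //.
  by have := inb _ uw; rewrite addrC subrK.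
pose F : RR -> \bar R := (fun p => (modulus (g (plane p)) ^+ 2)%:E) \_ (plane_ball 1).
have mF : measurable_fun setT F.
  apply/(measurable_restrictT _ (measurable_plane_ball 1)); apply/measurable_EFinP.
  apply: (rcontC_measurable_disc (h := fun z => modulus (g z) ^+ 2)) => z z1.
  by apply: rcontC_sqr; apply: rcontC_modulus; exact: holo_derive1_ccont.
have F0 p : (0 <= F p)%E by rewrite /F patchE; case: ifP => // _; rewrite lee_fin sqr_ge0.
rewrite /dirichlet_area [leRHS]integral_mkcond -/F -(area_preserving_integral
  (area_preserving_translation (cre w) (cim w)) mF F0).
rewrite [leLHS]integral_mkcond; apply: le_integral_nonmeasurable => p _.
  by rewrite patchE; case: ifP => // _; rewrite lee_fin sqr_ge0.
rewrite patchE; case: ifPn => [|_]; last exact: F0.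
rewrite inE => pb; have e : plane (p.1 + cre w, p.2 + cim w) = w + plane p :> C.
  by apply: C_ext; rewrite !cE /= addrC.
rewrite /F patchE mem_set; first by rewrite e.
by rewrite /plane_ball /mkset e; exact: inb.
Qed.

Lemma rcontCV (h : C -> R) z : rcontC h z -> h z != 0 -> rcontC (fun w => (h w)^-1) z.
Proof.
move=> hc h0 e e0.
have [|d d0 D] := (cont_epsP (@GRing.inv R) (h z)).1 _ e e0; first exact: inv_continuous.
by have [d' d'0 D'] := hc _ d0; exists d' => // w /D'/D.
Qed.

(** Up to normalisation, the hyperbolic area of the image counted with multiplicity. *)
Definition hs_integral phi : \bar R := (\int[area]_(p in plane_ball 1)
  (modulus (derive1 phi (plane p)) ^+ 2 / (1 - modulus (phi (plane p)) ^+ 2) ^+ 2)%:E)%E.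

Section composition.
Variables (phi : C -> C) (K : R).
Hypothesis phi_holo : holomorphic phi.
Hypothesis phi_disc : forall z, modulus z < 1 -> modulus (phi z) < 1.
Hypothesis phi0 : phi 0 = 0.
Hypothesis phiK : (hs_integral phi <= K%:E)%E.

Let K0 : 0 <= K.
Proof.
rewrite -lee_fin; apply: le_trans phiK; apply: integral_ge0 => p _.
by rewrite lee_fin divr_ge0 ?sqr_ge0.
Qed.

Lemma derive1_compose f z : holomorphic f -> modulus z < 1 ->
  derive1 (f \o phi) z = derive1 f (phi z) * derive1 phi z.
Proof.
move=> H z1; apply: cderiv_derive1; apply: (cderiv_comp (f := f)); apply: holo_cderiv => //.
exact: phi_disc.
Qed.

Lemma comp_holo f : holomorphic f -> holomorphic (f \o phi).
Proof.
move=> H; apply: (@cderiv_holo _ (fun z => derive1 f (phi z) * derive1 phi z)) => z z1.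
by apply: (cderiv_comp (f := f)); apply: holo_cderiv => //; exact: phi_disc.
Qed.

Lemma hs_cont z : modulus z < 1 ->
  rcontC (fun z => modulus (derive1 phi z) ^+ 2 / (1 - modulus (phi z) ^+ 2) ^+ 2) z.
Proof.
move=> z1; apply: rcontCM.
  by apply: rcontC_sqr; apply: rcontC_modulus; exact: holo_derive1_ccont.
have := phi_disc z1; have := modulus_ge0 (phi z) => w0 w1.
apply: rcontCV; last by rewrite expf_neq0// gt_eqF//; nra.
apply: rcontC_sqr; apply: rcontCD; first exact: rcontC_cst.
apply: rcontCN; apply: rcontC_sqr; apply: rcontC_modulus.
by apply: cderiv_ccont; exact: holo_cderiv.
Qed.

Lemma phi_measurable (h : C -> R) : (forall z, modulus z < 1 -> rcontC h z) ->
  measurable_fun (plane_ball 1 : set RR) (fun p => (h (plane p))%:E).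
Proof. by move=> hc; apply/measurable_EFinP; exact: rcontC_measurable_disc. Qed.

(** The chain rule and [derive1_growth] at [phi z]: the factor [1 / (1 - |phi z|)^2]
    that the latter costs is what [hs_integral] controls. *)
Lemma comp_dirichlet_area f : holomorphic f -> (dirichlet_area f < +oo)%E -> (dirichlet_area (f \o
  phi) <= (4 * K)%:E * dirichlet_area f)%E.
Proof.
move=> H Hf; have Df : dirichlet_area f \is a fin_num by rewrite ge0_fin_numE ?dirichlet_area_ge0.
rewrite -(fineK Df); set d := fine _.
have d0 : 0 <= d by apply: fine_ge0; exact: dirichlet_area_ge0.
apply: (@le_trans _ _ ((4 * d)%:E * hs_integral phi)%E); last first.
  apply: le_trans (lee_wpmul2l _ phiK) _; first by rewrite lee_fin; lra.
  by rewrite -!EFinM lee_fin mulrAC.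
have -> : ((4 * d)%:E * hs_integral phi = \int[area]_(p in plane_ball 1) ((4 * d)%:E *
  (modulus (derive1 phi (plane p)) ^+ 2 / (1 - modulus (phi (plane p)) ^+ 2) ^+ 2)%:E))%E.
  rewrite ge0_integralZl//.
  - exact: measurable_plane_ball.
  - apply: (phi_measurable (h := fun z => modulus (derive1 phi z) ^+ 2 / (1 - modulus (phi z) ^+ 2) ^+ 2)).
    exact: hs_cont.
  - by move=> p _; rewrite lee_fin divr_ge0 ?sqr_ge0.
  - by rewrite lee_fin; lra.
apply: le_integral_nonmeasurable => p; first by rewrite lee_fin sqr_ge0.
rewrite /plane_ball /mkset; set z := plane p => z1.
rewrite -EFinM lee_fin derive1_compose// modulusM exprMn.
have w1 := phi_disc z1; have := derive1_growth H w1; rewrite -(fineK Df) lee_fin -/d.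
have w0 := modulus_ge0 (phi z); move: w0 w1; set x := modulus (phi z) => w0 w1 h.
have -> : 4 * d * (modulus (derive1 phi z) ^+ 2 / (1 - x ^+ 2) ^+ 2) =
  (4 * d / (1 - x ^+ 2) ^+ 2) * modulus (derive1 phi z) ^+ 2 by ring.
apply: ler_wpM2r; first exact: sqr_ge0.
have x2 : 0 < (1 - x ^+ 2) ^+ 2 by apply: exprn_gt0; nra.
rewrite ler_pdivlMr//; apply: le_trans (_ : 4 * (modulus (derive1 f (phi z)) ^+ 2 * (1 - x) ^+ 2)
  <= _); last first.
  by apply: ler_wpM2l.
have -> : (1 - x ^+ 2) ^+ 2 = (1 + x) ^+ 2 * (1 - x) ^+ 2 by ring.
set M := modulus (derive1 f _) ^+ 2; have M0 : 0 <= M by exact: sqr_ge0.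
have b0 := sqr_ge0 (1 - x).
rewrite [X in X <= _](_ : _ = (1 + x) ^+ 2 * (M * (1 - x) ^+ 2)); last ring.
by apply: ler_wpM2r; [rewrite mulr_ge0|nra].
Qed.

Lemma comp_dirichlet f : dirichlet_space f -> dirichlet_space (f \o phi).
Proof.
move=> [H /dirichlet_finP Hf]; split; first exact: comp_holo.
apply/dirichlet_finP; apply: le_lt_trans (comp_dirichlet_area H Hf) _.
have Df : dirichlet_area f \is a fin_num by rewrite ge0_fin_numE ?dirichlet_area_ge0.
by rewrite -(fineK Df) -EFinM ltry.
Qed.

Lemma comp_bounded : bounded_operator (composition_operator phi).
Proof.
split=> [f|a f g _ _ z _//|]; first exact: comp_dirichlet.
exists (1 + 4 * K) => f [H /dirichlet_finP Hf]; rewrite /dirichlet_normsq /composition_operator /= phi0.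
have Df : dirichlet_area f \is a fin_num by rewrite ge0_fin_numE ?dirichlet_area_ge0.
have := comp_dirichlet_area H Hf; rewrite !dirichlet_integralE -(fineK Df); set d := fine _ => h.
have d0 : 0 <= d by apply: fine_ge0; exact: dirichlet_area_ge0.
have p0 := pi_inv_gt0; have s0 := sqr_ge0 (modulus (f 0)).
apply: (@le_trans _ _ ((modulus (f 0) ^+ 2)%:E + (pi^-1)%:E * ((4 * K)%:E * d%:E))%E).
  by apply: leeD2l; apply: lee_wpmul2l => //; rewrite lee_fin ltW.
rewrite -[X in (_ <= X)%E]/(((1 + 4 * K) * (modulus (f 0) ^+ 2 + pi^-1 * d))%:E).
rewrite -!EFinM -!EFinD lee_fin.
have : 0 <= pi^-1 * d by rewrite mulr_ge0// ltW.
by have := K0; set x := pi^-1 * d; rewrite -/x (_ : pi^-1 * (4 * K * d) = 4 * K * x); [nra|rewrite /x; ring].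
Qed.

(** The monomials, normalised in the Dirichlet norm. *)
Definition basis_coef n : R := if n is 0%N then 1 else Num.sqrt (pi / (n%:R * discarea)).
Definition basis n z : C := RtoC (basis_coef n) * z ^+ n.

Lemma basis_cderiv n z : cderiv (basis n) z (RtoC (basis_coef n) * (n%:R * z ^+ n.-1)).
Proof. by apply: cderivZ; exact: cderivX. Qed.

Lemma basis_derive1 n z : derive1 (basis n) z = RtoC (basis_coef n) * (n%:R * z ^+ n.-1).
Proof. by apply: cderiv_derive1; exact: basis_cderiv. Qed.

Lemma basis_coef_sqr n : n%:R * basis_coef n ^+ 2 = (if n is 0%N then 0 else pi / discarea).
Proof.
case: n => [|n]; first by rewrite mul0r.
have n0 : n.+1%:R != 0 :> R by rewrite pnatr_eq0.
have A0 : discarea != 0 by have := discarea_gt0; case: eqP => // ->; rewrite ltxx.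
rewrite /basis_coef sqr_sqrtr; first by field; rewrite A0 addrC natr1 n0.
by rewrite divr_ge0 ?mulr_ge0 ?pi_ge0// ltW// discarea_gt0.
Qed.

Lemma basis_derive1_sqr n z : modulus (derive1 (basis n) z) ^+ 2 =
  (pi / discarea) * (n%:R * (modulus z ^+ 2) ^+ n.-1).
Proof.
rewrite basis_derive1 !modulusM modulusR modulus_nat modulusX !exprMn real_normK ?num_real//.
have := basis_coef_sqr n; case: n => [|n]; first by rewrite mulr0n expr0n/= !mul0r !mulr0.
rewrite [n.+1.-1]/= => <-; move: (_ ^+ n) => m.
by ring.
Qed.

Lemma basis_holo n : holomorphic (basis n).
Proof. by apply: cderiv_holo => z _; exact: basis_cderiv. Qed.

(** Partial sums of the derivative of the geometric series. *)
Lemma geometric_derivative (x : R) N : 0 <= x < 1 ->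
  \sum_(0 <= n < N) n%:R * x ^+ n.-1 <= 1 / (1 - x) ^+ 2.
Proof.
move=> /andP[x0 x1].
suff E : (\sum_(0 <= n < N.+1) n%:R * x ^+ n.-1) * (1 - x) ^+ 2 =
    1 - N.+1%:R * x ^+ N + N%:R * x ^+ N.+1.
  have h : (\sum_(0 <= n < N.+1) n%:R * x ^+ n.-1) * (1 - x) ^+ 2 <= 1.
    rewrite E exprS -natr1; have := exprn_ge0 N x0; have : 0 <= N%:R :> R by [].
    move: (N%:R) (x ^+ N) => a b a0 b0.
    have : 0 <= a * b by rewrite mulr_ge0.
    have x1' : 0 <= 1 - x by lra.
    by move=> ab; have := mulr_ge0 ab x1'; lra.
  have x2 : 0 < (1 - x) ^+ 2 by apply: exprn_gt0; lra.
  rewrite ler_pdivlMr//; apply: le_trans h; apply: ler_wpM2r; first exact: sqr_ge0.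
  by rewrite big_nat_recr//= lerDl mulr_ge0 ?exprn_ge0.
elim: N => [|N IH]; first by rewrite big_nat1 mulr0n !mul0r mulr1n expr0 mulr1 addr0 subrr.
rewrite big_nat_recr//= mulrDl IH !exprS -!natr1.
by move: (N%:R : R) (x ^+ N) => a b; ring.
Qed.

(** Pointwise, [n |phi|^(2n-2)] sums over [n] to at most [1 / (1 - |phi|^2)^2]. *)
Lemma basis_comp_sum N :
  (\sum_(0 <= n < N) dirichlet_area (basis n \o phi) <= ((pi / discarea) * K)%:E)%E.
Proof.
have pA : 0 <= pi / discarea by rewrite divr_ge0 ?pi_ge0// ltW// discarea_gt0.
have cx z : modulus z < 1 -> rcontC (fun z => modulus (phi z) ^+ 2) z.
  by move=> z1; apply: rcontC_sqr; apply: rcontC_modulus; apply: cderiv_ccont; exact: holo_cderiv.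
have cd z : modulus z < 1 -> rcontC (fun z => modulus (derive1 phi z) ^+ 2) z.
  by move=> z1; apply: rcontC_sqr; apply: rcontC_modulus; exact: holo_derive1_ccont.
have E z : modulus z < 1 -> forall n, modulus (derive1 (basis n \o phi) z) ^+ 2 =
    (pi / discarea) * (modulus (derive1 phi z) ^+ 2 * (n%:R * (modulus (phi z) ^+ 2) ^+ n.-1)).
  move=> z1 n; rewrite (derive1_compose (@basis_holo n) z1).
  have gen (w a b : R) : w * b * a = w * (a * b) by ring.
  rewrite (modulusM (derive1 (basis n) (phi z))) [LHS]exprMn.
  have B := basis_derive1_sqr n (phi z).
  exact: (etrans (congr1 (fun t => t * modulus (derive1 phi z) ^+ 2) B) (gen _ _ _)).
rewrite /dirichlet_area -ge0_integral_sum//; last 3 first.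
- exact: measurable_plane_ball.
- move=> n; apply: (phi_measurable (h := fun z => modulus (derive1 (basis n \o phi) z) ^+ 2)) => z z1.
  apply: rcontC_sqr; apply: rcontC_modulus.
  exact: (holo_derive1_ccont (comp_holo (@basis_holo n)) z1).
- by move=> n p _; rewrite lee_fin sqr_ge0.
apply: (@le_trans _ _ ((pi / discarea)%:E * hs_integral phi)%E); last first.
  rewrite [X in (_ <= X)%E]EFinM; apply: lee_wpmul2l phiK.
  by rewrite lee_fin.
rewrite -ge0_integralZl//; last 3 first.
- exact: measurable_plane_ball.
- exact: (phi_measurable hs_cont).
- by move=> p _; rewrite lee_fin divr_ge0 ?sqr_ge0.
apply: le_integral_nonmeasurable => p; first by rewrite sumEFin lee_fin sumr_ge0// => n _; exact: sqr_ge0.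
rewrite /plane_ball /mkset; set z := plane p => z1.
rewrite sumEFin -EFinM lee_fin; under eq_bigr do rewrite E//.
rewrite -!mulr_sumr; apply: ler_wpM2l => //; apply: ler_wpM2l; first exact: sqr_ge0.
have w1 := phi_disc z1; have w0 := modulus_ge0 (phi z).
have := @geometric_derivative (modulus (phi z) ^+ 2) N; rewrite div1r; apply.
by rewrite sqr_ge0/=; nra.
Qed.

End composition.

(** Averaging over rotations kills the case [a != b]; in the other one the integrand is
    radial. *)
Lemma disc_monomial a b : cintegral area (plane_ball 1) (fun p => plane p ^+ a * (plane p)^* ^+ b) =
  RtoC (if a == b then discarea / a.+1%:R else 0).
Proof.
pose G z : C := z ^+ a * z^* ^+ b.
have Gc z : ccont G z.
  by apply: ccontM; apply: ccontX; [exact: ccont_id|apply: (@ccont_conj R id); exact: ccont_id].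
have [<-|ab] := eqVneq a b.
  have GE z : z ^+ a * z^* ^+ a = RtoC (modulus z ^+ 2 ^+ a).
    by rewrite -exprMn mulC_conj -RtoCX.
  rewrite /cintegral /Rintegral; congr Complex.
    under eq_integral do rewrite GE creR.
    by rewrite disc_moment.
  by under eq_integral do rewrite GE cimR; rewrite integral0.
have circ0 : circint (fun t => cis t ^+ a * (cis t : C)^* ^+ b) = 0.
  have [h|h] := ltnP b a.
    rewrite -(circint_cisX (j := (a - b)%N)) ?subn_gt0//; apply: circint_ext => t.
    by rewrite -{1}(subnK (ltnW h)) exprD -mulrA -exprMn cis_conj expr1n mulr1.
  have {h}h : (a < b)%N by rewrite ltn_neqAle ab.
  have e : (fun t => cis t ^+ a * (cis t : C)^* ^+ b) = fun t => (cis t ^+ (b - a) : C)^*.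
    apply/funext => t; rewrite -{1}(subnK (ltnW h)) exprD mulrCA -exprMn cis_conj expr1n mulr1.
    by rewrite conjCX.
  rewrite e circint_conj ?circint_cisX ?subn_gt0// ?conjC0//.
  by move=> t; apply: rccontX; exact: rccont_cis.
have circG z : circint (fun t => G (z * cis t)) = 0.
  rewrite (circint_ext (g := fun t => G z * (cis t ^+ a * (cis t : C)^* ^+ b))).
    rewrite circintZ ?circ0 ?mulr0// => t; apply: rccontM.
      by apply: rccontX; exact: rccont_cis.
    by apply: rccontX; apply: rccont_conj; exact: rccont_cis.
  by move=> t; rewrite /G conjCM !exprMn; ring.
have t0 := @tau_gt0 R.
have key (h : C -> R) : (forall z, rcontC h z) -> (forall z, modulus z < 1 -> `|h z| <= 1) ->
    (forall z, RI 0 tau (fun t => h (z * cis t)) = 0) ->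
    \int[area]_(p in plane_ball 1) h (plane p) = 0.
  move=> hc hb h0.
  have ih : area.-integrable (plane_ball 1) (fun p => (h (plane p))%:E).
    apply: (@disc_integrable R h (fun=> 0)) => //.
    - by move=> z _; exact: rcontC_cst.
    - by move=> z z1; rewrite addr0; exact: hb.
    - by rewrite integral0.
  have := average_integrable (fun z _ => hc z) ih.
  under [X in _ = X]eq_integral do rewrite h0.
  rewrite integral0 -(fineK (integrable_fin_num (measurable_plane_ball 1) ih)) -EFinM => -[/eqP].
  by rewrite mulf_eq0 => /orP[/eqP e|/eqP//]; move: t0; rewrite e ltxx.
have Gb z : modulus z < 1 -> modulus (G z) <= 1.
  move=> z1; rewrite /G modulusM !modulusX modulusC mulr_ile1 ?exprn_ge0 ?modulus_ge0//.
    by rewrite exprn_ile1 ?modulus_ge0// ltW.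
  by rewrite exprn_ile1 ?modulus_ge0// ltW.
rewrite RtoC0; apply: C_ext.
  apply: (key (fun z => cre (G z))) => [z|z z1|z].
  - by apply: rcontC_re; exact: Gc.
  - by apply: le_trans (cre_le_modulus _) _; exact: Gb.
  - by have /(congr1 cre) := circG z.
apply: (key (fun z => cim (G z))) => [z|z z1|z].
- by apply: rcontC_im; exact: Gc.
- by apply: le_trans (cim_le_modulus _) _; exact: Gb.
- by have /(congr1 cim) := circG z.
Qed.

Lemma cintegralZ (k : R) (F : C -> C) (b : C -> R) : (forall z, modulus z < 1 -> ccont F z) ->
  (forall z, modulus z < 1 -> rcontC b z) ->
  (forall z, modulus z < 1 -> modulus (F z) <= 1 + b z) -> (forall z, 0 <= b z) ->
  (\int[area]_(p in plane_ball 1) (b (plane p))%:E < +oo)%E ->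
  cintegral area (plane_ball 1) (fun p => RtoC k * F (plane p)) =
  RtoC k * cintegral area (plane_ball 1) (fun p => F (plane p)).
Proof.
move=> Fc bc Fb b0 bfin; have mb := @measurable_plane_ball R 1.
have I1 : area.-integrable (plane_ball 1) (fun p => (cre (F (plane p)))%:E).
  apply: (disc_integrable (h := fun z => cre (F z)) _ bc) => //= z z1.
    by apply: rcontC_re; exact: Fc.
  by apply: le_trans (cre_le_modulus _) _; exact: Fb.
have I2 : area.-integrable (plane_ball 1) (fun p => (cim (F (plane p)))%:E).
  apply: (disc_integrable (h := fun z => cim (F z)) _ bc) => //= z z1.
    by apply: rcontC_im; exact: Fc.
  by apply: le_trans (cim_le_modulus _) _; exact: Fb.
apply: C_ext; rewrite ?creZ ?cimZ /cintegral /=.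
  by rewrite -RintegralZl//; apply: eq_Rintegral => p _; rewrite creZ.
by rewrite -RintegralZl//; apply: eq_Rintegral => p _; rewrite cimZ.
Qed.

Lemma cintegral0 (F : RR -> C) : (forall p, F p = 0) -> cintegral area (plane_ball 1) F = 0.
Proof.
move=> F0; rewrite /cintegral (_ : F = fun=> 0); last exact/funext.
by rewrite /Rintegral !integral0.
Qed.

Lemma dirichlet_innerE f g : dirichlet_inner f g = f 0 * (g 0)^* + RtoC pi^-1 *
  cintegral area (plane_ball 1) (fun p => derive1 f (plane p) * (derive1 g (plane p))^*).
Proof. by []. Qed.

Lemma basis0 n : basis n 0 = (n == 0)%N%:R.
Proof. by rewrite /basis; case: n => [|n]; rewrite ?RtoC1 ?mul1r// expr0n/= mulr0. Qed.

Lemma basis_inner m n : dirichlet_inner (basis m) (basis n) = (m == n)%:R.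
Proof.
rewrite dirichlet_innerE !basis0.
case: m n => [|m] [|n].
- rewrite cintegral0 ?mulr0 ?addr0 ?mul1r ?conjC1// => p.
  by rewrite !basis_derive1 mul0r mulr0 mul0r.
- rewrite cintegral0 ?mulr0 ?addr0 ?mul1r ?conjC0// => p.
  by rewrite !basis_derive1 mul0r mulr0 mul0r.
- rewrite cintegral0 ?mulr0 ?addr0 ?mul0r// => p.
  by rewrite !basis_derive1 mul0r mulr0 conjC0 mulr0.
rewrite mul0r add0r.
pose k : R := basis_coef m.+1 * basis_coef n.+1 * m.+1%:R * n.+1%:R.
have -> : (fun p : RR => derive1 (basis m.+1) (plane p) * (derive1 (basis n.+1) (plane p))^*) =
    (fun p => RtoC k * (plane p ^+ m * (plane p)^* ^+ n)).
  apply/funext => p; rewrite !basis_derive1 !conjCM conjCX /k !RtoCM !RtoC_nat conjC_nat.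
  have -> a : (RtoC a)^* = RtoC a by apply: C_ext; rewrite !cE ?oppr0.
  by rewrite -!pred_Sn; ring.
rewrite (@cintegralZ k (fun z => z ^+ m * z^* ^+ n) (fun=> 0)); last 5 first.
- move=> z _; apply: ccontM; apply: ccontX; first exact: ccont_id.
  by apply: (@ccont_conj R id); exact: ccont_id.
- by move=> z _; exact: rcontC_cst.
- move=> z z1; rewrite addr0 modulusM !modulusX modulusC mulr_ile1 ?exprn_ge0 ?modulus_ge0//;
  by rewrite exprn_ile1 ?modulus_ge0// ltW.
- by [].
- by rewrite integral0.
rewrite disc_monomial eqSS; have [e|mn] := eqVneq m n; last by rewrite RtoC0 !mulr0.
subst n.
rewrite -!RtoCM -RtoC1; congr RtoC; have := basis_coef_sqr m.+1 => /= h.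
have p0 : pi != 0 :> R by have := @pi_gt0 R; case: eqP => // ->; rewrite ltxx.
have A0 : discarea != 0 by have := discarea_gt0; case: eqP => // ->; rewrite ltxx.
have n0 : m.+1%:R != 0 :> R by rewrite pnatr_eq0.
have -> : k = m.+1%:R * (m.+1%:R * basis_coef m.+1 ^+ 2) by rewrite /k; ring.
rewrite h; move: (m.+1%:R) n0 (pi : R) p0 (discarea) A0 => x x0 y y0 w w0.
by field; rewrite x0 y0 w0.
Qed.

(** The inner products with monomials are the moments of the derivative against
    powers of the conjugate variable, so that [bergman_complete] applies. *)
Lemma basis_complete f : dirichlet_space f -> (forall n, dirichlet_inner f (basis n) = 0) ->
  forall z, disc z -> f z = 0.
Proof.
move=> [H /dirichlet_finP Hf] Hn.
have f0 : f 0 = 0.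
  have := Hn 0%N; rewrite dirichlet_innerE basis0 conjC1 mulr1 cintegral0 ?mulr0 ?addr0// => p.
  by rewrite basis_derive1 mul0r mulr0 conjC0 mulr0.
have d0 : forall a, modulus a < 1 -> derive1 f a = 0.
  apply: bergman_complete => //; first by move=> u; exact: holo_derive1.
  move=> j; have := Hn j.+1; rewrite dirichlet_innerE f0 mul0r add0r.
  pose k : R := basis_coef j.+1 * j.+1%:R.
  have -> : (fun p : RR => derive1 f (plane p) * (derive1 (basis j.+1) (plane p))^*) =
      (fun p => RtoC k * (derive1 f (plane p) * (plane p)^* ^+ j)).
    apply/funext => p; rewrite basis_derive1 !conjCM conjCX /k !RtoCM !RtoC_nat conjC_nat.
    have -> a : (RtoC a)^* = RtoC a by apply: C_ext; rewrite !cE ?oppr0.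
    by rewrite -!pred_Sn; ring.
  rewrite (@cintegralZ k (fun z => derive1 f z * z^* ^+ j) (fun z => modulus (derive1 f z) ^+ 2)).
  - move=> /eqP; rewrite mulf_eq0 => /orP[/eqP /(congr1 cre)|].
      by rewrite creR cre0 => h; have := pi_inv_gt0; rewrite h ltxx.
    rewrite mulf_eq0 => /orP[/eqP /(congr1 cre)|/eqP//]; rewrite creR cre0 => k0.
    have := basis_coef_sqr j.+1; rewrite /= expr2 mulrA (mulrC j.+1%:R) -/k k0 mul0r => /esym/eqP.
    by rewrite gt_eqF// divr_gt0 ?pi_gt0 ?discarea_gt0.
  - move=> z z1; apply: ccontM; first exact: holo_derive1_ccont.
    by apply: ccontX; apply: (@ccont_conj R id); exact: ccont_id.
  - by move=> z z1; apply: rcontC_sqr; apply: rcontC_modulus; exact: holo_derive1_ccont.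
  - move=> z z1; rewrite modulusM modulusX modulusC.
    have h1 : modulus z ^+ j <= 1 by rewrite exprn_ile1 ?modulus_ge0// ltW.
    have h2 : 0 <= modulus z ^+ j by rewrite exprn_ge0 ?modulus_ge0.
    have := modulus_ge0 (derive1 f z); set m := modulus (derive1 f z) => m0.
    apply: (@le_trans _ _ m); first by nra.
    by have := sqr_ge0 (m - 1); nra.
  - by move=> z; exact: sqr_ge0.
  - exact: Hf.
move=> z z1; apply/eqP; rewrite -modulus_eq0 eq_le modulus_ge0 andbT.
have := @complex_mvt R f (derive1 f) z 0 0; rewrite f0 !subr0 mulr0 mul0r; apply.
move=> t t01.
have tz : modulus (0 + RtoC t * z) < 1.
  rewrite add0r modulusM modulusR; move: z1 (modulus_ge0 z); rewrite /disc /mkset => z1 z0.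
  by rewrite ger0_norm; nra.
by split; [exact: holo_cderiv|rewrite d0// modulus0].
Qed.

Lemma basis_orthonormal : orthonormal_basis basis.
Proof.
split; last exact: basis_complete; last exact: basis_inner.
move=> n; split; first exact: basis_holo.
apply/dirichlet_finP; rewrite /dirichlet_area.
have pA : 0 <= pi / discarea by rewrite divr_ge0 ?pi_ge0// ltW// discarea_gt0.
apply: (@le_lt_trans _ _ (\int[area]_(p in plane_ball 1) (pi / discarea * n%:R)%:E)%E).
  apply: le_integral_nonmeasurable => p; first by rewrite lee_fin sqr_ge0.
  rewrite /plane_ball /mkset => p1; rewrite lee_fin basis_derive1_sqr; apply: ler_wpM2l => //.
  by rewrite ler_piMr// exprn_ile1 ?sqr_ge0// exprn_ile1 ?modulus_ge0// ltW.
rewrite integral_cst; last exact: measurable_plane_ball.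
rewrite -[X in (_ * X)%E]/(area (plane_ball 1)).
by rewrite area_disc -EFinM ltry.
Qed.

(** A self-map of the disc fixing the origin whose hyperbolic area, counted with
    multiplicity, is finite induces a Hilbert-Schmidt operator: expand in monomials
    and sum [n |phi|^(2n-2)]. *)
Lemma composition_hilbert_schmidt phi (K : R) : holomorphic phi ->
  (forall z, modulus z < 1 -> modulus (phi z) < 1) -> phi 0 = 0 ->
  (hs_integral phi <= K%:E)%E -> hilbert_schmidt (composition_operator phi).
Proof.
move=> H1 H2 H3 H4; split; first exact: (comp_bounded H1 H2 H3 H4).
exists basis; first exact: basis_orthonormal.
have pA : 0 <= pi / discarea by rewrite divr_ge0 ?pi_ge0// ltW// discarea_gt0.
pose B : \bar R := (1 + (pi^-1)%:E * ((pi / discarea) * K)%:E)%E.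
apply: (@le_lt_trans _ _ B); last by rewrite /B -EFinM -EFinD ltry.
have n0 n : (0 <= dirichlet_normsq (composition_operator phi (basis n)))%E.
  rewrite /dirichlet_normsq dirichlet_integralE adde_ge0 ?lee_fin ?sqr_ge0//.
  by rewrite mule_ge0 ?dirichlet_area_ge0// lee_fin ltW// pi_inv_gt0.
apply: lime_le; first by apply: is_cvg_nneseries => n _ _; exact: n0.
apply: nearW => N; rewrite /dirichlet_normsq big_split/=; apply: leeD.
  rewrite /composition_operator /= H3; under eq_bigr do rewrite basis0.
  case: N => [|N]; first by rewrite big_geq.
  rewrite big_nat_recl// modulus1 expr1n big1 ?adde0// => n _.
  by rewrite modulus0 expr0n.
under eq_bigr do rewrite dirichlet_integralE.
rewrite -ge0_sume_distrr; last by move=> n _; exact: dirichlet_area_ge0.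
apply: lee_wpmul2l; first by rewrite lee_fin ltW// pi_inv_gt0.
exact: basis_comp_sum.
Qed.

(** The hyperbolic density is bounded below by 1. *)
Lemma self_map_dirichlet phi (K : R) : holomorphic phi ->
  (forall z, modulus z < 1 -> modulus (phi z) < 1) ->
  (hs_integral phi <= K%:E)%E -> dirichlet_space phi.
Proof.
move=> H1 H2 H4; split => //; apply/dirichlet_finP.
apply: le_lt_trans (ltry K); apply: le_trans H4; apply: le_integral_nonmeasurable => p.
  by rewrite lee_fin sqr_ge0.
rewrite /plane_ball /mkset => /H2; set x := modulus (phi _) => x1.
have x0 : 0 <= x := modulus_ge0 _.
rewrite lee_fin ler_pdivlMr; last by apply: exprn_gt0; nra.
rewrite ler_piMr ?sqr_ge0// exprn_ile1//; nra.
Qed.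

End DirichletSpace.

(** * Logarithmic potentials of finite sets *)

Section LogKernel.
Context {R : realType}.
Local Notation C := (Cplx R).
Implicit Types (z w u v h : C).

(** Partial sums of the Taylor series of [- log (1 - w)]. *)
Definition logsum N w : C := \sum_(1 <= n < N.+1) RtoC n%:R^-1 * w ^+ n.

Lemma invn_gt0 n : 0 < (n.+1%:R : R)^-1.
Proof. by rewrite invr_gt0 ltr0n. Qed.

Lemma modulus_powle1 w n : modulus w <= 1 -> modulus (w ^+ n) <= 1.
Proof. by move=> w1; rewrite modulusX exprn_ile1 ?modulus_ge0. Qed.

(** Summation by parts. *)
Lemma logsum_tail M k w : modulus w <= 1 ->
  modulus ((1 - w) * \sum_(M.+1 <= n < (M.+1 + k)%N) RtoC n%:R^-1 * w ^+ n) <= 2 / M.+1%:R.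
Proof.
move=> w1.
(* The induction runs on the sharper bound that includes the boundary term. *)
suff H : modulus ((1 - w) * (\sum_(M.+1 <= n < (M.+1 + k)%N) RtoC n%:R^-1 * w ^+ n) +
    RtoC (M.+1 + k)%:R^-1 * w ^+ (M.+1 + k)) <= 2 / M.+1%:R - (M.+1 + k)%:R^-1.
  set T := (1 - w) * _ in H *; set t := RtoC _ * _ in H.
  have t1 : modulus t <= (M.+1 + k)%:R^-1.
    rewrite modulusM modulusR ger0_norm ?invr_ge0// ler_piMr ?invr_ge0//.
    exact: modulus_powle1.
  have h := modulusB (T + t) t; rewrite addrK in h; apply: le_trans h _.
  by have := lerD H t1; rewrite subrK.
elim: k => [|k IH].
  rewrite addn0 big_geq// mulr0 add0r modulusM modulusR ger0_norm ?invr_ge0//.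
  have := invn_gt0 M; have := modulus_powle1 M.+1 w1; have := modulus_ge0 (w ^+ M.+1).
  set a := modulus _; set b := _^-1 => *; nra.
rewrite addnS big_nat_recr ?leq_addr//= mulrDr.
set S := (1 - w) * _ in IH *; set m := (M.+1 + k)%N in IH *.
have -> : S + (1 - w) * (RtoC m%:R^-1 * w ^+ m) + RtoC m.+1%:R^-1 * w ^+ m.+1 =
  (S + RtoC m%:R^-1 * w ^+ m) - RtoC (m%:R^-1 - m.+1%:R^-1) * w ^+ m.+1.
  by rewrite (RtoCD _ (- _)) (_ : RtoC (- m.+1%:R^-1) = - RtoC m.+1%:R^-1) ?exprS;
    [ring|apply: C_ext; rewrite !cE ?oppr0].
apply: le_trans (modulusB _ _) _.
have d0 : 0 <= (m%:R : R)^-1 - m.+1%:R^-1.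
  have m0 : (0 < m)%N by rewrite /m addSn.
  by rewrite subr_ge0 lef_pV2 ?posrE ?ltr0n// ler_nat.
rewrite modulusM modulusR ger0_norm//.
have := modulus_powle1 m.+1 w1; have := modulus_ge0 (w ^+ m.+1).
move: IH; set X := modulus (S + _); set a := modulus _; move: d0; set b := _ - _ => d0 h1 h2 h3.
have : b * a <= b by nra.
have bE : b = m%:R^-1 - m.+1%:R^-1 by [].
by move=> h4; apply: le_trans (lerD h1 h4) _; rewrite bE addrA subrK.
Qed.

Lemma pow_sub_le z w n : modulus z <= 1 -> modulus w <= 1 ->
  modulus (z ^+ n - w ^+ n) <= n%:R * modulus (z - w).
Proof.
move=> z1 w1; elim: n => [|n IH]; first by rewrite !expr0 subrr modulus0 mul0r.
rewrite (_ : _ - _ = z * (z ^+ n - w ^+ n) + (z - w) * w ^+ n); last by rewrite !exprS; ring.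
apply: le_trans (modulusD _ _) _; rewrite !modulusM -natr1 mulrDl mul1r.
have := modulus_powle1 n w1; have := modulus_ge0 (w ^+ n).
have := modulus_ge0 (z ^+ n - w ^+ n); have := modulus_ge0 (z - w); have := modulus_ge0 z.
move: (modulus (z - w)) (modulus (w ^+ n)) (modulus (z ^+ n - w ^+ n)) IH (modulus z) z1.
move=> a b c IH d d1 d0 a0 c0 b0 b1.
have : d * c <= c by nra.
have : a * b <= a by nra.
by lra.
Qed.

(** The [n]-th term differs from its value at [w = 1], which is real and positive, by
    at most [|1 - w|]. *)
Lemma logsum_head M w : modulus w <= 1 ->
  `|cim (logsum M w)| <= M%:R * modulus (1 - w) /\ - (M%:R * modulus (1 - w)) <= cre (logsum M w).
Proof.
move=> w1; rewrite /logsum; elim: M => [|M [IH1 IH2]].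
  by rewrite big_geq// mul0r cim0 cre0 normr0 oppr0.
rewrite big_nat_recr//= creD cimD creZ cimZ.
set S := \sum_(1 <= n < _) _ in IH1 IH2 *.
have m1 : modulus (1 : C) <= 1 by rewrite modulus1.
have h := @pow_sub_le w 1 M.+1 w1 m1; rewrite expr1n (modulus_distC (w ^+ _)) (modulus_distC w) in h.
have hi := le_trans (cim_le_modulus _) h; have hr := le_trans (cre_le_modulus _) h.
rewrite !cE sub0r normrN in hi; rewrite !cE in hr.
have n0 := invn_gt0 M; have n1 : (M.+1%:R : R)^-1 * M.+1%:R = 1 by rewrite mulVf// pnatr_eq0.
move: n0 n1 hi hr IH1 IH2; rewrite -(natr1 M).
set n := (M%:R + 1 : R); set i := n^-1; set d := modulus _; set y := cim (w ^+ _).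
set x := cre (w ^+ _); set a := cre S; set b := cim S => n0 n1.
have d0 : 0 <= d := modulus_ge0 _.
have nM : n = M%:R + 1 by [].
rewrite !ler_norml => /andP[y1 y2] /andP[x1 x2] /andP[b1 b2] a1.
have iy1 : - d <= i * y by rewrite -[d]mul1r -n1 -mulrA -mulrN; apply: ler_wpM2l => //; exact: ltW.
have iy2 : i * y <= d by rewrite -[d]mul1r -n1 -mulrA; apply: ler_wpM2l => //; exact: ltW.
have ix : i * (1 - x) <= d.
  rewrite -[X in _ <= X]mul1r -[X in _ <= X * _]n1 -mulrA; apply: ler_wpM2l => //; exact: ltW.
rewrite nM mulrDl mul1r; split; first by apply/andP; split; lra.
by move: ix; rewrite mulrBr mulr1; lra.
Qed.

(** Cut the sum at [1 / |1 - w|]: below the terms stay close to those at [w = 1],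
    above the tail cancels. *)
Lemma logsum_bounds N w : modulus w <= 1 ->
  `|cim (logsum N w)| <= 3 /\ -3 <= cre (logsum N w).
Proof.
move=> w1; have [/eqP e|w_neq1] := boolP (1 - w == 0).
  have [] := logsum_head N w1; rewrite e modulus0 mulr0 oppr0 => h1 h2.
  by split; [exact: le_trans h1 _|apply: le_trans h2; lra].
have d0 : 0 < modulus (1 - w) by rewrite modulus_gt0.
(* Up to [m] the deviation is at most 1, beyond [m] the sum is at most 2. *)
set d := modulus _ in d0; pose m := Num.truncn (d^-1).
have dV0 : 0 <= d^-1 by rewrite invr_ge0 ltW.
have := truncn_itv dV0; rewrite -/m => /andP[m1 m2].
have md : m%:R * d <= 1 by rewrite -ler_pdivlMr// mul1r.
have mS : 1 <= m.+1%:R * d by rewrite -ler_pdivrMr// mul1r ltW.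
have [Nm|mN] := leqP N m.
  have [h1 h2] := logsum_head N w1; rewrite -/d in h1 h2.
  have : N%:R * d <= m%:R * d by apply: ler_wpM2r; [exact: ltW|rewrite ler_nat].
  by move=> h3; split; lra.
have -> : logsum N w = logsum m w + \sum_(m.+1 <= n < (m.+1 + (N - m))%N) RtoC n%:R^-1 * w ^+ n.
  by rewrite /logsum addSn subnKC ?(ltnW mN)// (big_cat_nat (n := m.+1))//= ltnS ltnW.
have [h1 h2] := logsum_head m w1; rewrite -/d in h1 h2.
have := logsum_tail m (N - m) w1; set T := \sum_(m.+1 <= n < _) _.
rewrite modulusM -/d => hT.
have T2 : modulus T <= 2.
  have n0 := invn_gt0 m; have n1 : (m.+1%:R : R)^-1 * m.+1%:R = 1 by rewrite mulVf// pnatr_eq0.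
  have t0 := modulus_ge0 T; move: hT mS n0 n1 t0.
  move: (m.+1%:R : R) (modulus T) => x t h4 h5; move: h4; set y := x^-1 => h4 h6 h7 h8.
  have : y <= d by rewrite -[d]mul1r -h7 -mulrA ler_peMr// ltW.
  by nra.
have := cim_le_modulus T; have := cre_le_modulus T; rewrite creD cimD !ler_norml.
move: h1; rewrite ler_norml => /andP[a1 a2] /andP[b1 b2] /andP[c1 c2].
by split; [apply/andP; split; lra|lra].
Qed.

Lemma logsum_far N w : modulus w <= 1 -> modulus (1 - w) * modulus (logsum N w) <= 2.
Proof. by move=> w1; have := logsum_tail 0 N w1; rewrite add1n modulusM divr1. Qed.

End LogKernel.

Section FinitePotential.
Context {R : realType}.
Local Notation C := (Cplx R).
Local Notation area := (@area R).
Local Notation RR := (measurableTypeR R * measurableTypeR R)%type.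
Implicit Types (z w u v h : C) (s : seq C).

(** Fourier coefficients of the equidistributed probability measure on [s]. *)
Definition phat s n : C := RtoC (size s)%:R^-1 * \sum_(x <- s) x^* ^+ n.

(** Truncated logarithmic potential, as the real part of an analytic function, and
    truncated energy. *)
Definition pot s z : C := \sum_(1 <= n < (size s).+1) RtoC n%:R^-1 * (phat s n * z ^+ n).
Definition pot' s z : C := \sum_(1 <= n < (size s).+1) phat s n * z ^+ n.-1.
Definition truncated_energy s : R := \sum_(1 <= n < (size s).+1) modulus (phat s n) ^+ 2 / n%:R.

Definition on_circle s := {in s, forall x, modulus x = 1}.

Lemma big_avg (T : eqType) (s : seq T) (F : T -> R) (M : R) : s != [::] ->
  {in s, forall x, F x <= M} -> (size s)%:R^-1 * \sum_(x <- s) F x <= M.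
Proof.
move=> s0 H; have sz : 0 < (size s)%:R :> R by rewrite ltr0n lt0n size_eq0.
rewrite mulrC ler_pdivrMr//.
have -> : M * (size s)%:R = \sum_(x <- s) M by rewrite big_const_seq count_predT iter_addr_0 mulr_natr.
by rewrite big_seq_cond [X in _ <= X]big_seq_cond; apply: ler_sum => x /andP[xs _]; exact: H.
Qed.

Variables (s : seq C).
Hypothesis (s0 : s != [::]) (sc : on_circle s).
Local Notation N := (size s).

Lemma size_inv_ge0 : 0 <= (N%:R : R)^-1.
Proof. by rewrite invr_ge0. Qed.

Lemma phat_le1 n : modulus (phat s n) <= 1.
Proof.
rewrite /phat modulusM modulusR ger0_norm ?size_inv_ge0//.
apply: le_trans (_ : N%:R^-1 * \sum_(x <- s) modulus (x^* ^+ n) <= _).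
  by apply: ler_wpM2l; [exact: size_inv_ge0|exact: modulus_sum].
by apply: big_avg => // x /sc x1; rewrite modulusX modulusC x1 expr1n.
Qed.

Lemma pot0 : pot s 0 = 0.
Proof.
rewrite /pot big_nat; apply: big1 => n /andP[n0 _].
by rewrite expr0n; case: n n0 => // n _; rewrite !mulr0.
Qed.

(** The potential is the mean of logarithmic kernels centred at the points, so that
    bounds for the kernel carry over. *)
Lemma pot_average z : pot s z = RtoC N%:R^-1 * \sum_(x <- s) logsum N (z * x^*).
Proof.
rewrite /pot /logsum exchange_big /= mulr_sumr; apply: eq_bigr => n _.
rewrite /phat -!mulrA mulrCA mulr_suml mulr_sumr; congr (_ * _); apply: eq_bigr => x _.
by rewrite exprMn; ring.
Qed.

Lemma rot_le1 z x : modulus z <= 1 -> x \in s -> modulus (z * x^*) <= 1.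
Proof. by move=> z1 /sc x1; rewrite modulusM modulusC x1 mulr1. Qed.

Lemma pot_im z : modulus z <= 1 -> `|cim (pot s z)| <= 3.
Proof.
move=> z1; rewrite pot_average cimZ cim_sum ler_norml; apply/andP; split; last first.
  by apply: big_avg => // x /(rot_le1 z1)/(logsum_bounds N)[+ _]; rewrite ler_norml => /andP[].
rewrite lerNl -mulrN -sumrN; apply: big_avg => // x /(rot_le1 z1)/(logsum_bounds N)[+ _].
by rewrite ler_norml => /andP[+ _]; lra.
Qed.

Lemma pot_re z : modulus z <= 1 -> -3 <= cre (pot s z).
Proof.
move=> z1; rewrite pot_average creZ cre_sum.
rewrite lerNl -mulrN -sumrN; apply: big_avg => // x /(rot_le1 z1)/(logsum_bounds N)[_].
by lra.
Qed.

Lemma pot_far z (d : R) : modulus z <= 1 -> 0 < d -> {in s, forall x, d <= modulus (z - x)} ->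
  modulus (pot s z) <= 2 / d.
Proof.
move=> z1 d0 H; rewrite pot_average modulusM modulusR ger0_norm ?size_inv_ge0//.
apply: le_trans (_ : N%:R^-1 * \sum_(x <- s) modulus (logsum N (z * x^*)) <= _).
  by apply: ler_wpM2l; [exact: size_inv_ge0|exact: modulus_sum].
apply: big_avg => // x xs; have := logsum_far N (rot_le1 z1 xs).
have -> : modulus (1 - z * x^*) = modulus (z - x).
  have xx := mulC_conj x; rewrite (sc xs) expr1n RtoC1 in xx.
  rewrite (_ : 1 - z * x^* = (x - z) * x^*); last by rewrite mulrBl xx.
  by rewrite modulusM modulusC (sc xs) mulr1 modulus_distC.
move=> h; rewrite ler_pdivlMr// mulrC; apply: le_trans h.
by apply: ler_wpM2r; [exact: modulus_ge0|exact: H].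
Qed.

Lemma pot_lip z w : modulus z <= 1 -> modulus w <= 1 ->
  modulus (pot s z - pot s w) <= N%:R * modulus (z - w).
Proof.
move=> z1 w1; rewrite /pot -sumrB; apply: le_trans (modulus_sum _ _ _) _.
have -> : N%:R * modulus (z - w) = \sum_(1 <= n < N.+1) modulus (z - w).
  by rewrite sumr_const_nat subn1/= mulr_natl.
rewrite big_nat [X in _ <= X]big_nat; apply: ler_sum => -[//|n] _.
rewrite -mulrBr -mulrBr modulusM (modulusM (phat s n.+1)) modulusR ger0_norm ?invr_ge0//.
have n0 := @invn_gt0 R n.
have n1 : (n.+1%:R : R)^-1 * n.+1%:R = 1 by rewrite mulVf// pnatr_eq0.
have := @pow_sub_le R z w n.+1 z1 w1; have := phat_le1 n.+1.
have := modulus_ge0 (phat s n.+1); have := modulus_ge0 (z ^+ n.+1 - w ^+ n.+1).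
move: n0 n1 (modulus (phat s n.+1)) (modulus (z ^+ n.+1 - _)) (modulus (z - w)).
move: (n.+1%:R : R) => x; set i := x^-1 => i0 ix a b c b0 a0 a1 bc.
have : a * b <= x * c by nra.
move=> h; rewrite -[c]mul1r -ix -mulrA; apply: ler_wpM2l => //; exact: ltW.
Qed.

Lemma pow_remainder z h n (r : R) : modulus z <= r -> modulus (z + h) <= r ->
  modulus ((z + h) ^+ n - z ^+ n - n%:R * z ^+ n.-1 * h) <=
  n%:R * (n.-1%:R * r ^+ n.-2) * modulus h ^+ 2.
Proof.
move=> zr zhr; have r0 : 0 <= r := le_trans (modulus_ge0 _) zr.
elim: n => [|n IH]; first by rewrite !expr0 mulr0n !mul0r subr0 subrr modulus0 ?mulr0n ?mul0r.
set X := _ - _ in IH.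
have -> : (z + h) ^+ n.+1 - z ^+ n.+1 - n.+1%:R * z ^+ n * h =
    (z + h) * X + n%:R * z ^+ n.-1 * h ^+ 2.
  rewrite /X; case: n {IH X} => [|n]; first by rewrite !expr0 !expr1; ring.
  by rewrite [n.+1.-1]/= !exprS -!natr1; ring.
apply: le_trans (modulusD _ _) _; rewrite !modulusM modulus_nat !modulusX.
have h1 : modulus (z + h) * modulus X <= r * (n%:R * (n.-1%:R * r ^+ n.-2) * modulus h ^+ 2).
  by apply: ler_pM => //; exact: modulus_ge0.
have h2 : modulus z ^+ n.-1 <= r ^+ n.-1 by apply: lerXn2r; rewrite ?nnegrE ?modulus_ge0.
have h3 : n%:R * modulus z ^+ n.-1 * modulus h ^+ 2 <= n%:R * r ^+ n.-1 * modulus h ^+ 2.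
  by apply: ler_wpM2r; [exact: sqr_ge0|apply: ler_wpM2l].
apply: le_trans (lerD h1 h3) _; rewrite mulrA -mulrDl; apply: ler_wpM2r; first exact: sqr_ge0.
case: n {IH X h1 h2 h3} => [|[|n]].
- by rewrite [1.-1]/= mulr0n !mul0r !mulr0 addr0.
- by rewrite /= !expr0 mulr0n !mul0r !mulr0 add0r; lra.
rewrite /= exprS -!natr1.
have := exprn_ge0 n r0; move: (r ^+ n) => x x0; have : 0 <= r * x by rewrite mulr_ge0.
have : 0 <= n%:R :> R by []; move: (n%:R : R) => y y0 rx.
have -> : r * ((y + 1 + 1) * ((y + 1) * x)) + (y + 1 + 1) * (r * x) = (y + 2) * (y + 2) * (r * x) by ring.
have -> : (y + 1 + 1 + 1) * ((y + 1 + 1) * (r * x)) = (y + 3) * (y + 2) * (r * x) by ring.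
apply: ler_wpM2r => //; nra.
Qed.

Lemma geom_sum_le (r : R) n : 0 <= r < 1 -> \sum_(1 <= k < n.+1) r ^+ k.-1 <= 1 / (1 - r).
Proof.
move=> /andP[r0 r1]; rewrite ler_pdivlMr; last by lra.
suff -> : (\sum_(1 <= k < n.+1) r ^+ k.-1) * (1 - r) = 1 - r ^+ n.
  by rewrite lerBlDr lerDl exprn_ge0.
elim: n => [|n IH]; first by rewrite big_geq// mul0r expr0 subrr.
by rewrite big_nat_recr//= mulrDl IH exprS; ring.
Qed.

Lemma geom_deriv_le (r : R) n : 0 <= r < 1 ->
  \sum_(1 <= k < n.+1) k.-1%:R * r ^+ k.-2 <= 1 / (1 - r) ^+ 2.
Proof.
move=> r01; rewrite big_add1 /=; apply: le_trans (geometric_derivative n r01).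
by [].
Qed.

(** The bound is the same for all configurations, however large; this is what allows
    series of potentials to be differentiated term by term. *)
Lemma pot_quad z h (r : R) : r < 1 -> modulus z <= r -> modulus (z + h) <= r ->
  modulus (pot s (z + h) - pot s z - pot' s z * h) <= modulus h ^+ 2 / (1 - r) ^+ 2.
Proof.
move=> r1 zr zhr; have r0 : 0 <= r := le_trans (modulus_ge0 _) zr.
rewrite /pot /pot' mulr_suml -!sumrB; apply: le_trans (modulus_sum _ _ _) _.
apply: (@le_trans _ _ (\sum_(1 <= k < N.+1) (modulus h ^+ 2 * (k.-1%:R * r ^+ k.-2)))); last first.
  rewrite -mulr_sumr -[X in _ <= _ * X]div1r; apply: ler_wpM2l; first exact: sqr_ge0.
  by apply: geom_deriv_le; rewrite r0.
rewrite big_nat [X in _ <= X]big_nat; apply: ler_sum => -[//|n] _.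
have n0 := @invn_gt0 R n.
have n1 : (n.+1%:R : R)^-1 * n.+1%:R = 1 by rewrite mulVf// pnatr_eq0.
have -> : RtoC n.+1%:R^-1 * (phat s n.+1 * (z + h) ^+ n.+1) -
  RtoC n.+1%:R^-1 * (phat s n.+1 * z ^+ n.+1) - phat s n.+1 * z ^+ n.+1.-1 * h =
  RtoC n.+1%:R^-1 * (phat s n.+1 * ((z + h) ^+ n.+1 - z ^+ n.+1 - n.+1%:R * z ^+ n.+1.-1 * h)).
  have : RtoC n.+1%:R^-1 * n.+1%:R = 1 :> C by rewrite -(@RtoC_nat R n.+1) -RtoCM n1 RtoC1.
  move: (RtoC _) (n.+1%:R : C) => a b ab; rewrite !mulrBr.
  by congr (_ - _); rewrite -[LHS]mul1r -ab; ring.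
rewrite modulusM (modulusM (phat s n.+1)) modulusR ger0_norm ?(ltW n0)//.
have := @pow_remainder z h n.+1 r zr zhr; have := phat_le1 n.+1.
have := modulus_ge0 (phat s n.+1).
have := modulus_ge0 ((z + h) ^+ n.+1 - z ^+ n.+1 - n.+1%:R * z ^+ n.+1.-1 * h).
move: (modulus (_ - _)) (modulus (phat s n.+1)) => a b a0 b0 b1.
rewrite -mulrA; move: (_ * modulus h ^+ 2) (mulrC (modulus h ^+ 2) (n.+1.-1%:R * r ^+ n.+1.-2)).
move: n0 n1; move: (n.+1%:R : R) => x; set i := x^-1 => i0 ix c -> h1.
have : b * a <= x * c by nra.
move=> h2; rewrite -[c]mul1r -ix -mulrA; apply: ler_wpM2l => //; exact: ltW.
Qed.

Lemma pot'_le z (r : R) : r < 1 -> modulus z <= r -> modulus (pot' s z) <= 1 / (1 - r).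
Proof.
move=> r1 zr; have r0 : 0 <= r := le_trans (modulus_ge0 _) zr.
apply: le_trans (modulus_sum _ _ _) _; apply: le_trans (@geom_sum_le r N _); last by rewrite r0.
apply: ler_sum => n _; rewrite modulusM modulusX.
have := phat_le1 n; have : modulus z ^+ n.-1 <= r ^+ n.-1 by apply: lerXn2r; rewrite ?nnegrE ?modulus_ge0.
have := exprn_ge0 n.-1 (modulus_ge0 z); have := modulus_ge0 (phat s n); nra.
Qed.

End FinitePotential.

(** * Fekete configurations *)

Section AreaEnergy.
Context {R : realType}.
Local Notation C := (Cplx R).
Local Notation area := (@area R).
Local Notation discarea := (@discarea R).
Local Notation RR := (measurableTypeR R * measurableTypeR R)%type.
Implicit Types (z w u v h : C) (F G : C -> C) (s : seq C).

Definition bounded_cont F := (forall z, ccont F z) /\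
  exists B : R, forall z, modulus z < 1 -> modulus (F z) <= B.

Definition disc_int F : C := cintegral area (plane_ball 1) (fun p => F (plane p)).

Lemma bounded_integrable (h : C -> R) (B : R) : (forall z, modulus z < 1 -> rcontC h z) ->
  (forall z, modulus z < 1 -> `|h z| <= B) ->
  area.-integrable (plane_ball 1) (fun p => (h (plane p))%:E).
Proof.
move=> hc hB; apply: (@disc_integrable R h (fun=> Num.max B 0)) => //.
- by move=> z _; exact: rcontC_cst.
- move=> z /hB h1; apply: le_trans h1 _.
  have mB : B <= Num.max B 0 by rewrite le_max lexx.
  lra.
- by move=> z; rewrite le_max lexx orbT.
rewrite integral_cst; last exact: measurable_plane_ball.
rewrite -[X in (_ * X)%E]/(area (plane_ball 1)).
by rewrite area_disc -EFinM ltry.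
Qed.

Lemma bounded_cont_re F : bounded_cont F -> area.-integrable (plane_ball 1) (fun p => (cre (F (plane p)))%:E).
Proof.
move=> [Fc [B FB]]; apply: (@bounded_integrable (fun z => cre (F z)) B) => z z1.
  exact: rcontC_re.
by apply: le_trans (cre_le_modulus _) _; exact: FB.
Qed.

Lemma bounded_cont_im F : bounded_cont F -> area.-integrable (plane_ball 1) (fun p => (cim (F (plane p)))%:E).
Proof.
move=> [Fc [B FB]]; apply: (@bounded_integrable (fun z => cim (F z)) B) => z z1.
  exact: rcontC_im.
by apply: le_trans (cim_le_modulus _) _; exact: FB.
Qed.

Lemma ccont_cst (a : C) z : ccont (fun=> a) z.
Proof. by move=> e e0; exists 1 => // w _; rewrite subrr modulus0. Qed.

Lemma ccontD F G z : ccont F z -> ccont G z -> ccont (fun w => F w + G w) z.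
Proof.
move=> Fc Gc; apply: ccontP.
  rewrite (_ : (fun w => _) = fun w => cre (F w) + cre (G w)); last by apply/funext => w; rewrite creD.
  by apply: rcontCD; exact: rcontC_re.
rewrite (_ : (fun w => _) = fun w => cim (F w) + cim (G w)); last by apply/funext => w; rewrite cimD.
by apply: rcontCD; exact: rcontC_im.
Qed.

Lemma bounded_contD F G : bounded_cont F -> bounded_cont G -> bounded_cont (fun z => F z + G z).
Proof.
move=> [Fc [A FA]] [Gc [B GB]]; split; first by move=> z; exact: ccontD.
by exists (A + B) => z z1; apply: le_trans (modulusD _ _) _; apply: lerD; [exact: FA|exact: GB].
Qed.

Lemma bounded_contZ (a : C) F : bounded_cont F -> bounded_cont (fun z => a * F z).
Proof.
move=> [Fc [B FB]]; split; first by move=> z; apply: ccontM; [exact: ccont_cst|exact: Fc].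
exists (modulus a * B) => z z1; rewrite modulusM; apply: ler_wpM2l; first exact: modulus_ge0.
exact: FB.
Qed.

Lemma bounded_cont_cst (a : C) : bounded_cont (fun=> a).
Proof. by split; [move=> z; exact: ccont_cst|exists (modulus a)]. Qed.

Lemma bounded_cont_monomial a b : bounded_cont (fun z => z ^+ a * z^* ^+ b).
Proof.
split=> [z|]; first by apply: ccontM; apply: ccontX; [exact: ccont_id|apply: (@ccont_conj R id);
  exact: ccont_id].
exists 1 => z z1; rewrite modulusM !modulusX modulusC mulr_ile1 ?exprn_ge0 ?modulus_ge0//.
  by rewrite exprn_ile1 ?modulus_ge0// ltW.
by rewrite exprn_ile1 ?modulus_ge0// ltW.
Qed.

Lemma disc_intD F G : bounded_cont F -> bounded_cont G -> disc_int (fun z => F z + G z) = disc_int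
  F + disc_int G.
Proof.
move=> nF nG; have mb := @measurable_plane_ball R 1; apply: C_ext.
  rewrite creD /disc_int /cintegral /= -RintegralD//; [|exact: bounded_cont_re|exact: bounded_cont_re].
  by apply: eq_Rintegral => p _; rewrite creD.
rewrite cimD /disc_int /cintegral /= -RintegralD//; [|exact: bounded_cont_im|exact: bounded_cont_im].
by apply: eq_Rintegral => p _; rewrite cimD.
Qed.

Lemma disc_intZ (a : C) F : bounded_cont F -> disc_int (fun z => a * F z) = a * disc_int F.
Proof.
move=> nF; have mb := @measurable_plane_ball R 1.
have [I1 I2] := (bounded_cont_re nF, bounded_cont_im nF).
have Z (k : R) (u : RR -> R) : area.-integrable (plane_ball 1) (EFin \o u) ->
   area.-integrable (plane_ball 1) (fun p => (k * u p)%:E).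
  by move=> iu; rewrite (_ : (fun p => _) = (fun p => k%:E * (u p)%:E)%E) //; exact: integrableZl.
apply: C_ext.
  rewrite creM /disc_int /cintegral /= -RintegralZl// -RintegralZl// -RintegralB//; [|exact: Z..].
  by apply: eq_Rintegral => p _; rewrite creM.
rewrite cimM /disc_int /cintegral /= -RintegralZl// -RintegralZl// -RintegralD//; [|exact: Z..].
by apply: eq_Rintegral => p _; rewrite cimM.
Qed.

Lemma disc_int_sum (I : Type) (r : seq I) (F : I -> C -> C) : (forall i, bounded_cont (F i)) ->
  disc_int (fun z => \sum_(i <- r) F i z) = \sum_(i <- r) disc_int (F i) /\
  bounded_cont (fun z => \sum_(i <- r) F i z).
Proof.
move=> nF; elim: r => [|i r [IH1 IH2]].
  rewrite big_nil (_ : (fun z => _) = fun=> 0); last by apply/funext => z; rewrite big_nil.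
  by split; [rewrite /disc_int cintegral0|exact: bounded_cont_cst].
rewrite big_cons (_ : (fun z => _) = fun z => F i z + \sum_(j <- r) F j z); last first.
  by apply/funext => z; rewrite big_cons.
by rewrite disc_intD// IH1; split => //; exact: bounded_contD.
Qed.

(** Parseval's identity: by [disc_monomial] the monomials are orthogonal. *)
Lemma pot_area s : (\int[area]_(p in plane_ball 1) (modulus (pot' s (plane p)) ^+ 2)%:E =
  (discarea * truncated_energy s)%:E)%E.
Proof.
pose N := size s; pose a n : C := phat s n.+1.
have pE z : pot' s z = \sum_(n < N) a n * z ^+ n.
  by rewrite /pot' big_add1 big_mkord.
have E : disc_int (fun z => pot' s z * (pot' s z)^*) = RtoC (discarea * truncated_energy s).
  have e : (fun z => pot' s z * (pot' s z)^*) =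
      fun z => \sum_(m < N) a m * \sum_(n < N) (a n)^* * (z ^+ m * z^* ^+ n).
    apply/funext => z; rewrite pE (big_morph _ (@conjCD R) (@conjC0 _)) mulr_suml.
    apply: eq_bigr => m _; rewrite -mulrA mulr_sumr; congr (_ * _); apply: eq_bigr => n _.
    by rewrite conjCM conjCX; ring.
  have nmn (m n : 'I_N) : bounded_cont (fun z => (a n)^* * (z ^+ m * z^* ^+ n)).
    by apply: bounded_contZ; exact: bounded_cont_monomial.
  have nm (m : 'I_N) := (disc_int_sum (index_enum _) (nmn m)).2.
  rewrite e (disc_int_sum _ (fun m : 'I_N => bounded_contZ (a m) (nm m))).1.
  have E1 (m : 'I_N) : disc_int (fun z => a m * (\sum_(n < N) (a n)^* * (z ^+ m * z^* ^+ n))) =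
      RtoC (discarea * (modulus (a m) ^+ 2 / m.+1%:R)).
    rewrite disc_intZ// (disc_int_sum _ (nmn m)).1 (bigD1 m)//= big1 ?addr0; last first.
      move=> n nm'; rewrite disc_intZ; last exact: bounded_cont_monomial.
      by rewrite /disc_int disc_monomial eq_sym (inj_eq val_inj) (negbTE nm') RtoC0 mulr0.
    rewrite disc_intZ; last exact: bounded_cont_monomial.
    rewrite /disc_int disc_monomial eqxx mulrA mulC_conj -RtoCM; congr RtoC; ring.
  under eq_bigr do rewrite E1.
  rewrite -(big_morph _ RtoCD RtoC0) -mulr_sumr; congr RtoC; congr (_ * _).
  by rewrite /truncated_energy big_add1 big_mkord.
have nf : bounded_cont (fun z => pot' s z * (pot' s z)^*).
  have np : bounded_cont (pot' s).
    rewrite (_ : pot' s = fun z => \sum_(n < N) a n * z ^+ n); last by apply/funext => z.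
    apply: (disc_int_sum _ _).2 => n; apply: bounded_contZ.
    have := bounded_cont_monomial n 0; rewrite (_ : (fun z => _) = fun z => z ^+ n)//.
    by apply/funext => z; rewrite expr0 mulr1.
  case: np => pc [B pB]; split; first by move=> z; apply: ccontM => //; exact: ccont_conj.
  exists (B * B) => z z1; rewrite modulusM modulusC; have := pB _ z1; have := modulus_ge0 (pot' s z).
  by nra.
have := congr1 cre E; rewrite creR /disc_int /cintegral /= => <-.
have fn := integrable_fin_num (measurable_plane_ball 1) (bounded_cont_re nf).
rewrite /Rintegral fineK//.
by apply: eq_integral => p _; rewrite mulC_conj creR.
Qed.

Lemma pot_cre s z : cre (pot s z) =
  \sum_(1 <= n < (size s).+1) n%:R^-1 * cre (phat s n * z ^+ n).
Proof. by rewrite /pot cre_sum; apply: eq_bigr => n _; rewrite creZ. Qed.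

Lemma pot'_ccont s z : ccont (pot' s) z.
Proof.
have nm n : bounded_cont (fun z => phat s n * z ^+ n.-1).
  apply: bounded_contZ; have := bounded_cont_monomial n.-1 0; rewrite (_ : (fun z => _) = fun z =>
    z ^+ n.-1)//.
  by apply/funext => u; rewrite expr0 mulr1.
exact: ((disc_int_sum (index_iota 1 (size s).+1) nm).2.1 z).
Qed.

Lemma truncated_energy_ge0 s : 0 <= truncated_energy s.
Proof. by apply: sumr_ge0 => n _; rewrite divr_ge0 ?sqr_ge0. Qed.

End AreaEnergy.

Section Fekete.
Context {R : realType}.
Local Notation C := (Cplx R).
Local Notation tau := (@tau R).
Implicit Types (z w : C).

Lemma sin_lip (a b : R) : `|sin a - sin b| <= `|a - b|.
Proof.
wlog ab : a b / a <= b => [H|].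
  have [/H//|/ltW/H] := leP a b.
  by rewrite distrC (distrC b a).
rewrite distrC (distrC a).
have sc : {within `[a, b], continuous (@sin R)}.
  by apply: continuous_subspaceT => x; exact: continuous_sin.
have [c cab ->] := MVT_segment ab (fun x _ => is_derive_sin x) sc.
by rewrite normrM ler_piMl// ler_norml cos_geN1 cos_le1.
Qed.

Lemma cos_lip (a b : R) : `|cos a - cos b| <= `|a - b|.
Proof.
have h x : cos x = sin (x + pi / 2) by rewrite sinDpihalf.
by rewrite !h; have := sin_lip (a + pi / 2) (b + pi / 2); rewrite opprD addrACA subrr addr0.
Qed.

Lemma cis_lip (a b : R) : modulus (cis a - cis b) <= 2 * `|a - b|.
Proof.
apply: le_trans (modulus_le _) _; rewrite creB cimB /=.
by have := sin_lip a b; have := cos_lip a b; lra.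
Qed.

Fact root_key : {f : nat -> nat -> C | forall N x, f N x = cis (tau * (x%:R / N%:R))}.
Proof. by exists (fun N x => cis (tau * (x%:R / N%:R))). Qed.

(** The [x]-th of the [N]-th roots of unity, sealed so that unification never
    unfolds trigonometric functions. *)
Definition root (N x : nat) : C := sval root_key N x.

Lemma rootE N x : root N x = cis (tau * (x%:R / N%:R)).
Proof. exact: (svalP root_key). Qed.

Lemma modulus_root N x : modulus (root N x) = 1.
Proof. by rewrite rootE modulus_cis. Qed.

Definition roots N (u : seq nat) := [seq root N x | x <- u].

Lemma roots_circle N u : on_circle (roots N u).
Proof. by move=> z /mapP[x _ ->]; exact: modulus_root. Qed.

Variable E : set C.
Hypotheses (E_circle : E `<=` circle) (E0 : E !=set0).

(** Grid points near [E]; the radius is chosen such that every point of [E] has one. *)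
Definition admissible (N x : nat) :=
  exists2 e, E e & modulus (root N x - e) <= 2 * tau / N%:R.

Lemma admissible_near N e : (0 < N)%N -> E e -> exists2 x, (x < N)%N &
  modulus (root N x - e) <= 2 * tau / N%:R.
Proof.
move=> N0 Ee; have [t [t0 tt ->]] := cis_surj (E_circle Ee).
have T0 := @tau_gt0 R; have n0 : 0 < N%:R :> R by rewrite ltr0n.
pose y := N%:R * (t / tau); have y0 : 0 <= y by rewrite mulr_ge0// divr_ge0// ltW.
have /andP[x1 x2] := truncn_itv y0.
exists (Num.truncn y).
  rewrite -(ltr_nat R); apply: le_lt_trans x1 _.
  by rewrite /y gtr_pMr// ltr_pdivrMr// mul1r.
rewrite rootE; apply: le_trans (cis_lip _ _) _; rewrite -mulrA; apply: ler_wpM2l => //.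
have -> : tau * ((Num.truncn y)%:R / N%:R) - t = (tau / N%:R) * ((Num.truncn y)%:R - y).
  by rewrite /y; field; rewrite !gt_eqF.
rewrite normrM gtr0_norm ?divr_gt0// ler_piMr ?divr_ge0//; first exact: ltW.
by rewrite -natr1 in x2; rewrite ler_norml; apply/andP; split; lra.
Qed.

Section config.
Variable N : nat.
Hypothesis N0 : (0 < N)%N.
Local Notation n0 := (N%:R^-1 : R).

Let ninv_gt0 : 0 < n0. Proof. by rewrite invr_gt0 ltr0n. Qed.

Definition config (t : N.-tuple 'I_N) : seq C := roots N [seq val x | x <- t].

Lemma size_config t : size (config t) = N.
Proof. by rewrite /config /roots !size_map size_tuple. Qed.

Lemma config_neq0 t : config t != [::].
Proof. by rewrite -size_eq0 size_config -lt0n. Qed.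

Lemma config_sum t (V : zmodType) (F : C -> V) :
  \sum_(z <- config t) F z = \sum_(i < N) F (root N (tnth t i)).
Proof. by rewrite /config /roots !big_map big_tuple. Qed.

(** Frequency by frequency, [|phat n|^2] is the mean over the configuration of
    [Re (phat n * z^n)]. *)
Lemma energy_average (s : seq C) : s != [::] -> on_circle s ->
  truncated_energy s = (size s)%:R^-1 * \sum_(z <- s) cre (pot s z).
Proof.
move=> s0 sc; rewrite -cre_sum -creZ -[LHS]creR; congr cre.
rewrite /truncated_energy (big_morph _ RtoCD RtoC0) /pot exchange_big /= mulr_sumr; apply: eq_bigr => n _.
rewrite -mulr_sumr -mulr_sumr mulrCA RtoCM mulrC; congr (_ * _).
rewrite -mulC_conj mulrCA; congr (_ * _); rewrite /phat conjCM (big_morph _ (@conjCD R) (@conjC0 _)).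
have -> (a : R) : (RtoC a)^* = RtoC a by apply: C_ext; rewrite !cE ?oppr0.
by congr (_ * _); apply: eq_bigr => z _; rewrite conjCX conjCK.
Qed.

Definition replace (t : N.-tuple 'I_N) (a x : 'I_N) : N.-tuple 'I_N :=
  [tuple if i == a then x else tnth t i | i < N].

Lemma replace_sum t a x (F : C -> C) : \sum_(z <- config (replace t a x)) F z =
  \sum_(z <- config t) F z + (F (root N x) - F (root N (tnth t a))).
Proof.
rewrite !config_sum (bigD1 a)//= [in RHS](bigD1 a)//= tnth_mktuple eqxx.
under eq_bigr => i ia do rewrite tnth_mktuple (negbTE ia).
by rewrite addrAC [F (root N (tnth t a)) + _]addrC subrK.
Qed.

Lemma replace_phat t a x n : phat (config (replace t a x)) n =
  phat (config t) n + RtoC n0 * ((root N x)^* ^+ n - (root N (tnth t a))^* ^+ n).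
Proof. by rewrite /phat !size_config (replace_sum _ _ _ (fun z => z^* ^+ n)) mulrDr. Qed.

(** The energy is a quadratic form in the measure, and one point has mass [1 / N]: the
    potential gives the linear term, and each of the [N] frequencies contributes at
    most [4 / N^2] to the quadratic one. *)
Lemma replace_energy t a x : truncated_energy (config (replace t a x)) <= truncated_energy (config t) +
  2 * n0 * (cre (pot (config t) (root N x)) - cre (pot (config t) (root N (tnth t a)))) + 4 * n0.
Proof.
set s := config t; set zx := root N x; set za := root N _.
have -> : cre (pot s zx) - cre (pot s za) =
    \sum_(1 <= n < N.+1) n%:R^-1 * cre (phat s n * (zx ^+ n - za ^+ n)).
  rewrite !(pot_cre s) size_config -sumrB; apply: eq_bigr => n _.
  by rewrite -mulrBr -creB -mulrBr.
have -> : 4 * n0 = \sum_(1 <= n < N.+1) 4 * n0 ^+ 2.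
  by rewrite sumr_const_nat subn1 /= -mulr_natr; field; rewrite pnatr_eq0 -lt0n.
rewrite /truncated_energy !size_config mulr_sumr -!big_split/= big_nat [X in _ <= X]big_nat.
apply: ler_sum => -[//|n] _; rewrite replace_phat -/s -/zx -/za.
set p := phat s n.+1.
have -> : zx^* ^+ n.+1 - za^* ^+ n.+1 = (zx ^+ n.+1 - za ^+ n.+1)^*.
  by rewrite rmorphB/= !conjCX.
set d := zx ^+ n.+1 - _.
have -> : modulus (p + RtoC n0 * d^*) ^+ 2 =
    modulus p ^+ 2 + 2 * n0 * cre (p * d) + n0 ^+ 2 * modulus d ^+ 2.
  rewrite !modulus_sqr !cE; move: (cre p) (cim p) (cre d) (cim d) n0 => a1 a2 a3 a4 a5; ring.
have d4 : modulus d ^+ 2 <= 4.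
  have := modulusB (zx ^+ n.+1) (za ^+ n.+1); rewrite -/d !modulusX !modulus_root expr1n.
  by have := modulus_ge0 d; nra.
have i0 := @invn_gt0 R n; have i1 : (n.+1%:R : R)^-1 <= 1.
  by rewrite invf_le1 ?ltr0n// ler1n.
have h : n0 ^+ 2 * modulus d ^+ 2 * n.+1%:R^-1 <= 4 * n0 ^+ 2.
  have : 0 <= n0 ^+ 2 * modulus d ^+ 2 by rewrite mulr_ge0 ?sqr_ge0.
  have : n0 ^+ 2 * modulus d ^+ 2 <= 4 * n0 ^+ 2 by rewrite mulrC; apply: ler_wpM2r => //; exact: sqr_ge0.
  move=> b1 b0; apply: le_trans b1.
  by apply: ler_piMr.
have -> : (modulus p ^+ 2 + 2 * n0 * cre (p * d) + n0 ^+ 2 * modulus d ^+ 2) / n.+1%:R =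
  modulus p ^+ 2 / n.+1%:R + 2 * n0 * (n.+1%:R^-1 * cre (p * d)) + n0 ^+ 2 * modulus d ^+ 2 * n.+1%:R^-1.
  by ring.
by rewrite lerD2l.
Qed.

(** Fekete's argument: moving one point of a minimal configuration to another
    admissible place cannot lower the energy, so the potential there is almost as
    large as at the points of the configuration, hence as its mean, the energy. *)
Lemma fekete : exists u : seq nat, [/\ size u = N,
  {in u, forall x, (x < N)%N /\ admissible N x} &
  forall x, (x < N)%N -> admissible N x ->
    truncated_energy (roots N u) - 2 <= cre (pot (roots N u) (root N x))].
Proof.
have [e0 Ee0] := E0; have [x0 x0N x0a] := admissible_near N0 Ee0.
pose ok (t : N.-tuple 'I_N) := [forall i, `[< admissible N (tnth t i) >]].
pose t0 : N.-tuple 'I_N := [tuple Ordinal x0N | i < N].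
have ok0 : ok t0.
  by apply/forallP => i; apply/asboolP; rewrite tnth_mktuple; exists e0.
case: (@Order.TotalTheory.arg_minP _ _ _ t0 ok (fun t => truncated_energy (config t)) ok0) => t okt tmin.
exists [seq val x | x <- t]; rewrite -/(config t); split.
- by rewrite size_map size_tuple.
- move=> _ /mapP[x /tnthP[i ->] ->]; split; first exact: ltn_ord.
  exact/asboolP/(forallP okt).
move=> x xN ax; set s := config t.
have H a : cre (pot s (root N (tnth t a))) <= cre (pot s (root N x)) + 2.
  have okr : ok (replace t a (Ordinal xN)).
    apply/forallP => i; rewrite tnth_mktuple; case: eqP => _; first exact/asboolP.
    exact: (forallP okt).
  have := le_trans (tmin _ okr) (replace_energy t a (Ordinal xN)); rewrite -/s /=.
  move: (cre (pot s (root N x))) (cre (pot s (root N (tnth t a)))) => A B h.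
  have : 0 <= n0 * (2 * (A - B) + 4) by lra.
  by rewrite pmulr_rge0//; lra.
rewrite (energy_average (config_neq0 t) (@roots_circle _ _)) -/s.
rewrite lerBlDr; apply: big_avg; first exact: config_neq0.
move=> z /mapP[_ /mapP[y /tnthP[i ->] ->] ->]; exact: H.
Qed.

End config.
End Fekete.

(** * Laws of angles *)

Section AngleLaw.
Context {R : realType}.
Local Notation C := (Cplx R).
Local Notation mu := (@lebesgue_measure R).
Local Notation tau := (@tau R).
Local Notation borel := (@borelC R).
Implicit Types (z w : C).

Lemma openC_open (U : set C) : openC U -> open U.
Proof. by move=> oU; rewrite openE => z Uz; apply/nbhsCP; exact: oU. Qed.

Lemma open_openC (U : set C) : open U -> openC U.
Proof. by rewrite openE => oU z /oU /nbhsCP. Qed.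

Lemma openC_borel (U : set C) : openC U -> measurable (U : set borel).
Proof. by move=> /openC_open oU; exact: sub_sigma_algebra. Qed.

Lemma rcontC_borel (h : C -> R) : (forall z, rcontC h z) ->
  measurable_fun [set: borel] (h : borel -> measurableTypeR R).
Proof.
move=> hc; apply: (measurability _ (RGenOInfty.measurableE R)) => _ [_ [x ->] <-].
rewrite setTI; apply: (@openC_borel (h @^-1` `]x, +oo[%classic)).
move=> z; rewrite /= in_itv/= andbT => xz.
have xz0 : 0 < h z - x by lra.
have [e e0 H] := hc z _ xz0; exists e => // w /H.
by rewrite ltr_norml in_itv/= andbT => /andP[? ?]; lra.
Qed.

Lemma circle_borel : measurable (circle : set borel).
Proof.
have := @rcontC_borel (fun z => modulus z) (fun z => rcontC_modulus (ccont_id z)).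
move=> /(_ measurableT _ (measurable_set1 (1 : R))); rewrite setTI.
by rewrite (_ : _ @^-1` _ = circle).
Qed.

Definition circ (g : measurableTypeR R -> measurableTypeR R)
  (mg : measurable_fun setT g) (t : measurableTypeR R) : borel := cis (g t).

Lemma circ_measurable g mg : measurable_fun [set: measurableTypeR R] (@circ g mg).
Proof.
have := @measurability _ _ (measurableTypeR R) borel setT (@circ g mg) (@open C) erefl.
apply => _ [U oU <-]; rewrite setTI.
rewrite (_ : _ @^-1` U = g @^-1` [set s | U (cis s)]) //.
rewrite -[_ @^-1` _]setTI; apply: mg => //; apply: open_measurable.
rewrite openE => s Us; have [e e0 eU] := open_openC oU Us.
have [d d0 D] := @rccont_cis R s e e0.
apply/nbhs_ballP; exists d => //= y; rewrite /ball/= distrC => /D h.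
by apply: eU.
Qed.

HB.instance Definition _ g mg := isMeasurableFun.Build _ _ _ _ (@circ g mg) (@circ_measurable g mg).

Local Notation U01 := (uniform_prob (@ltr01 R)).

(** The distribution on the circle of the angle [g], for a uniform variable. *)
Definition angle_law g mg : probability borel R := distribution U01 (@circ g mg).

Lemma angle_law_full g mg (A : set C) : (forall t : R, 0 <= t <= 1 -> A (cis (g t))) ->
  @angle_law g mg A = 1%E.
Proof.
move=> H; rewrite -[LHS]/(\int[mu]_(x in @circ g mg @^-1` A) (uniform_pdf 0 1 x)%:E)%E.
by rewrite integral_uniform_pdf1// => t /=; rewrite in_itv/= => /H.
Qed.

Lemma uniform_integral (u : R -> R) : measurable_fun [set: measurableTypeR R] u ->
  \int[U01]_x u x = RI 0 1 u.
Proof.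
move=> mu_; rewrite /RI /Rintegral integralE [in RHS]integralE.
have mE : measurable_fun [set: measurableTypeR R] (EFin \o u) by exact/measurable_EFinP.
rewrite !integral_uniform ?subr0 ?invr1 ?mul1e//.
- exact: measurable_funeneg.
- exact: measurable_funepos.
Qed.

Definition bounded_measurable (u : R -> R) := measurable_fun [set: measurableTypeR R] u /\
  exists B : R, forall t, `|u t| <= B.

Lemma bounded_measurable_integrable a b u : bounded_measurable u -> mu.-integrable `[a, b] (EFin \o u).
Proof.
move=> [mu_ [B uB]].
apply: (@le_integrable _ _ _ mu `[a, b]%classic _ _ (cst B%:E)) => //.
- by apply/measurable_EFinP; apply: measurable_funTS.
- move=> x _; rewrite /= lee_fin; apply: le_trans (uB x) _; exact: ler_norm.
- apply: (@cont_on_integrable R a b (fun=> B)); apply: continuous_cont_on => x.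
  exact: cst_continuous.
Qed.

Lemma bounded_measurable_split a m b u : bounded_measurable u -> a <= m <= b -> RI a b u = RI a m u
  + RI m b u.
Proof.
move=> H /andP[am mb]; rewrite /RI -(@Rintegral_itv_obnd_cbnd _ m).
  rewrite -(@Rintegral_itvB _ _ (BLeft a) (BRight b)) ?bnd_simp//.
    by rewrite addrC subrK.
  exact: bounded_measurable_integrable.
have := bounded_measurable_integrable m b H; move=> /integrableS; apply => //.
exact: subset_itv_oc_cc.
Qed.

Lemma bounded_measurable_sum (K : nat) (x : nat -> R) u : bounded_measurable u -> (forall j, x j <= x j.+1) ->
  RI (x 0%N) (x K) u = \sum_(j < K) RI (x j) (x j.+1) u.
Proof.
move=> H xm; elim: K => [|K IH].
  rewrite big_ord0 /RI /Rintegral set_itv1 integral_set1//.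
rewrite big_ord_recr/= -IH; apply: bounded_measurable_split => //; rewrite xm andbT.
by elim: K {IH} => // K IH; apply: le_trans IH (xm _).
Qed.

Lemma bounded_measurable_near a b u (k M : R) : bounded_measurable u -> a <= b -> (forall t, a <= t
  <= b -> `|u t - k| <= M) ->
  `|RI a b u - k * (b - a)| <= M * (b - a).
Proof.
move=> H ab uM; have iu := bounded_measurable_integrable a b H.
have ic (c : R) : mu.-integrable `[a, b] (EFin \o (fun=> c)).
  apply: (@cont_on_integrable R a b (fun=> c)); apply: continuous_cont_on => x.
  exact: cst_continuous.
have le1 : RI a b u <= RI a b (fun=> k + M).
  apply: le_Rintegral => // t; rewrite /= in_itv/= => /uM; rewrite ler_norml => /andP[? ?]; lra.
have le2 : RI a b (fun=> k - M) <= RI a b u.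
  apply: le_Rintegral => // t; rewrite /= in_itv/= => /uM; rewrite ler_norml => /andP[? ?]; lra.
by rewrite !RI_cst// in le1 le2; rewrite ler_norml; apply/andP; split; lra.
Qed.

Definition lipschitz (L : R) (g : R -> R) := forall a b, `|g a - g b| <= L * `|a - b|.

Lemma lipschitz_cont L g : 0 <= L -> lipschitz L g -> continuous g.
Proof.
move=> L0 H x; apply/cont_epsP => e e0; exists (e / (L + 1)); first by rewrite divr_gt0//; lra.
move=> y; rewrite ltr_pdivlMr; last lra.
by have := H y x; have := normr_ge0 (y - x); nra.
Qed.

Lemma bounded_measurable_mono g (v : R -> R) : continuous g -> (exists B : R, forall t, `|g t| <= B) ->
  {homo v : a b / a <= b} -> bounded_measurable (fun t => g (v t)).
Proof.
move=> gc [B gB] vm; split; last by exists B => t.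
apply: (@measurableT_comp _ _ _ _ _ _ g); first exact: continuous_measurable_fun.
exact: nondecreasing_measurable.
Qed.

(** Riemann sums of a Lipschitz function of a nondecreasing one converge at a rate
    that depends on the total increase only. *)
Lemma riemann_mono (L : R) g (v : R -> R) K : 0 <= L -> lipschitz L g ->
  (exists B : R, forall t, `|g t| <= B) -> {homo v : a b / a <= b} ->
  (forall t, 0 <= v t <= 1) -> (0 < K)%N ->
  `|RI 0 1 (fun t => g (v t)) - K%:R^-1 * \sum_(j < K) g (v (j%:R / K%:R))| <= L / K%:R.
Proof.
move=> L0 gL gB vm v01 K0; have k0 : 0 < K%:R :> R by rewrite ltr0n.
have b := bounded_measurable_mono (lipschitz_cont L0 gL) gB vm.
pose x j : R := j%:R / K%:R.
have xS j : x j.+1 - x j = K%:R^-1 by rewrite /x -mulrBl -natr1 addrAC subrr add0r mul1r.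
have xm j : x j <= x j.+1 by rewrite -subr_ge0 xS invr_ge0 ltW.
have -> : RI 0 1 (fun t => g (v t)) = \sum_(j < K) RI (x j) (x j.+1) (fun t => g (v t)).
  by rewrite -bounded_measurable_sum// /x mul0r divff// gt_eqF.
rewrite mulr_sumr -sumrB; apply: le_trans (ler_norm_sum _ _ _) _.
apply: (@le_trans _ _ (\sum_(j < K) L * (v (x j.+1) - v (x j)) * K%:R^-1)).
  apply: ler_sum => j _; rewrite -[j%:R / K%:R]/(x j) -(xS j) (mulrC (x _ - x _)); apply:
    bounded_measurable_near => // t /andP[t1 t2].
  apply: le_trans (gL _ _) _; apply: ler_wpM2l => //.
  by have := vm _ _ t1; have := vm _ _ t2; rewrite ler_norml => *; apply/andP; split; lra.
rewrite -mulr_suml -mulr_sumr; apply: ler_wpM2r; first by rewrite invr_ge0 ltW.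
rewrite ler_piMr//.
have -> : \sum_(j < K) (v (x j.+1) - v (x j)) = v (x K) - v (x 0%N).
  by rewrite -(big_mkord xpredT (fun j => v (x j.+1) - v (x j))) telescope_sumr.
by have := v01 (x K); have := v01 (x 0%N); lra.
Qed.

Lemma angle_law_fourier g mg n : fourier (@angle_law g mg) n =
  Complex (RI 0 1 (fun t => cos (n%:R * g t))) (- RI 0 1 (fun t => sin (n%:R * g t))).
Proof.
have cisn t : ((circ mg t : C)^*) ^+ n = cis (- (n%:R * g t)).
  by rewrite /circ -cisN cisX mulrN.
have key (F : C -> R) (u : R -> R) : (forall z, rcontC F z) ->
    (forall t, F (circ mg t) = u t) -> measurable_fun [set: measurableTypeR R] u ->
    (exists B : R, forall t, `|u t| <= B) ->
    \int[angle_law mg]_(z in circle) F z = RI 0 1 u.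
  move=> Fc Fu mu_ [B uB]; rewrite -uniform_integral// /Rintegral.
  have pre : @circ g mg @^-1` circle = setT.
    by apply/seteqP; split => // t _; rewrite /preimage /circle /mkset modulus_cis.
  have := @integral_pushforward _ _ _ _ _ _ (@circ_measurable g mg) U01 circle (EFin \o F) _ _ circle_borel.
  rewrite pre => ->.
  - by congr fine; apply: eq_integral => t _ /=; rewrite Fu.
  - by apply/measurable_EFinP; exact: rcontC_borel.
  - rewrite (_ : _ \o _ = EFin \o u); last by apply/funext => t /=; rewrite Fu.
    apply: (@le_integrable _ _ _ U01 setT _ _ (cst B%:E)) => //.
    + by apply/measurable_EFinP.
    + by move=> t _; rewrite /= lee_fin; apply: le_trans (uB t) _; exact: ler_norm.
    + apply/integrableP; split => //; rewrite /= integral_cst//.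
      by rewrite -[X in (_ * X)%E]/(U01 setT) probability_setT mule1 ltry.
have mn : measurable_fun [set: measurableTypeR R] (fun t => n%:R * g t) by exact: measurable_funM.
rewrite /fourier /cintegral; congr Complex.
  apply: (key (fun z => cre (z^* ^+ n))) => [z|t||].
  - by apply: rcontC_re; apply: ccontX; apply: (@ccont_conj R id); exact: ccont_id.
  - by rewrite cisn /= cosN.
  - apply: (@measurableT_comp _ _ _ _ _ _ (@cos R)) => //.
    by apply: continuous_measurable_fun; exact: continuous_cos.
  - by exists 1 => t; rewrite ler_norml cos_geN1 cos_le1.
have E : RI 0 1 (fun t => - sin (n%:R * g t)) = - RI 0 1 (fun t => sin (n%:R * g t)).
  have bs : bounded_measurable (fun t => sin (n%:R * g t)).
    split; last by exists 1 => t; rewrite ler_norml sin_geN1 sin_le1.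
    apply: (@measurableT_comp _ _ _ _ _ _ (@sin R)) => //.
    by apply: continuous_measurable_fun; exact: continuous_sin.
  rewrite /RI -[RHS]mulN1r -RintegralZl//; last exact: bounded_measurable_integrable.
  by apply: eq_Rintegral => t _; rewrite mulN1r.
rewrite -E; apply: (key (fun z => cim (z^* ^+ n))) => [z|t||].
- by apply: rcontC_im; apply: ccontX; apply: (@ccont_conj R id); exact: ccont_id.
- by rewrite cisn /= sinN.
- apply: measurableT_comp => //; apply: (@measurableT_comp _ _ _ _ _ _ (@sin R)) => //.
  by apply: continuous_measurable_fun; exact: continuous_sin.
- by exists 1 => t; rewrite normrN ler_norml sin_geN1 sin_le1.
Qed.

End AngleLaw.

(** * Configurations near a set of capacity zero *)

Section Limit.
Context {R : realType}.
Local Notation C := (Cplx R).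
Local Notation tau := (@tau R).
Implicit Types (z w : C).

(** Along a free ultrafilter every bounded sequence converges, which spares the
    extraction of subsequences for uncountably many arguments of the quantile
    functions at once. *)
Lemma ultra_nat : exists F : set_system nat, UltraFilter F /\ forall N, F [set n | (N <= n)%N].
Proof.
have [F [UF HF]] := ultraFilterLemma eventually_filter.
by exists F; split => // N; apply: HF; exists N.
Qed.

Lemma ultra_lim (F : set_system nat) (u : nat -> R) : UltraFilter F ->
  (forall n, 0 <= u n <= 1) -> exists2 l : R, 0 <= l <= 1 & u n @[n --> F] --> l.
Proof.
move=> UF u01; have PF : ProperFilter F by exact: ultra_proper.
have := @segment_compact R 0 1; rewrite compact_cluster_set1 || idtac.
move=> /(_ (u @ F) _) H.
have [|l [l01 lcl]] := H _.
  change (F (u @^-1` [set` `[0, 1]])).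
  by apply: filterS filterT => n _; have := u01 n; rewrite /= in_itv.
exists l; first by move: l01; rewrite /= in_itv.
apply/cvgrPdist_lt => e e0.
pose A := [set n | `|l - u n| < e].
have [//|FA] := @in_ultra_setVsetC _ F A UF.
have [] := lcl [set u n | n in ~` A] (ball l e).
- change (F (u @^-1` [set u n | n in ~` A])).
  by apply: filterS FA => n An; exists n.
- exact: nbhsx_ballx.
by move=> _ [[n An <-]]; rewrite /ball/= => /An.
Qed.

Section sampling.
Variables (g : R -> R) (L : R).
Hypotheses (L0 : 0 <= L) (gL : lipschitz L g) (gB : exists B : R, forall t, `|g t| <= B).
Variables (F : set_system nat) (c : nat -> nat -> nat) (q : R -> R).
Hypothesis PF : ProperFilter F.
Hypothesis Finf : forall N, F [set n | (N <= n)%N].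
Hypothesis cm : forall l i j, (i <= j)%N -> (c l i <= c l j)%N.
Hypothesis cb : forall l i, (c l i < 2 ^ l)%N.

(** The quantile function of the uniform measure on the sorted configuration [c l]. *)
Definition quantile l (t : R) : R := (c l (Num.truncn ((2 ^ l)%:R * t)))%:R / (2 ^ l)%:R.

Lemma pow2_gt0 l : 0 < (2 ^ l)%:R :> R.
Proof. by rewrite ltr0n expn_gt0. Qed.

Lemma quantile01 l t : 0 <= quantile l t <= 1.
Proof.
rewrite divr_ge0//= ler_pdivrMr ?pow2_gt0// mul1r ler_nat ltnW//.
Qed.

Lemma quantile_mono l : {homo quantile l : a b / a <= b}.
Proof.
move=> a b ab; apply: ler_wpM2r; first by rewrite invr_ge0 ltW// pow2_gt0.
by rewrite ler_nat; apply: cm; apply: le_truncn; apply: ler_wpM2l => //; exact: ltW (pow2_gt0 l).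
Qed.

Lemma quantile_grid l i : quantile l (i%:R / (2 ^ l)%:R) = (c l i)%:R / (2 ^ l)%:R.
Proof. by rewrite /quantile mulrCA divff ?mulr1 ?natrK// gt_eqF// pow2_gt0. Qed.

Hypothesis qlim : forall t, quantile l t @[l --> F] --> q t.

Lemma q_mono : {homo q : a b / a <= b}.
Proof.
move=> a b ab; rewrite leNgt; apply/negP => ba.
have e0 : 0 < (q a - q b) / 2 by lra.
have /cvgrPdist_lt /(_ _ e0) A := @qlim a; have /cvgrPdist_lt /(_ _ e0) B := @qlim b.
have [l [/= A1 B1]] := filter_ex (filterI A B).
have := quantile_mono l ab; move: A1 B1; rewrite !ltr_norml; lra.
Qed.

Lemma q01 t : 0 <= q t <= 1.
Proof.
apply/andP; split; rewrite leNgt; apply/negP => h.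
  have e0 : 0 < - q t by lra.
  have /cvgrPdist_lt /(_ _ e0) A := @qlim t; have [l /= A1] := filter_ex A.
  have := quantile01 l t; move: A1; rewrite !ltr_norml; lra.
have e0 : 0 < q t - 1 by lra.
have /cvgrPdist_lt /(_ _ e0) A := @qlim t; have [l /= A1] := filter_ex A.
have := quantile01 l t; move: A1; rewrite !ltr_norml; lra.
Qed.

(** The sample mean is the Riemann sum with mesh [2^-l] of the quantile function. The
    integral of the quantile function and that of the limit are both compared with
    Riemann sums of a fixed mesh [2^-k], where pointwise convergence suffices; by
    [riemann_mono] the errors are uniform in [l]. *)
Lemma sample_limit :
  ((2 ^ l)%:R^-1 * \sum_(i < 2 ^ l) g ((c l i)%:R / (2 ^ l)%:R)) @[l --> F] -->
  RI 0 1 (fun t => g (q t)).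
Proof.
apply/cvgrPdist_lt => e e0.
have [k k1] : exists k, L / (2 ^ k)%:R < e / 8.
  have [k hk] : exists k, 8 * L / e < (2 ^ k)%:R.
    exists (Num.truncn (8 * L / e)).+1; apply: lt_le_trans (truncnS_gt _) _.
    by rewrite ler_nat; exact/ltnW/ltn_expl.
  exists k; rewrite ltr_pdivrMr ?pow2_gt0//; move: hk; rewrite ltr_pdivrMr//; lra.
pose S l : R := (2 ^ k)%:R^-1 * \sum_(j < 2 ^ k) g (quantile l (j%:R / (2 ^ k)%:R)).
pose S' : R := (2 ^ k)%:R^-1 * \sum_(j < 2 ^ k) g (q (j%:R / (2 ^ k)%:R)).
have SS : S l @[l --> F] --> S'.
  apply: cvgM; first exact: cvg_cst.
  apply: cvg_big => [|j _]; first by move=> x y; apply: add_continuous.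
  by apply: continuous_cvg; [exact: lipschitz_cont gL _|exact: qlim].
have e8 : 0 < e / 8 by lra.
have /cvgrPdist_lt /(_ _ e8) A := SS.
have B := Finf k.
have H1 := riemann_mono L0 gL gB q_mono q01 (expn_gt0 2 k : (0 < 2 ^ k)%N).
apply: filterS (filterI A B) => l [/= Al kl].
have H2 := riemann_mono L0 gL gB (@quantile_mono l) (quantile01 l) (expn_gt0 2 k : (0 < 2 ^ k)%N).
have H3 := riemann_mono L0 gL gB (@quantile_mono l) (quantile01 l) (expn_gt0 2 l : (0 < 2 ^ l)%N).
have e3 : \sum_(j < 2 ^ l) g (quantile l (j%:R / (2 ^ l)%:R)) = \sum_(i < 2 ^ l) g ((c l i)%:R / (2 ^ l)%:R).
  by apply: eq_bigr => j _; rewrite quantile_grid.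
rewrite e3 in H3.
have kl' : L / (2 ^ l)%:R <= L / (2 ^ k)%:R.
  apply: ler_wpM2l => //; rewrite lef_pV2 ?posrE ?pow2_gt0// ler_nat.
  by rewrite leq_exp2l.
move: H1 H2 H3 Al; rewrite -/S' -/(S l) !ltr_norml !ler_norml.
set I := RI 0 1 _; set J := RI 0 1 _; move: (_^-1 * _) kl' k1 => V.
move: (L / (2 ^ k)%:R) (L / (2 ^ l)%:R) => X Y kl' k1.
move=> /andP[? ?] /andP[? ?] /andP[? ?] /andP[? ?]; apply/andP; split; lra.
Qed.

End sampling.
End Limit.

Section CapacityZero.
Context {R : realType}.
Local Notation C := (Cplx R).
Local Notation tau := (@tau R).
Implicit Types (z w : C).
Variable E : set C.
Hypotheses (E_closed : closed E) (E_circle : E `<=` circle) (E0 : E !=set0).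

Lemma conj_root N x n : (root N x : C)^* ^+ n = cis (- (n%:R * tau * (x%:R / N%:R))).
Proof. by rewrite rootE -cisN cisX; congr cis; ring. Qed.

Lemma phat_roots N (c : nat -> nat) n : let g := n%:R * tau in
  phat (roots N (mkseq c N)) n =
  Complex (N%:R^-1 * \sum_(i < N) cos (g * ((c i)%:R / N%:R)))
    (- (N%:R^-1 * \sum_(i < N) sin (g * ((c i)%:R / N%:R)))) :> C.
Proof.
move=> g; rewrite /phat size_map size_mkseq big_map /mkseq big_map.
rewrite (_ : iota 0 N = index_iota 0 N) ?big_mkord; last by rewrite /index_iota subn0.
apply: C_ext; rewrite ?creZ ?cimZ ?cre_sum ?cim_sum -?mulrN -?sumrN /=; congr (_ * _).
  by apply: eq_bigr => i _; rewrite conj_root /= cosN.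
by apply: eq_bigr => i _; rewrite conj_root /= sinN.
Qed.

Lemma energy_infinite (P : probability (@borelC R) R) : capacity E = 0%E -> P E = 1%E ->
  energy P = +oo%E.
Proof.
move=> /eqP; rewrite /capacity inve_eq0 => /eqP H PE; apply/eqP; rewrite eq_le leey/= -H.
by apply: ereal_inf_lbound; exists P.
Qed.

Lemma lip_cos (k : R) : 0 <= k -> lipschitz k (fun t => cos (k * t)).
Proof.
by move=> k0 a b; apply: le_trans (cos_lip _ _) _; rewrite -mulrBr normrM (ger0_norm k0).
Qed.
Lemma lip_sin (k : R) : 0 <= k -> lipschitz k (fun t => sin (k * t)).
Proof.
by move=> k0 a b; apply: le_trans (sin_lip _ _) _; rewrite -mulrBr normrM (ger0_norm k0).
Qed.

(** Weak compactness: bounded energies of sorted configurations near [E] pass to a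
    measure on [E], the limit being taken on quantile functions. *)
Lemma energy_tight (c : nat -> nat -> nat) (M : R) (l0 : nat) :
  (forall l i j, (i <= j)%N -> (c l i <= c l j)%N) ->
  (forall l i, (c l i < 2 ^ l)%N) ->
  (forall l i, admissible E (2 ^ l) (c l i)) ->
  (forall l, (l0 <= l)%N -> truncated_energy (roots (2 ^ l) (mkseq (c l) (2 ^ l))) <= M :> R) ->
  exists P : probability (@borelC R) R, P E = 1%E /\ (energy P <= M%:E)%E.
Proof.
move=> cm cb ca cM; have [F [UF Finf]] := ultra_nat.
have PF : ProperFilter F by exact: ultra_proper.
(* The limits of the quantile functions parametrise the measure. *)
have H t : exists l : R, quantile c n t @[n --> F] --> l.
  by have [l _ hl] := ultra_lim UF (fun n => quantile01 cb n t); exists l.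
pose q t := xget 0 [set l : R | quantile c n t @[n --> F] --> l].
have qlim t : quantile c l t @[l --> F] --> q t.
  have [l hl] := H t.
  exact: (@xgetPex _ 0 [set l : R | quantile c n t @[n --> F] --> l] (ex_intro _ l hl)).
have qm := q_mono PF cm qlim.
pose g t : R := tau * q t.
have T0 := @tau_gt0 R.
have mg : measurable_fun setT (g : measurableTypeR R -> measurableTypeR R).
  apply: nondecreasing_measurable => // a b ab; apply: ler_wpM2l; first exact: ltW.
  exact: qm.
exists (angle_law mg); split.
  (* The limit angles are limits of grid points whose distance to the closed set [E]
     tends to zero. *)
  apply: angle_law_full => t t01; apply: contrapT => nE.
  have oE : openC (~` E) by apply: open_openC; exact: closed_openC.
  have [e e0 He] := oE _ nE.
  have e1 : 0 < e / (4 * tau) by rewrite divr_gt0// mulr_gt0.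
  have /cvgrPdist_lt /(_ _ e1) A := @qlim t.
  have [l [/= A1 A2]] := filter_ex (filterI A (Finf (Num.truncn (4 * tau / e)).+1)).
  have [x Ex hx] := ca l (Num.truncn ((2 ^ l)%:R * t)).
  apply: (He x) => //.
  apply: le_lt_trans (modulus_triangle _ (root (2 ^ l) (c l (Num.truncn ((2 ^ l)%:R * t)))) _) _.
  rewrite modulus_distC in hx.
  have h1 : 2 * tau / (2 ^ l)%:R < e / 2.
    have : 4 * tau / e < (2 ^ l)%:R.
      apply: lt_le_trans (truncnS_gt _) _; rewrite ler_nat.
      by apply: leq_trans A2 _; exact/ltnW/ltn_expl.
    by rewrite ltr_pdivrMr// ltr_pdivrMr ?pow2_gt0//; lra.
  have h2 : modulus (root (2 ^ l) (c l (Num.truncn ((2 ^ l)%:R * t))) - cis (g t)) < e / 2.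
    rewrite rootE; apply: le_lt_trans (cis_lip _ _) _.
    rewrite -mulrBr normrM gtr0_norm// distrC -/(quantile c l t).
    have A3 : `|q t - quantile c l t| * (4 * tau) < e by rewrite -ltr_pdivlMr// mulr_gt0.
    have gen (a b : R) : a * (4 * b) < e -> 2 * (b * a) < e / 2 by move=> ?; lra.
    exact: gen.
  by apply: le_lt_trans (lerD hx (ltW h2)) _; lra.
have AL n l := phat_roots (2 ^ l) (c l) n.
have fE n : modulus (fourier (angle_law mg) n) ^+ 2 =
   (RI 0 1 (fun t => cos (n%:R * tau * q t))) ^+ 2 + (RI 0 1 (fun t => sin (n%:R * tau * q t))) ^+ 2.
  rewrite angle_law_fourier modulus_sqr /= sqrrN.
  by congr (_ ^+ 2 + _ ^+ 2); apply: RI_ext => t _; rewrite /g mulrA.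
have lim n : modulus (phat (roots (2 ^ l) (mkseq (c l) (2 ^ l))) n) ^+ 2 @[l --> F] -->
    modulus (fourier (angle_law mg) n) ^+ 2.
  rewrite fE; have k0 : 0 <= n%:R * tau by rewrite mulr_ge0// ltW.
  have bc : exists B : R, forall t, `|cos (n%:R * tau * t)| <= B.
    by exists 1 => t; rewrite ler_norml cos_geN1 cos_le1.
  have bs : exists B : R, forall t, `|sin (n%:R * tau * t)| <= B.
    by exists 1 => t; rewrite ler_norml sin_geN1 sin_le1.
  have L1 := sample_limit k0 (lip_cos k0) bc PF Finf cm cb qlim.
  have L2 := sample_limit k0 (lip_sin k0) bs PF Finf cm cb qlim.
  rewrite (_ : (fun l => _) = fun l =>
    ((2 ^ l)%:R^-1 * \sum_(i < 2 ^ l) cos (n%:R * tau * ((c l i)%:R / (2 ^ l)%:R))) ^+ 2 +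
    ((2 ^ l)%:R^-1 * \sum_(i < 2 ^ l) sin (n%:R * tau * ((c l i)%:R / (2 ^ l)%:R))) ^+ 2); last first.
    by apply/funext => l; rewrite AL modulus_sqr /= sqrrN.
  by apply: cvgD; rewrite !expr2; apply: cvgM.
apply: lime_le; first by apply: is_cvg_nneseries => n _ _; rewrite lee_fin divr_ge0 ?sqr_ge0.
apply: nearW => m; rewrite sumEFin lee_fin leNgt; apply/negP => hM.
(* A finite number of frequencies is seen by all fine enough configurations. *)
have limS : \sum_(1 <= n < m) modulus (phat (roots (2 ^ l) (mkseq (c l) (2 ^ l))) n) ^+ 2 / n%:R
    @[l --> F] --> \sum_(1 <= n < m) modulus (fourier (angle_law mg) n) ^+ 2 / n%:R.
  apply: cvg_big => [|n _]; first by move=> x y; apply: add_continuous.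
  by apply: cvgM; [exact: lim|exact: cvg_cst].
have FF : Filter F by apply _.
have A := @cvgr_gt _ _ F FF _ _ limS M hM.
have [l [/= A1 [A2 A3]]] := filter_ex (filterI A (filterI (Finf l0) (Finf m))).
have := cM l A2; rewrite leNgt => /negP; apply; apply: lt_le_trans A1 _.
rewrite /truncated_energy size_map size_mkseq.
have ml : (m <= (2 ^ l).+1)%N by apply: leq_trans A3 _; apply: ltnW; apply: ltnW; rewrite ltnS;
  exact: ltn_expl.
case: m {hM limS A A3} ml => [|m] ml.
  rewrite big_geq//; apply: sumr_ge0 => n _; rewrite divr_ge0 ?sqr_ge0//.
rewrite [X in _ <= X](big_cat_nat (n := m.+1))//= lerDl; apply: sumr_ge0 => n _.
by rewrite divr_ge0 ?sqr_ge0.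
Qed.

End CapacityZero.

(** * Spreading configurations over arcs *)

Section Arcs.
Context {R : realType}.
Local Notation C := (Cplx R).
Local Notation tau := (@tau R).
Local Notation mu := (@lebesgue_measure R).
Implicit Types (z w : C).

Lemma tau_bounds : 2 <= tau <= 8.
Proof.
have h1 := @pihalf_ge1 R; have h2 := @pihalf_lt2 R; have := @pi_ge2 R; rewrite /tau => h3.
by apply/andP; split; lra.
Qed.

Lemma phat_perm (s s' : seq C) n : perm_eq s s' -> phat s n = phat s' n.
Proof. by move=> p; rewrite /phat (perm_size p) (perm_big _ p). Qed.

Lemma truncated_energy_perm (s s' : seq C) : perm_eq s s' -> truncated_energy s = truncated_energy s'.
Proof. by move=> p; rewrite /truncated_energy (perm_size p); apply: eq_bigr => n _; rewrite
  (phat_perm n p). Qed.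

Lemma pot_perm (s s' : seq C) z : perm_eq s s' -> pot s z = pot s' z.
Proof. by move=> p; rewrite /pot (perm_size p); apply: eq_bigr => n _; rewrite (phat_perm n p). Qed.

Lemma sorted_indexing (u : seq nat) N : size u = N -> (0 < N)%N -> exists c : nat -> nat,
  [/\ forall i j, (i <= j)%N -> (c i <= c j)%N, forall i, c i \in u & perm_eq (mkseq c N) u].
Proof.
move=> szu N0; pose v := sort leq u; have szv : size v = N by rewrite size_sort.
have vs : sorted leq v by apply: sort_sorted; exact: leq_total.
(* The minimum keeps the sequence constant beyond the last index. *)
pose c i := nth 0%N v (minn i N.-1).
have mN i : (minn i N.-1 < N)%N by rewrite gtn_min ltn_predL N0 orbT.
exists c; split.
- move=> i j ij; apply: (sorted_leq_nth leq_trans leqnn 0%N vs); rewrite ?inE ?szv//.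
  by rewrite leq_min geq_minr andbT (leq_trans (geq_minl _ _)).
- by move=> i; rewrite -(mem_sort leq) mem_nth// szv.
- rewrite (_ : mkseq c N = v); first by rewrite perm_sort.
  apply: (@eq_from_nth _ 0%N); first by rewrite size_mkseq.
  move=> i; rewrite size_mkseq => iN; rewrite nth_mkseq// /c; congr (nth _ _ _).
  by apply/minn_idPl; rewrite -ltnS prednK.
Qed.

Lemma RI_ext_oo a b (u v : R -> R) : measurable_fun [set: measurableTypeR R] u ->
  measurable_fun [set: measurableTypeR R] v -> (forall t, a < t < b -> u t = v t) ->
  RI a b u = RI a b v.
Proof.
move=> hu hv uv; rewrite /RI /Rintegral; congr fine; apply: eq_integral_itv_bounded.
- exact: measurable_funTS.
- exact: measurable_funTS.
- by move=> t; rewrite in_itv/=; exact: uv.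
Qed.

Lemma RI_cos (k b x y : R) : 0 < k -> x < y ->
  RI x y (fun t => cos (k * t + b)) = (sin (k * y + b) - sin (k * x + b)) / k.
Proof.
move=> k0 xy; have cl : continuous (fun t : R => k * t + b).
  by apply: (@lipschitz_cont R k) => [|s t]; [exact: ltW|rewrite opprD addrACA subrr addr0 -mulrBr
    normrM gtr0_norm].
have cc : continuous (fun t : R => cos (k * t + b)).
  by move=> t; apply: continuous_comp; [exact: cl|exact: continuous_cos].
have Dl (t : R) : is_derive t 1 (fun t : R => k * t + b) k.
  apply/is_derive_epsP => e e0; exists 1 => // h _.
  rewrite (_ : _ - _ = 0); last by ring.
  by rewrite normr0 mulr_ge0// ltW.
have D (t : R) : is_derive t 1 (fun t : R => k^-1 * sin (k * t + b)) (cos (k * t + b)).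
  have hs := @is_derive1_comp R (@sin R) (fun t => k * t + b) t _ _ (is_derive_sin _) (Dl t).
  have h := is_deriveZ k^-1 hs.
  apply: (is_derive_eq h).
  by rewrite /GRing.scale/= mulrCA mulVf ?mulr1// gt_eqF.
by rewrite (RI_FTC xy cc D); ring.
Qed.

Lemma RI_sin (k b x y : R) : 0 < k -> x < y ->
  RI x y (fun t => sin (k * t + b)) = - (cos (k * y + b) - cos (k * x + b)) / k.
Proof.
move=> k0 xy; rewrite (RI_ext (v := fun t => cos (k * t + (b - pi / 2)))); last first.
  by move=> t _; rewrite addrA cosB cos_pihalf sin_pihalf mulr0 add0r mulr1.
rewrite RI_cos// !addrA !sinB !cos_pihalf !sin_pihalf !mulr0 !mulr1 !sub0r.
by congr (_ / _); ring.
Qed.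

Variables (N : nat) (c : nat -> nat).
Hypotheses (N0 : (0 < N)%N) (cm : forall i j, (i <= j)%N -> (c i <= c j)%N).
Local Notation s := (roots N (mkseq c N) : seq C).

Let n0 : 0 < N%:R :> R. Proof. by rewrite ltr0n. Qed.

(** Runs once over the arc of length [tau / N] that starts at each point of the
    configuration. *)
Definition arc_angle (t : R) : R :=
  tau * ((c (Num.truncn (N%:R * t)))%:R / N%:R + (t - (Num.truncn (N%:R * t))%:R / N%:R)).

Lemma arc_angle_measurable : measurable_fun setT (arc_angle : measurableTypeR R -> measurableTypeR R).
Proof.
have mt : {homo (fun t : R => Num.truncn (N%:R * t)) : a b / a <= b >-> (a <= b)%N}.
  by move=> a b ab; apply: le_truncn; apply: ler_wpM2l => //; exact: ltW.
have Ni : 0 <= (N%:R : R)^-1 by rewrite invr_ge0 ltW.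
apply: measurable_funM => //; apply: measurable_funD.
  apply: nondecreasing_measurable => // a b ab; apply: ler_wpM2r => //.
  by rewrite ler_nat; apply: cm; exact: mt.
apply: measurable_funB => //.
apply: nondecreasing_measurable => // a b ab; apply: ler_wpM2r => //.
by rewrite ler_nat; exact: mt.
Qed.

Lemma arc_angle_near (t : R) : 0 <= t ->
  modulus (cis (arc_angle t) - root N (c (Num.truncn (N%:R * t)))) <= 2 * tau / N%:R.
Proof.
move=> t0; have y0 : 0 <= N%:R * t by rewrite mulr_ge0// ltW.
have /andP[x1 x2] := truncn_itv y0; have T0 := @tau_gt0 R.
rewrite rootE; apply: le_trans (cis_lip _ _) _; rewrite -mulrA; apply: ler_wpM2l => //.
rewrite /arc_angle -mulrBr addrAC subrr add0r normrM gtr0_norm//; apply: ler_wpM2l; first exact: ltW.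
have -> : t - (Num.truncn (N%:R * t))%:R / N%:R = (N%:R * t - (Num.truncn (N%:R * t))%:R) / N%:R.
  by field; rewrite gt_eqF.
rewrite normrM (ger0_norm (x := N%:R^-1)) ?invr_ge0 ?(ltW n0)// ler_piMl ?invr_ge0 ?(ltW n0)//.
by rewrite -natr1 in x2; rewrite ler_norml; apply/andP; split; lra.
Qed.

Definition arc_law := angle_law arc_angle_measurable.

(** The angle is affine on every interval [j / N, (j+1) / N], so that the coefficient
    is the one of the configuration times the one of a single arc. *)
Lemma arc_fourier n : (0 < n)%N -> modulus (fourier arc_law n) ^+ 2 =
  (N%:R / (n%:R * tau)) ^+ 2 * (modulus (phat s n) ^+ 2 * modulus (cis (n%:R * tau / N%:R) - 1 : C) ^+ 2).
Proof.
move=> n1; set k := n%:R * tau.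
have k0 : 0 < k by rewrite mulr_gt0 ?ltr0n// tau_gt0.
pose S : C := \sum_(i < N) cis (k * ((c i)%:R / N%:R)).
pose D : C := cis (k / N%:R) - 1.
pose x j : R := j%:R / N%:R.
have xS j : x j.+1 = x j + N%:R^-1 by rewrite /x -natr1 mulrDl mul1r.
have xlt j : x j < x j.+1 by rewrite xS ltrDl invr_gt0.
have ma := arc_angle_measurable.
have mlin b : measurable_fun [set: measurableTypeR R] (fun t : measurableTypeR R => k * t + b : R).
  by apply: measurable_funD => //; apply: measurable_funM.
have mcos : measurable_fun [set: measurableTypeR R] (@cos R).
  by apply: continuous_measurable_fun; exact: continuous_cos.
have msin : measurable_fun [set: measurableTypeR R] (@sin R).
  by apply: continuous_measurable_fun; exact: continuous_sin.
have mang : measurable_fun [set: measurableTypeR R] (fun t => n%:R * arc_angle t) by exact: measurable_funM.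
have trE j t : x j < t < x j.+1 -> n%:R * arc_angle t = k * t + k * ((c j)%:R / N%:R - x j).
  move=> /andP[t1 t2]; rewrite /arc_angle.
  have -> : Num.truncn (N%:R * t) = j.
    apply: truncn_def; move: t1 t2; rewrite /x ltr_pdivrMr// ltr_pdivlMr// !(mulrC t) => t1 ->.
    by rewrite ltW.
  by rewrite /k -/(x j); ring.
have bc : bounded_measurable (fun t => cos (n%:R * arc_angle t)).
  by split; [exact: (measurableT_comp mcos)|exists 1 => t; rewrite ler_norml cos_geN1 cos_le1].
have bs : bounded_measurable (fun t => sin (n%:R * arc_angle t)).
  by split; [exact: (measurableT_comp msin)|exists 1 => t; rewrite ler_norml sin_geN1 sin_le1].
have x0 : x 0%N = 0 by rewrite /x mul0r.
have x1 : x N = 1 by rewrite /x divff// gt_eqF.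
have SD : S * D = \sum_(i < N) (cis (k * (c i)%:R / N%:R + k / N%:R) - cis (k * (c i)%:R / N%:R)).
  by rewrite mulr_suml; apply: eq_bigr => i _; rewrite cisD /D mulrBr mulr1 mulrA.
have Ec : RI 0 1 (fun t => cos (n%:R * arc_angle t)) = cim (S * D) / k.
  rewrite -[X in RI X _ _]x0 -[X in RI _ X _]x1 bounded_measurable_sum//; last by move=> j; exact: ltW.
  rewrite SD cim_sum mulr_suml; apply: eq_bigr => j _.
  rewrite (RI_ext_oo (v := fun t => cos (k * t + k * ((c j)%:R / N%:R - x j)))).
  - rewrite RI_cos// cimB /= xS; congr ((sin _ - sin _) / _); ring.
  - by case: bc.
  - exact: (measurableT_comp mcos (mlin _)).
  - by move=> t /trE ->.
have Es : RI 0 1 (fun t => sin (n%:R * arc_angle t)) = - cre (S * D) / k.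
  rewrite -[X in RI X _ _]x0 -[X in RI _ X _]x1 bounded_measurable_sum//; last by move=> j; exact: ltW.
  rewrite SD cre_sum -sumrN mulr_suml; apply: eq_bigr => j _.
  rewrite (RI_ext_oo (v := fun t => sin (k * t + k * ((c j)%:R / N%:R - x j)))).
  - rewrite RI_sin// creB /= xS; congr (- (cos _ - cos _) / _); ring.
  - by case: bs.
  - exact: (measurableT_comp msin (mlin _)).
  - by move=> t /trE ->.
have Fm : modulus (fourier arc_law n) ^+ 2 = RI 0 1 (fun t => cos (n%:R * arc_angle t)) ^+ 2 +
    RI 0 1 (fun t => sin (n%:R * arc_angle t)) ^+ 2.
  by rewrite angle_law_fourier modulus_sqr /= sqrrN.
rewrite Fm Ec Es -/D.
have pE : phat s n = RtoC N%:R^-1 * S^*.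
  rewrite phat_roots /S; apply: C_ext.
    by rewrite creZ creC cre_sum.
  by rewrite cimZ cimC cim_sum mulrN.
rewrite pE modulusM modulusR modulusC ger0_norm ?invr_ge0 ?(ltW n0)//.
have e := modulus_sqr (S * D); rewrite modulusM exprMn in e.
rewrite [LHS](_ : _ = (cre (S * D) ^+ 2 + cim (S * D) ^+ 2) / k ^+ 2).
  rewrite -e; move: (modulus S) (modulus D) => a b; field.
  by rewrite !gt_eqF.
by move: (cre _) (cim _) => a b; field; rewrite gt_eqF.
Qed.

Lemma root_period x n : (root N x : C)^* ^+ (n + N) = (root N x)^* ^+ n.
Proof.
have T1 j : cis (j%:R * tau) = 1 :> C.
  by rewrite -cisX cis_tau expr1n.
have rN : root N x ^+ N = 1 :> C.
  rewrite rootE cisX (_ : N%:R * _ = x%:R * tau) ?T1//.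
  by field; rewrite gt_eqF.
by rewrite exprD -(conjCX (root N x) N) rN conjC1 mulr1.
Qed.

(** The [N]-th roots of unity cannot tell apart frequencies that agree modulo [N]. *)
Lemma phat_period q n : phat s (q * N + n) = phat s n.
Proof.
elim: q => [|q IH]; first by rewrite mul0n add0n.
rewrite -IH mulSn -addnA addnC /phat; congr (_ * _); rewrite !big_map; apply: eq_bigr => x _.
exact: root_period.
Qed.

(** The coefficient of a single arc is bounded, and decays like [N / n]. *)
Lemma arc_fourier_le n : (0 < n)%N -> modulus (fourier arc_law n) ^+ 2 <= 4 * modulus (phat s n) ^+ 2 /\
  modulus (fourier arc_law n) ^+ 2 <= (N%:R / n%:R) ^+ 2 * modulus (phat s n) ^+ 2.
Proof.
move=> n1; rewrite arc_fourier//; set p := modulus (phat s n) ^+ 2.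
have p0 : 0 <= p by exact: sqr_ge0.
have nn : 0 < n%:R :> R by rewrite ltr0n.
have /andP[T1 T2] := tau_bounds; have T0 := @tau_gt0 R.
set k := n%:R * tau; have k0 : 0 < k by rewrite mulr_gt0.
set d := modulus _; have d0 : 0 <= d by exact: modulus_ge0.
have d1 : d <= 2 * (k / N%:R).
  by have := @cis_lip R (k / N%:R) 0; rewrite cis0 subr0 gtr0_norm// divr_gt0.
have d2 : d <= 2.
  by have := modulusB (cis (k / N%:R) : C) 1; rewrite modulus_cis modulus1.
rewrite [X in X <= _ /\ X <= _](_ : _ = (N%:R / k * d) ^+ 2 * p); last by rewrite exprMn; ring.
have kN : 0 <= N%:R / k by rewrite divr_ge0// ltW.
split; apply: ler_wpM2r => //.
  rewrite (_ : 4 = 2 ^+ 2); last by rewrite expr2; lra.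
  apply: lerXn2r; rewrite ?nnegrE//; first exact: mulr_ge0.
  apply: le_trans (ler_wpM2l kN d1) _.
  by rewrite (_ : _ * _ = 2) //; field; rewrite !gt_eqF.
apply: lerXn2r; rewrite ?nnegrE; [exact: mulr_ge0|by rewrite divr_ge0// ltW|].
rewrite -mulrA; apply: ler_wpM2l; first exact: ltW.
by rewrite mulrC ler_pdivrMr// /k mulKf ?gt_eqF//; lra.
Qed.

Lemma inv_sqr_telescope (q : nat) : (q.+1%:R ^+ 2)^-1 <= 2 * (q.+1%:R^-1 - q.+2%:R^-1) :> R.
Proof.
rewrite -(natr1 q.+1); have : 1 <= q.+1%:R :> R by rewrite ler1n.
move: (q.+1%:R : R) => x x1; have -> : 2 * (x^-1 - (x + 1)^-1) = 2 / (x * (x + 1)).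
  by field; rewrite !gt_eqF; lra.
by rewrite -[X in X <= _]div1r ler_pdivrMr ?exprn_gt0//; [rewrite mulrAC ler_pdivlMr ?mulr_gt0//; nra|lra].
Qed.

(** Cut the frequencies into blocks of length [N]. By [phat_period] the [q]-th block
    repeats the coefficients of the first, damped by [1 / q^2]; the first block costs
    at most [4 truncated_energy s], all others together at most half of that. *)
Lemma arc_energy : (energy arc_law <= (6 * truncated_energy s)%:E)%E.
Proof.
pose w n := modulus (fourier arc_law n) ^+ 2 / n%:R.
pose Q : R := truncated_energy s; have Q0 : 0 <= Q := truncated_energy_ge0 _.
have w0 n : 0 <= w n by rewrite divr_ge0 ?sqr_ge0.
have QE : Q = \sum_(1 <= n < N.+1) modulus (phat s n) ^+ 2 / n%:R by rewrite /Q /truncated_energy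
  size_map size_mkseq.
have K K' : \sum_(1 <= n < (K'.+1 * N).+1) w n <= (4 + 2 * (1 - K'.+1%:R^-1)) * Q.
  elim: K' => [|q IH].
    rewrite mul1n invr1 subrr mulr0 addr0 QE mulr_sumr big_nat [X in _ <= X]big_nat.
    apply: ler_sum => n /andP[n1 _]; rewrite mulrA; apply: ler_wpM2r; first by rewrite invr_ge0.
    by have [] := arc_fourier_le n1.
  rewrite (big_cat_nat (n := (q.+1 * N).+1))//=; last by rewrite ltnS leq_mul2r leqnSn orbT.
  apply: le_trans (lerD IH (_ : _ <= (q.+1%:R ^+ 2)^-1 * Q)) _; last first.
    by rewrite -mulrDl; apply: ler_wpM2r => //; have := inv_sqr_telescope q;
    move: (_ ^- 2) (q.+1%:R^-1) (q.+2%:R^-1) => a a1 a2; lra.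
  rewrite -[(q.+1 * N).+1]add1n (_ : (q.+2 * N).+1 = (N.+1 + q.+1 * N)%N); last by rewrite mulSn.
  rewrite big_addn addnK QE mulr_sumr big_nat [X in _ <= X]big_nat; apply: ler_sum => r /andP[r1 _].
  have m0 : (0 < r + q.+1 * N)%N by rewrite addn_gt0 r1.
  have [_ h] := arc_fourier_le m0; rewrite [in X in _ <= X](addnC r) phat_period in h.
  have r0 : 0 < r%:R :> R by rewrite ltr0n.
  have mr : r%:R <= (r + q.+1 * N)%:R :> R by rewrite ler_nat leq_addr.
  have mq : q.+1%:R * N%:R <= (r + q.+1 * N)%:R :> R by rewrite -natrM ler_nat leq_addl.
  rewrite /w mulrA; move: h; rewrite (addnC (q.+1 * N)%N); set m := (r + _)%:R in mr mq *.
  set p := modulus (phat s r) ^+ 2 => h; have p0 : 0 <= p by exact: sqr_ge0.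
  have mm : 0 < m by exact: lt_le_trans mr.
  have qq : 0 < q.+1%:R :> R by rewrite ltr0n.
  apply: ler_pM; rewrite ?sqr_ge0 ?invr_ge0 ?(ltW mm)//; last by rewrite lef_pV2.
  apply: le_trans h _; apply: ler_wpM2r => //.
  rewrite -exprVn; apply: lerXn2r; rewrite ?nnegrE ?invr_ge0 ?divr_ge0 ?(ltW mm) ?(ltW n0) ?(ltW qq)//.
  by rewrite ler_pdivrMr// mulrC ler_pdivlMr// mulrC.
apply: lime_le; first by apply: is_cvg_nneseries => n _ _; rewrite lee_fin w0.
apply: nearW => m; rewrite sumEFin lee_fin.
apply: (@le_trans _ _ (\sum_(1 <= n < (m.+1 * N).+1) w n)).
  have mN : (m <= (m.+1 * N).+1)%N by apply: leq_trans (leqnSn _) _; rewrite ltnS -{1}(muln1 m) leq_mul.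
  case: m mN => [|m] mN; first by rewrite big_geq// sumr_ge0.
  by rewrite [X in _ <= X](big_cat_nat (n := m.+1))//= lerDl sumr_ge0.
apply: le_trans (K m) _; apply: ler_wpM2r => //.
have h : 0 <= (m.+1%:R : R)^-1 by [].
by move: (m.+1%:R^-1) h => i h; lra.
Qed.

End Arcs.

Section Block.
Context {R : realType}.
Local Notation C := (Cplx R).
Local Notation tau := (@tau R).
Variable E : set C.
Hypotheses (E_closed : closed E) (E_circle : E `<=` circle) (E0 : E !=set0).
Hypothesis E_cap : capacity E = 0%E.

Lemma fekete_sorted N : (0 < N)%N -> exists c : nat -> nat,
  [/\ forall i j, (i <= j)%N -> (c i <= c j)%N,
      forall i, (c i < N)%N /\ admissible E N (c i) &
      forall x, (x < N)%N -> admissible E N x ->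
        truncated_energy (roots N (mkseq c N)) - 2 <= cre (pot (roots N (mkseq c N)) (root N x)) :> R].
Proof.
move=> N0; have [u [szu uE uF]] := fekete E_circle E0 N0.
have [c [cm cu cp]] := sorted_indexing szu N0; exists c; split => //.
  by move=> i; apply: uE.
have p : perm_eq (roots N (mkseq c N) : seq C) (roots N u) by exact: perm_map.
by move=> x xN ax; rewrite (truncated_energy_perm p) (pot_perm _ p); exact: uF.
Qed.

(** Otherwise [energy_tight] would provide a measure of finite energy on [E]. *)
Lemma energy_unbounded (M : R) l0 : exists l (c : nat -> nat), [/\ (l0 <= l)%N,
   forall i j, (i <= j)%N -> (c i <= c j)%N,
   forall i, (c i < 2 ^ l)%N /\ admissible E (2 ^ l) (c i),
   forall x, (x < 2 ^ l)%N -> admissible E (2 ^ l) x ->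
        truncated_energy (roots (2 ^ l) (mkseq c (2 ^ l))) - 2 <= cre (pot (roots (2 ^ l) (mkseq c
          (2 ^ l))) (root (2 ^ l) x)) :> R &
   M <= truncated_energy (roots (2 ^ l) (mkseq c (2 ^ l)))].
Proof.
have H l := @fekete_sorted (2 ^ l) (expn_gt0 2 l).
have [c Hc] := choice H; apply: contrapT => nH.
have [P [PE Pe]] : exists P : probability (@borelC R) R, P E = 1%E /\ (energy P <= M%:E)%E.
  apply: (@energy_tight R E E_closed c M l0) => [l i j|l i|l i|l l0l].
  - by have [+ _ _] := Hc l; apply.
  - by have [_ /(_ i)[]] := Hc l.
  - by have [_ /(_ i)[]] := Hc l.
  - rewrite leNgt; apply/negP => hM; apply: nH; exists l, (c l); have [? ? ?] := Hc l; split => //.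
    exact: ltW.
by move: Pe; rewrite (energy_infinite E_cap PE) leye_eq.
Qed.

(** The Lipschitz bound of the potential carries the estimate of [fekete] from the
    admissible grid points to a neighbourhood of [E] and to the arcs that support
    [arc_law]. *)
Lemma block (M delta : R) : 0 < delta -> exists s : seq C,
  [/\ s != [::] /\ on_circle s,
      {in s, forall x, exists2 e, E e & modulus (x - e) <= delta},
      M <= truncated_energy s,
      (exists2 eta : R, 0 < eta & forall e z, E e -> modulus z <= 1 -> modulus (z - e) < eta ->
        truncated_energy s - 20 <= cre (pot s z)) &
      exists2 P : probability (@borelC R) R, (energy P <= (6 * truncated_energy s)%:E)%E &
        forall A : set C, (forall z, modulus z = 1 -> truncated_energy s - 20 <= cre (pot s z) -> A z) ->
          P A = 1%E].
Proof.
move=> d0; have /andP[T1 T2] := @tau_bounds R; have T0 := @tau_gt0 R.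
have [l [c [ll cm cE cF cM]]] := energy_unbounded M (Num.truncn (2 * tau / delta)).+1.
set N := (2 ^ l)%N in cE cF cM; have N0 : (0 < N)%N by rewrite expn_gt0.
have n0 : 0 < N%:R :> R by rewrite ltr0n.
have small : 2 * tau / N%:R <= delta.
  rewrite ler_pdivrMr// [X in _ <= X]mulrC -ler_pdivrMr//; apply/ltW; apply: lt_le_trans (truncnS_gt _) _.
  by rewrite ler_nat; apply: leq_trans ll _; exact/ltnW/ltn_expl.
set s := roots N (mkseq c N) in cF cM *; exists s.
have sc : on_circle s := @roots_circle R N (mkseq c N).
have szs : size s = N by rewrite size_map size_mkseq.
have s0 : s != [::] by rewrite -size_eq0 szs -lt0n.
have lip z w : modulus z <= 1 -> modulus w <= 1 -> cre (pot s w) - N%:R * modulus (z - w) <= cre (pot s z).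
  move=> z1 w1; have := pot_lip s0 sc z1 w1; rewrite szs.
  by have := cre_le_modulus (pot s z - pot s w); rewrite creB ler_norml => /andP[? ?]; lra.
have cN (x : C) (y : R) : modulus x <= y -> N%:R * modulus x <= N%:R * y.
  by move=> ?; apply: ler_wpM2l.
(* The loss is 2 in [fekete_sorted], plus [N] times a distance of at most
   [(1 + 2 tau) / N], with [tau <= 8]: altogether less than 20. *)
have N2 : N%:R * (2 * tau / N%:R) = 2 * tau by field; rewrite gt_eqF.
split => //.
- move=> _ /mapP[x /mapP[i _ ->] ->]; have [_ [e Ee he]] := cE i.
  by exists e => //; exact: le_trans he small.
- exists N%:R^-1; first by rewrite invr_gt0.
  move=> e z Ee z1 ze; have [x xN xe] := admissible_near E_circle N0 Ee.
  have ax : admissible E N x by exists e.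
  have h1 := cF x xN ax; have r1 : modulus (root N x : C) <= 1 by rewrite modulus_root.
  have h2 := lip z _ z1 r1.
  have h3 : N%:R * modulus (z - root N x) <= N%:R * (N%:R^-1 + 2 * tau / N%:R).
    apply: cN.
    rewrite modulus_distC in xe; apply: le_trans (modulus_triangle _ e _) _.
    by apply: lerD => //; exact: ltW.
  by move: h3; rewrite mulrDr N2 divff ?gt_eqF//; lra.
- exists (arc_law N0 cm); first exact: arc_energy.
  move=> A HA; apply: angle_law_full => t /andP[t0 t1]; apply: HA; first exact: modulus_cis.
  have [xN ax] := cE (Num.truncn (N%:R * t)); have h1 := cF _ xN ax.
  have h := @arc_angle_near R N c N0 t t0.
  have h2 := lip (cis (arc_angle N c t)) (root N (c (Num.truncn (N%:R * t)))).
  have h3 := cN _ _ h; rewrite N2 in h3.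
  by move: h2; rewrite modulus_cis modulus_root => /(_ (lexx _) (lexx _)); lra.
Qed.

End Block.

(** * The outer function *)

Section GeometricSeries.
Context {R : realType}.
Local Notation C := (Cplx R).
Implicit Types (u v : nat -> C) (l m z w : C).

Definition half_pow k : R := 2^-1 ^+ k.

Lemma half_pow_gt0 k : 0 < half_pow k.
Proof. by rewrite exprn_gt0// invr_gt0. Qed.

Lemma half_powS k : half_pow k.+1 = half_pow k / 2.
Proof. by rewrite /half_pow exprS mulrC. Qed.

Lemma half_pow_small (e : R) : 0 < e -> exists n, half_pow n < e.
Proof. by move=> e0; apply: small_pow => //; apply/andP; split; lra. Qed.

Lemma half_pow_le k n : (k <= n)%N -> half_pow n <= half_pow k.
Proof.
move=> kn; rewrite -(subnK kn) /half_pow exprD; apply: ler_piMl; first exact: ltW (half_pow_gt0 k).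
by apply: exprn_ile1; lra.
Qed.

Lemma half_pow_le1 k : half_pow k <= 1.
Proof. by have := half_pow_le (leq0n k); rewrite /half_pow expr0. Qed.

Lemma half_pow_sum n : \sum_(k < n) half_pow k = 2 - 2 * half_pow n.
Proof.
elim: n => [|n IH]; first by rewrite big_ord0 /half_pow expr0; lra.
by rewrite big_ord_recr/= IH half_powS; lra.
Qed.

Definition psum u n : C := \sum_(k < n) u k.

(** Convergence of a complex series at a geometric rate. *)
Definition geo_sum u l := exists B : R, forall n, modulus (l - psum u n) <= B * half_pow n.

Definition dominated u (B : R) := forall k, modulus (u k) <= B * half_pow k.

Lemma psum_diff u B (n m : nat) : dominated u B ->
  modulus (psum u (n + m) - psum u n) <= 2 * B * half_pow n - 2 * B * half_pow (n + m).
Proof.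
move=> H; elim: m => [|m IH]; first by rewrite addn0 !subrr modulus0.
rewrite addnS /psum big_ord_recr/= -/(psum u (n + m)) addrAC.
apply: le_trans (modulusD _ _) _; apply: le_trans (lerD IH (H _)) _.
by rewrite half_powS; lra.
Qed.

Lemma real_geo_limit (x : nat -> R) (B : R) : (forall n, `|x n.+1 - x n| <= B * half_pow n) ->
  exists l : R, forall n, `|l - x n| <= 2 * B * half_pow n.
Proof.
move=> H; have B0 : 0 <= B.
  by have := le_trans (normr_ge0 _) (H 0%N); rewrite /half_pow expr0 mulr1.
have [||n|l hl] := @nested_seq R (fun n => x n - 2 * B * half_pow n) (fun n => 4 * B * half_pow n).
- by move=> n; have := H n; rewrite ler_norml half_powS => /andP[? ?]; lra.
- by move=> n; have := H n; rewrite ler_norml half_powS => /andP[? ?]; lra.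
- by rewrite !mulr_ge0// ltW// half_pow_gt0.
by exists l => n; have /andP[? ?] := hl n; rewrite ler_norml; apply/andP; split; lra.
Qed.

Lemma geo_exists u B : dominated u B -> exists l, geo_sum u l.
Proof.
move=> H; have dS n : psum u n.+1 - psum u n = u n by rewrite /psum big_ord_recr/= addrAC subrr add0r.
have [a ha] : exists a, forall n, `|a - cre (psum u n)| <= 2 * B * half_pow n.
  by apply: real_geo_limit => n; rewrite -creB dS; apply: le_trans (cre_le_modulus _) (H n).
have [b hb] : exists b, forall n, `|b - cim (psum u n)| <= 2 * B * half_pow n.
  by apply: real_geo_limit => n; rewrite -cimB dS; apply: le_trans (cim_le_modulus _) (H n).
exists (Complex a b), (4 * B) => n; apply: le_trans (modulus_le _) _; rewrite creB cimB.
by have := ha n; have := hb n; rewrite /=; lra.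
Qed.

Lemma geo_approx u l (e : R) n0 : geo_sum u l -> 0 < e ->
  exists2 n, (n0 <= n)%N & modulus (l - psum u n) < e.
Proof.
move=> [B H] e0; have B0 : 0 <= B.
  by have := le_trans (modulus_ge0 _) (H 0%N); rewrite /half_pow expr0 mulr1.
have [|n hn] := @half_pow_small (e / (B + 1)); first by rewrite divr_gt0//; lra.
exists (maxn n0 n); first exact: leq_maxl.
apply: le_lt_trans (H _) _; apply: le_lt_trans (ler_wpM2l B0 (half_pow_le (leq_maxr n0 n))) _.
by move: hn; rewrite ltr_pdivlMr; [have := half_pow_gt0 n; nra|lra].
Qed.

Lemma geo_tail u l B n : dominated u B -> geo_sum u l -> modulus (l - psum u n) <= 2 * B * half_pow n.
Proof.
move=> H hl; have B0 : 0 <= B.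
  by have := le_trans (modulus_ge0 _) (H 0%N); rewrite /half_pow expr0 mulr1.
rewrite leNgt; apply/negP => h.
have [|m nm hm] := @geo_approx u l (modulus (l - psum u n) - 2 * B * half_pow n) n hl; first lra.
have := @psum_diff u B n (m - n) H; rewrite subnKC// => h2.
have : 0 <= 2 * B * half_pow m by rewrite !mulr_ge0// ltW// half_pow_gt0.
by have := modulus_triangle l (psum u m) (psum u n); lra.
Qed.

Lemma geo_bound u l B : dominated u B -> geo_sum u l -> modulus l <= 2 * B.
Proof.
by move=> H hl; have := geo_tail 0 H hl; rewrite /psum big_ord0 subr0 /half_pow expr0 mulr1.
Qed.

Lemma psumB u v n : psum (fun k => u k - v k) n = psum u n - psum v n.
Proof. exact: sumrB. Qed.

Lemma geo_sumB u v l m : geo_sum u l -> geo_sum v m -> geo_sum (fun k => u k - v k) (l - m).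
Proof.
move=> [A HA] [B HB]; exists (A + B) => n; rewrite psumB.
rewrite (_ : _ - _ = (l - psum u n) - (m - psum v n)); last by ring.
by apply: le_trans (modulusB _ _) _; rewrite mulrDl lerD.
Qed.

Lemma geo_sumZ u l (a : C) : geo_sum u l -> geo_sum (fun k => u k * a) (l * a).
Proof.
move=> [A HA]; exists (A * modulus a) => n; rewrite /psum -mulr_suml -mulrBl modulusM mulrAC.
by apply: ler_wpM2r; [exact: modulus_ge0|exact: HA].
Qed.

Lemma geo_re_ge u l (c : R) n0 : geo_sum u l -> (forall n, (n0 <= n)%N -> c <= cre (psum u n)) ->
  c <= cre l.
Proof.
move=> hl H; rewrite leNgt; apply/negP => h.
have [|n n1 hn] := @geo_approx u l (c - cre l) n0 hl; first lra.
have := H _ n1; have := le_lt_trans (cre_le_modulus _) hn.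
by rewrite creB ltr_norml => /andP[? ?]; lra.
Qed.

Lemma geo_im_le u l (c : R) : geo_sum u l -> (forall n, `|cim (psum u n)| <= c) -> `|cim l| <= c.
Proof.
move=> hl H; rewrite leNgt; apply/negP => h.
have [|n n1 hn] := @geo_approx u l (`|cim l| - c) 0%N hl; first lra.
have := H n; have := le_lt_trans (cim_le_modulus _) hn; rewrite cimB.
by have := ler_normB (cim l - cim (psum u n)) (- cim (psum u n)); rewrite opprK subrK normrN; lra.
Qed.

(** The Cauchy-Schwarz inequality with geometric weights. *)
Lemma psum_sqr (a : nat -> C) n :
  modulus (psum a n) ^+ 2 <= \sum_(k < n) 2 / half_pow k * modulus (a k) ^+ 2.
Proof.
elim: n a => [|n IH] a; first by rewrite /psum !big_ord0 modulus0 expr0n.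
rewrite /psum big_ord_recl [X in _ <= X]big_ord_recl /=.
set S := \sum_(i < n) _; set T := \sum_(i < n) _.
have h : 2 * modulus S ^+ 2 <= T.
  apply: le_trans (ler_wpM2l _ (IH (fun k => a k.+1))) _ => //.
  rewrite mulr_sumr; apply: ler_sum => i _; rewrite /bump /= add1n half_powS mulrA; apply: ler_wpM2r => //.
    exact: sqr_ge0.
  by rewrite le_eqVlt; apply/orP; left; apply/eqP; field; rewrite gt_eqF ?half_pow_gt0.
have h0 := modulus_ge0 (a 0%N); have h1 := modulus_ge0 S; have := modulusD (a 0%N) S.
have := modulus_ge0 (a 0%N + S); rewrite /half_pow expr0 divr1.
move: h h0 h1; move: (modulus _) (modulus S) (modulus (a 0%N + S)) => x y s h x0 y0 s0 sxy.
have : s ^+ 2 <= (x + y) ^+ 2 by apply: lerXn2r; rewrite ?nnegrE ?addr_ge0.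
by have := sqr_ge0 (x - y); lra.
Qed.

End GeometricSeries.

Section OuterFunction.
Context {R : realType}.
Local Notation C := (Cplx R).
Local Notation area := (@area R).
Local Notation discarea := (@discarea R).
Local Notation half_pow := (@half_pow R).
Implicit Types (z w h : C).

Lemma cos_ge_half (x : R) : `|x| <= 1 -> 1 / 2 <= cos x.
Proof.
move=> x1; have -> : cos x = 1 - 2 * sin (x / 2) ^+ 2.
  rewrite {1}(_ : x = x / 2 + x / 2); last lra.
  by rewrite cosD -!expr2; have := cos2Dsin2 (x / 2); lra.
have h : `|sin (x / 2)| <= 1 / 2.
  have := sin_lip (x / 2) 0; rewrite sin0 !subr0 => h; apply: le_trans h _.
  by rewrite normrM (ger0_norm (x := 2^-1)) ?invr_ge0//; lra.
have : sin (x / 2) ^+ 2 <= (1 / 2) ^+ 2.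
  by rewrite -real_normK ?num_real//; apply: lerXn2r; rewrite ?nnegrE//; lra.
by lra.
Qed.

(** The Cayley transform of the right half plane onto the disc. *)
Definition cayley z : C := (z - 1) / (z + 1).

Lemma cayley_neq0 z : 0 < cre z -> z + 1 != 0.
Proof. by move=> z0; rewrite -modulus_gt0; have := cre_le_modulus (z + 1); rewrite creD cre1
  ler_norml => /andP[? ?]; lra. Qed.

Lemma cayley_modulus z : 0 < cre z ->
  1 - modulus (cayley z) ^+ 2 = 4 * cre z / modulus (z + 1) ^+ 2.
Proof.
move=> z0; have P0 : modulus (z + 1) ^+ 2 != 0.
  by rewrite expf_neq0// modulus_eq0 cayley_neq0.
rewrite /cayley modulusM modulusV exprMn exprVn.
rewrite -[X in X - _](divff P0) -mulrBl; congr (_ / _).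
by rewrite !modulus_sqr !cE; ring.
Qed.

Lemma cayley_lt1 z : 0 < cre z -> modulus (cayley z) < 1.
Proof.
move=> z0; have P0 : 0 < modulus (z + 1) ^+ 2 by rewrite exprn_gt0// modulus_gt0 cayley_neq0.
have : 0 < 1 - modulus (cayley z) ^+ 2 by rewrite cayley_modulus// divr_gt0// mulr_gt0.
by have := modulus_ge0 (cayley z); nra.
Qed.

Lemma cayley_near1 z : 0 < cre z -> modulus (cayley z - 1) <= 2 / modulus z.
Proof.
move=> z0; have n0 := cayley_neq0 z0.
have m0 : 0 < modulus z by apply: lt_le_trans (cre_le_modulus z); rewrite gtr0_norm.
have -> : cayley z - 1 = RtoC (-2) / (z + 1).
  apply: (mulIf n0); rewrite mulrBl /cayley !mulfVK// mul1r; apply: C_ext; rewrite !cE; lra.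
rewrite modulusM modulusR modulusV normrN (ger0_norm (x := 2))//; apply: ler_wpM2l => //.
rewrite lef_pV2 ?posrE// ?modulus_gt0//.
have := modulus_ge0 (z + 1); have : modulus z ^+ 2 <= modulus (z + 1) ^+ 2 by rewrite !modulus_sqr !cE; nra.
by move: (modulus (z + 1)) => a ? ?; nra.
Qed.

Lemma cayley_cderiv (g : C -> C) z d : cderiv g z d -> 0 < cre (g z) ->
  cderiv (fun w => cayley (g w)) z (RtoC 2 * d / (g z + 1) ^+ 2).
Proof.
move=> H g0; have n0 := cayley_neq0 g0.
have H1 := cderivD H (cderiv_cst (-1) z); have H2 := cderivD H (cderiv_cst 1 z).
have := cderivM H1 (cderiv_comp H2 (cderivV n0)); rewrite !addr0.
rewrite (_ : _ + _ = RtoC 2 * d / (g z + 1) ^+ 2) //.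
have -> : RtoC 2 = 1 + 1 :> C by rewrite -RtoC1 -RtoCD.
by field; exact: n0.
Qed.

Variable E : set C.
Hypotheses (E_closed : closed E) (E_circle : E `<=` circle).

(** The potentials of [block], in abstract form: [f k] has derivative [f' k], Lipschitz
    constant [N k] and Dirichlet integral proportional to [Q k], and enters the series
    with weight [b k]. *)
Variables (f f' : nat -> C -> C) (N Q b : nat -> R).
Hypothesis N_ge0 : forall k, 0 <= N k.
Hypothesis f0 : forall k, f k 0 = 0.
Hypothesis f_lip : forall k z w, modulus z <= 1 -> modulus w <= 1 ->
  modulus (f k z - f k w) <= N k * modulus (z - w).
Hypothesis f_im : forall k z, modulus z <= 1 -> `|cim (f k z)| <= 3.
Hypothesis f_re : forall k z, modulus z <= 1 -> -3 <= cre (f k z).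
Hypothesis f_far : forall k z (d : R), modulus z <= 1 -> 0 < d ->
  (forall e, E e -> d + half_pow k <= modulus (z - e)) -> modulus (f k z) <= 2 / d.
Hypothesis f_quad : forall k z h (r : R), r < 1 -> modulus z <= r -> modulus (z + h) <= r ->
  modulus (f k (z + h) - f k z - f' k z * h) <= modulus h ^+ 2 / (1 - r) ^+ 2.
Hypothesis f'_le : forall k z (r : R), r < 1 -> modulus z <= r -> modulus (f' k z) <= 1 / (1 - r).
Hypothesis f'_cont : forall k z, ccont (f' k) z.
Hypothesis f_area : forall k,
  (\int[area]_(p in plane_ball 1) (modulus (f' k (plane p)) ^+ 2)%:E = (discarea * Q k)%:E)%E.
Hypothesis f_near : forall k, exists2 eta : R, 0 < eta & forall e z, E e -> modulus z <= 1 ->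
  modulus (z - e) < eta -> Q k - 20 <= cre (f k z).
Hypothesis b_gt0 : forall k, 0 < b k.
Hypothesis b_le : forall k, b k <= half_pow k / 6.
Hypothesis bQ : forall k, b k ^+ 2 * Q k <= half_pow k ^+ 2 / 36.
Hypothesis b_large : forall k, k%:R <= b k * Q k - 5.

Let U z k : C := RtoC (b k) * f k z.
Let U' z k : C := RtoC (b k) * f' k z.

Definition series_sum (u : nat -> C) : C := xget 0 [set l | geo_sum u l].
(** The logarithm of the outer function. *)
Definition log_outer z := series_sum (U z).
Definition log_outer' z := series_sum (U' z).

Lemma series_sumP u B : dominated u B -> geo_sum u (series_sum u).
Proof. by move=> /geo_exists[l hl]; exact: (@xgetPex _ 0 [set l | geo_sum u l] (ex_intro _ l hl)). Qed.

Lemma U_dominated z (B : R) : (forall k, modulus (f k z) <= B) -> dominated (U z) B.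
Proof.
move=> H k; rewrite /U modulusM modulusR gtr0_norm ?b_gt0// mulrC.
have B0 := le_trans (modulus_ge0 _) (H k).
apply: ler_pM => //; first exact: modulus_ge0; first exact: ltW.
by have := b_le k; have := half_pow_gt0 (R := R) k; lra.
Qed.

Lemma f_size k z : modulus z <= 1 -> modulus (f k z) <= N k.
Proof.
move=> z1; have := @f_lip k z 0 z1; rewrite modulus0 f0 !subr0 => /(_ ler01) h.
apply: le_trans h _; exact: ler_piMr.
Qed.

(** All but finitely many configurations stay away from a given point off [E], and
    the remaining potentials are bounded by their Lipschitz constants. *)
Lemma f_locally_bounded z : modulus z <= 1 -> ~ E z -> exists2 d : R, 0 < d &
  exists B : R, forall w, modulus w <= 1 -> modulus (w - z) < d -> forall k, modulus (f k w) <= B.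
Proof.
move=> z1 nE; have oE : openC (~` E) by apply: open_openC; exact: closed_openC.
have [e e0 He] := oE z nE.
have Hd x : E x -> e <= modulus (z - x).
  move=> Ex; rewrite leNgt; apply/negP => h; apply: (He x) => //.
  by rewrite modulus_distC.
have e4 : 0 < e / 4 by lra.
have [k0 hk0] := half_pow_small e4; exists (e / 4) => //.
exists (2 / (e / 4) + \sum_(k < k0) N k) => w w1 wz k.
have S0 : 0 <= \sum_(k < k0) N k by apply: sumr_ge0.
have [kk|kk] := leqP k0 k.
  apply: le_trans (_ : 2 / (e / 4) <= _); last by lra.
  apply: f_far => // x Ex; have := half_pow_le (R := R) kk; have := Hd _ Ex.
  by have := modulus_triangle z w x; rewrite (modulus_distC z w); lra.
apply: le_trans (f_size _ w1) _; rewrite (bigD1 (Ordinal kk))//=.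
have : 0 <= \sum_(i < k0 | i != Ordinal kk) N i by apply: sumr_ge0.
have : 0 <= 2 / (e / 4) by rewrite divr_ge0// ltW.
lra.
Qed.

Lemma disc_notE z : modulus z < 1 -> ~ E z.
Proof. by move=> z1 /E_circle; rewrite /circle /mkset => h; rewrite h ltxx in z1. Qed.

Lemma log_outer_sum z : modulus z <= 1 -> ~ E z -> geo_sum (U z) (log_outer z).
Proof.
move=> z1 nE; have [d d0 [B HB]] := f_locally_bounded z1 nE.
apply: (@series_sumP _ B); apply: U_dominated => k; apply: HB => //.
by rewrite subrr modulus0.
Qed.

Lemma log_outer'_dominated z : modulus z < 1 -> dominated (U' z) (1 / (1 - modulus z)).
Proof.
move=> z1 k; rewrite /U' modulusM modulusR gtr0_norm ?b_gt0// mulrC.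
apply: ler_pM; [exact: modulus_ge0|exact: ltW|exact: f'_le|].
by have := b_le k; have := half_pow_gt0 (R := R) k; lra.
Qed.

Lemma log_outer'_sum z : modulus z < 1 -> geo_sum (U' z) (log_outer' z).
Proof. by move=> /log_outer'_dominated; exact: series_sumP. Qed.

Lemma psum_im z n : modulus z <= 1 -> `|cim (psum (U z) n)| <= 1.
Proof.
move=> z1; rewrite /psum cim_sum; apply: le_trans (ler_norm_sum _ _ _) _.
apply: (@le_trans _ _ (\sum_(k < n) half_pow k / 2)).
  apply: ler_sum => k _; rewrite cimZ normrM gtr0_norm//.
  have := f_im k z1; have := b_le k; have := b_gt0 k; have := normr_ge0 (cim (f k z)).
  by move: (`|_|) => a ? ? ? ?; nra.
by rewrite -mulr_suml half_pow_sum; have := half_pow_gt0 (R := R) n; lra.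
Qed.

(** The other terms are at least [- 3 b k], and these lower bounds add up to at most 1
    in absolute value. *)
Lemma psum_re z n j : modulus z <= 1 -> (j < n)%N ->
  b j * cre (f j z) - 1 <= cre (psum (U z) n).
Proof.
move=> z1 jn; rewrite /psum cre_sum (bigD1 (Ordinal jn))//= creZ lerD2l.
apply: (@le_trans _ _ (- \sum_(k < n) half_pow k / 2)).
  by rewrite -mulr_suml half_pow_sum; have := half_pow_gt0 (R := R) n; lra.
rewrite (bigD1 (Ordinal jn))//= opprD -sumrN; apply: (@le_trans _ _ (\sum_(k < n | k != Ordinal jn)
  - (half_pow k / 2))).
  by have := half_pow_gt0 (R := R) j; lra.
apply: ler_sum => k _; rewrite creZ.
by have := f_re k z1; have := b_le k; have := b_gt0 k; nra.
Qed.

Lemma log_outer_im z : modulus z <= 1 -> ~ E z -> `|cim (log_outer z)| <= 1.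
Proof. by move=> z1 nE; apply: (geo_im_le (log_outer_sum z1 nE)) => n; exact: psum_im. Qed.

Lemma log_outer_re z j : modulus z <= 1 -> ~ E z -> b j * cre (f j z) - 1 <= cre (log_outer z).
Proof. by move=> z1 nE; apply: (geo_re_ge (n0 := j.+1) (log_outer_sum z1 nE)) => n; exact: psum_re. Qed.

Lemma log_outer0 : log_outer 0 = 0.
Proof.
have z1 : modulus (0 : C) <= 1 by rewrite modulus0.
have nE : ~ E 0 by apply: disc_notE; rewrite modulus0.
have D : dominated (U 0) 0 by apply: U_dominated => k; rewrite f0 modulus0.
apply/eqP; rewrite -modulus_eq0 eq_le modulus_ge0 andbT.
by have := geo_bound D (log_outer_sum z1 nE); rewrite mulr0.
Qed.

(** The quadratic remainders are dominated uniformly in the index of the series. *)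
Lemma log_outer_cderiv z : modulus z < 1 -> cderiv log_outer z (log_outer' z).
Proof.
move=> z1 e e0; pose r := (1 + modulus z) / 2; have r1 : r < 1 by rewrite /r; lra.
have zr : modulus z <= r by rewrite /r; lra.
pose A := 1 / (1 - r) ^+ 2; have A0 : 0 < A by rewrite divr_gt0// exprn_gt0//; lra.
exists (Num.min ((1 - modulus z) / 2) (e / (2 * A))).
  rewrite lt_min; apply/andP; split; first by lra.
  by rewrite divr_gt0// mulr_gt0.
move=> h; rewrite lt_min => /andP[h1 h2].
have zhr : modulus (z + h) <= r by have := modulusD z h; rewrite /r; lra.
have S1 := log_outer_sum (le_trans zhr (ltW r1)) (disc_notE (le_lt_trans zhr r1)).
have S2 := log_outer_sum (ltW z1) (disc_notE z1).
have S := geo_sumB (geo_sumB S1 S2) (geo_sumZ h (log_outer'_sum z1)).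
have D : dominated (fun k => U (z + h) k - U z k - U' z k * h) (A * modulus h ^+ 2).
  move=> k; rewrite /U /U' -mulrBr -mulrA -mulrBr modulusM modulusR gtr0_norm// mulrC.
  apply: ler_pM; [exact: modulus_ge0|exact: ltW| |].
    by rewrite (mulrC A) /A div1r; exact: f_quad.
  by have := b_le k; have := half_pow_gt0 (R := R) k; lra.
apply: le_trans (geo_bound D S) _.
have A2 : 0 < 2 * A by lra.
move: h2; rewrite ltr_pdivlMr// => h2.
have -> : 2 * (A * modulus h ^+ 2) = modulus h * (2 * A) * modulus h by ring.
by apply: ler_wpM2r; [exact: modulus_ge0|exact: ltW].
Qed.

Lemma log_outer_cont z (e : R) : modulus z <= 1 -> ~ E z -> 0 < e -> exists2 d : R, 0 < d &
  forall w, modulus w <= 1 -> modulus (w - z) < d -> ~ E w /\ modulus (log_outer w - log_outer z) < e.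
Proof.
move=> z1 nE e0; have [d d0 [B HB]] := f_locally_bounded z1 nE.
have oE : openC (~` E) by apply: open_openC; exact: closed_openC.
have [d' d'0 Hd'] := oE z nE.
have zz : modulus (z - z) < d by rewrite subrr modulus0.
have B0 : 0 <= B := le_trans (modulus_ge0 _) (HB z z1 zz 0%N).
have [n hn] : exists n, half_pow n < e / (8 * (B + 1)) by apply: half_pow_small; rewrite divr_gt0//
  mulr_gt0//; lra.
have tl : 2 * B * half_pow n < e / 4.
  by move: hn; rewrite ltr_pdivlMr; [have := half_pow_gt0 (R := R) n; nra|lra].
pose L := \sum_(k < n) N k + 1.
have N0 : 0 <= \sum_(k < n) N k by apply: sumr_ge0.
have L0 : 0 < L by rewrite /L; lra.
exists (Num.min (Num.min d d') (e / (2 * L))).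
  by rewrite !lt_min d0 d'0 divr_gt0// mulr_gt0.
move=> w w1; rewrite !lt_min => /andP[/andP[wd wd'] wL].
have nEw : ~ E w by exact: Hd'.
split => //.
have T1 := geo_tail n (U_dominated (HB w w1 wd)) (log_outer_sum w1 nEw).
have T2 := geo_tail n (U_dominated (HB z z1 zz)) (log_outer_sum z1 nE).
have T3 : modulus (psum (U w) n - psum (U z) n) < e / 2.
  rewrite -psumB; apply: le_lt_trans (modulus_sum _ _ _) _.
  apply: (@le_lt_trans _ _ (L * modulus (w - z))); last by move: wL; rewrite ltr_pdivlMr ?mulr_gt0//; lra.
  apply: (@le_trans _ _ (\sum_(k < n) N k * modulus (w - z))).
    apply: ler_sum => k _; rewrite /U -mulrBr modulusM modulusR gtr0_norm//.
    apply: le_trans (f_lip k w1 z1); apply: ler_piMl; first exact: modulus_ge0.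
    by have := b_le k; have := half_pow_le1 (R := R) k; lra.
  by rewrite -mulr_suml; apply: ler_wpM2r; [exact: modulus_ge0|rewrite /L; lra].
have := modulus_triangle (log_outer w) (psum (U w) n) (log_outer z).
have := modulus_triangle (psum (U w) n) (psum (U z) n) (log_outer z).
by rewrite (modulus_distC (psum (U z) n)); lra.
Qed.

(** [psum_sqr] reduces the integral to those of the terms, and the geometric weights
    are compensated by the bound on [b k ^+ 2 * Q k]. *)
Lemma log_outer'_area : (\int[area]_(p in plane_ball 1) (modulus (log_outer' (plane p)) ^+ 2)%:E <=
  (discarea / 9)%:E)%E.
Proof.
pose G k (p : measurableTypeR R * measurableTypeR R) : \bar R :=
  (2 / half_pow k * modulus (U' (plane p) k) ^+ 2)%:E.
have G0 k p : (0 <= G k p)%E.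
  by rewrite lee_fin mulr_ge0 ?sqr_ge0// divr_ge0// ltW// half_pow_gt0.
have mG k : measurable_fun (plane_ball 1) (G k).
  apply/measurable_EFinP; apply: measurable_funM => //.
  apply: (rcontC_measurable_disc (h := fun z => modulus (U' z k) ^+ 2)) => z _.
  apply: rcontC_sqr; apply: rcontC_modulus; apply: ccontM; first exact: ccont_cst.
  exact: f'_cont.
apply: (@le_trans _ _ (\int[area]_(p in plane_ball 1) \sum_(0 <= k <oo) G k p)%E).
  apply: le_integral_nonmeasurable => p; first by rewrite lee_fin sqr_ge0.
  rewrite /plane_ball /mkset; set z := plane p => z1.
  have part n : (\sum_(0 <= k < n) G k p <= \sum_(0 <= k <oo) G k p)%E.
    by apply: nneseries_lim_ge => k _ _; exact: G0.
  have X0 : (0 <= \sum_(0 <= k <oo) G k p)%E by apply: nneseries_ge0 => k _ _; exact: G0.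
  move: part X0; case: (\sum_(0 <= k <oo) G k p)%E => [x| |] // part X0; last by rewrite leey.
  rewrite lee_fin in X0 *.
  have px n : modulus (psum (U' z) n) ^+ 2 <= x.
    apply: le_trans (psum_sqr _ _) _; have := part n; rewrite big_mkord /G sumEFin lee_fin.
    by apply.
  rewrite -[x]sqr_sqrtr//; apply: lerXn2r; rewrite ?nnegrE ?modulus_ge0 ?sqrtr_ge0//.
  rewrite leNgt; apply/negP => hx.
  have [|n _ hn] := geo_approx (e := modulus (log_outer' z) - Num.sqrt x) 0 (log_outer'_sum z1); first lra.
  have : modulus (psum (U' z) n) <= Num.sqrt x.
    by rewrite -[X in X <= _]ger0_norm ?modulus_ge0// -sqrtr_sqr; apply: ler_wsqrtr.
  by have := modulus_rev (log_outer' z) (psum (U' z) n); lra.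
rewrite integral_nneseries//; last exact: measurable_plane_ball.
apply: lime_le; first by apply: is_cvg_nneseries => k _ _; apply: integral_ge0 => p _; exact: G0.
apply: nearW => n.
have E1 k : (\int[area]_(p in plane_ball 1) G k p <= (discarea / 18 * half_pow k)%:E)%E.
  have hk := half_pow_gt0 (R := R) k.
  have c0 : 0 <= 2 / half_pow k * b k ^+ 2 by rewrite mulr_ge0 ?sqr_ge0// divr_ge0// ltW.
  have -> : (\int[area]_(p in plane_ball 1) G k p = (2 / half_pow k * b k ^+ 2)%:E *
      \int[area]_(p in plane_ball 1) (modulus (f' k (plane p)) ^+ 2)%:E)%E.
    rewrite -ge0_integralZl//.
    - apply: eq_integral => p _; rewrite /G /U' modulusM modulusR gtr0_norm// exprMn -EFinM.
      by rewrite mulrA.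
    - exact: measurable_plane_ball.
    - apply/measurable_EFinP; apply: (rcontC_measurable_disc (h := fun z => modulus (f' k z) ^+ 2)) => z _.
      by apply: rcontC_sqr; apply: rcontC_modulus; exact: f'_cont.
    - by move=> p _; rewrite lee_fin sqr_ge0.
  rewrite f_area -EFinM lee_fin.
  have -> : 2 / half_pow k * b k ^+ 2 * (discarea * Q k) = (2 * discarea / half_pow k) * (b k ^+ 2
    * Q k) by ring.
  have A0 := @discarea_ge1 R.
  have c1 : 0 <= 2 * discarea / half_pow k by rewrite divr_ge0 ?(ltW hk)//; lra.
  apply: le_trans (ler_wpM2l c1 (bQ k)) _.
  by rewrite le_eqVlt; apply/orP; left; apply/eqP; field; rewrite gt_eqF.
apply: le_trans (lee_sum _ (fun k _ => E1 k)) _.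
rewrite sumEFin lee_fin -mulr_sumr big_mkord half_pow_sum.
by have := half_pow_gt0 (R := R) n; have := @discarea_ge1 R; nra.
Qed.

Let g z : C := cexp (log_outer z).

Lemma g_re z : modulus z <= 1 -> ~ E z -> modulus (g z) / 2 <= cre (g z) /\ 0 < cre (g z).
Proof.
move=> z1 nE; rewrite /g modulus_cexp cre_cexp.
have := cos_ge_half (log_outer_im z1 nE); have := expR_gt0 (cre (log_outer z)).
by move: (expR _) (cos _) => a c a0 c0; split; nra.
Qed.

(** Near [E] the real part of [log_outer] tends to infinity and the Cayley transform to
    1, whence the value on [E]. *)
Definition phi z : C := if `[< E z >] then 1 else cayley (g z).

Lemma phiE z : ~ E z -> phi z = cayley (g z).
Proof. by move=> nE; rewrite /phi asboolF. Qed.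

Lemma phi_onE z : E z -> phi z = 1.
Proof. by move=> Ez; rewrite /phi asboolT. Qed.

Lemma phi_lt1 z : modulus z <= 1 -> ~ E z -> modulus (phi z) < 1.
Proof. by move=> z1 nE; rewrite phiE//; apply: cayley_lt1; have [] := g_re z1 nE. Qed.

Lemma phi_close z (T : R) : modulus z <= 1 -> ~ E z -> T <= cre (log_outer z) ->
  modulus (phi z - 1) <= 2 * expR (- T).
Proof.
move=> z1 nE TF; rewrite phiE//; have [_ g0] := g_re z1 nE.
apply: le_trans (cayley_near1 g0) _; rewrite /g modulus_cexp -expRN; apply: ler_wpM2l => //.
by rewrite ler_expR; lra.
Qed.

(** A lower bound for the real part of [log_outer] where that of [f k] is at least
    [Q k - 20]: the loss is 1 from [log_outer_re] and at most [20 / 6] from [b_le]. *)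
Definition level k : R := b k * Q k - 5.

Lemma phi_level z k : modulus z <= 1 -> Q k - 20 <= cre (f k z) ->
  modulus (phi z - 1) <= 2 * expR (- level k).
Proof.
move=> z1 zk; have [Ez|nE] := pselect (E z).
  by rewrite phi_onE// subrr modulus0 mulr_ge0// expR_ge0.
apply: phi_close => //; apply: le_trans (log_outer_re k z1 nE); rewrite /level.
have := b_le k; have := half_pow_le1 (R := R) k; have := b_gt0 k => b0 h1 h2.
have : b k * (Q k - 20) <= b k * cre (f k z) by apply: ler_wpM2l => //; exact: ltW.
by lra.
Qed.

Definition dphi z : C := RtoC 2 * (g z * log_outer' z) / (g z + 1) ^+ 2.

Lemma phi_cderiv z : modulus z < 1 -> cderiv phi z (dphi z).
Proof.
move=> z1; apply: (@cderiv_ext _ (fun w => cayley (g w)) _ _ _ (1 - modulus z)); first lra.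
  move=> w wz; rewrite phiE//; apply: disc_notE.
  by have := modulusD (w - z) z; rewrite subrK; lra.
apply: cayley_cderiv; last by have [] := g_re (ltW z1) (disc_notE z1).
exact: (cderiv_comp (log_outer_cderiv z1) (cderiv_cexp _)).
Qed.

Lemma phi0 : phi 0 = 0.
Proof.
rewrite phiE; last by apply: disc_notE; rewrite modulus0.
by rewrite /g log_outer0 cexp0 /cayley subrr mul0r.
Qed.

(** [log_outer] takes its values in a strip on which the modulus of the exponential is
    at most twice its real part. *)
Lemma phi_hyperbolic z : modulus z < 1 ->
  modulus (dphi z) ^+ 2 / (1 - modulus (phi z) ^+ 2) ^+ 2 <= modulus (log_outer' z) ^+ 2.
Proof.
move=> z1; have nE := disc_notE z1; have [g1 g0] := g_re (ltW z1) nE.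
rewrite phiE// cayley_modulus// /dphi.
rewrite modulusM (modulusM (RtoC 2)) (modulusM (g z)) modulusV modulusX modulusR ger0_norm//.
have P0 : 0 < modulus (g z + 1) by rewrite modulus_gt0 cayley_neq0.
have g2 := modulus_ge0 (g z).
move: (modulus (g z + 1)) (modulus (g z)) (cre (g z)) (modulus (log_outer' z)) P0 g1 g0 g2 => P a c
  d P0 g1 g0 g2.
have -> : (2 * (a * d) / P ^+ 2) ^+ 2 / (4 * c / P ^+ 2) ^+ 2 = (a / (2 * c)) ^+ 2 * d ^+ 2.
  by field; rewrite !gt_eqF.
apply: ler_piMl; first exact: sqr_ge0.
apply: exprn_ile1; first by rewrite divr_ge0// mulr_ge0// ltW.
by rewrite ler_pdivrMr ?mulr_gt0// mul1r; lra.
Qed.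

Lemma phi_hs : (hs_integral phi <= (discarea / 9)%:E)%E.
Proof.
apply: le_trans log_outer'_area; apply: le_integral_nonmeasurable => p.
  by rewrite lee_fin divr_ge0 ?sqr_ge0.
rewrite /plane_ball /mkset => p1; rewrite lee_fin (cderiv_derive1 (phi_cderiv p1)).
exact: phi_hyperbolic.
Qed.

(** At a point of [E], the [k]-th potential forces [phi] within [2 exp (- level k)] of
    1 in a neighbourhood, and the levels are unbounded. *)
Lemma phi_cont z (e : R) : modulus z <= 1 -> 0 < e -> exists2 d : R, 0 < d &
  forall w, modulus w <= 1 -> modulus (w - z) < d -> modulus (phi w - phi z) < e.
Proof.
move=> z1 e0; have [Ez|nE] := pselect (E z).
  pose k := (Num.truncn (2 / e)).+1.
  have [eta eta0 H] := f_near k; exists eta => // w w1 wz.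
  rewrite (phi_onE Ez); apply: le_lt_trans (phi_level w1 (H _ _ Ez w1 wz)) _.
  have h1 : 2 / e < level k by apply: lt_le_trans (b_large k); exact: truncnS_gt.
  have h2 := expR_ge1Dx (level k).
  rewrite expRN -ltr_pdivlMl// -[X in _ < X]invrK ltf_pV2 ?posrE ?expR_gt0//; last first.
    by rewrite invr_gt0 mulr_gt0// invr_gt0.
  by rewrite invfM invrK; lra.
have [_ g0] := g_re z1 nE.
have gc : ccont (fun w => cayley (cexp w)) (log_outer z).
  by apply: cderiv_ccont; apply: cayley_cderiv; [exact: cderiv_cexp|exact: g0].
have [d d0 D] := gc e e0; have [d' d'0 D'] := log_outer_cont z1 nE d0.
by exists d' => // w w1 /(D' w w1)[nEw /D]; rewrite !phiE.
Qed.

Lemma phi_disc_algebra : disc_algebra phi.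
Proof.
split; first by apply: cderiv_holo => z; exact: phi_cderiv.
apply/subspace_continuousP => z z1 A /nbhsCP[e e0 eA].
have [d d0 D] := phi_cont z1 e0.
apply/nbhsCP; exists d => // w wz w1; apply: eA; exact: D.
Qed.

(** Off [E] the exponential of [log_outer] lies in the open right half plane, so that
    [|phi| < 1]. *)
Lemma phi_level1 : level_set phi 1 = E.
Proof.
apply/seteqP; split=> z; last first.
  by move=> Ez; split; [exact: E_circle|rewrite phi_onE// modulus1].
move=> [zc h]; apply: contrapT => nE.
have z1 : modulus z <= 1 by rewrite (_ : modulus z = 1).
by have := phi_lt1 z1 nE; rewrite ltNge h.
Qed.

Lemma outer_function :
  [/\ disc_algebra phi /\ dirichlet_space phi,
      forall z, disc z -> disc (phi z),
      level_set phi 1 = E,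
      hilbert_schmidt (composition_operator phi) &
      forall k z, modulus z <= 1 -> Q k - 20 <= cre (f k z) ->
        modulus (phi z - 1) <= 2 * expR (- level k)].
Proof.
have ph : holomorphic phi by case: phi_disc_algebra.
have pd z : modulus z < 1 -> modulus (phi z) < 1.
  by move=> z1; apply: phi_lt1; [exact: ltW|exact: disc_notE].
split.
- by split; [exact: phi_disc_algebra|exact: (self_map_dirichlet ph pd phi_hs)].
- exact: pd.
- exact: phi_level1.
- exact: (composition_hilbert_schmidt ph pd phi0 phi_hs).
- by move=> k z; exact: phi_level.
Qed.

End OuterFunction.

(** * Capacities of level sets *)

Section CapacityBounds.
Context {R : realType}.
Local Notation C := (Cplx R).
Local Notation mu := (@lebesgue_measure R).
Implicit Types (A : set C) (P : probability (@borelC R) R).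

Lemma energy_ge0 P : (0 <= energy P)%E.
Proof. by apply: nneseries_ge0 => n _ _; rewrite lee_fin divr_ge0 ?sqr_ge0. Qed.

Lemma energy_inf_ge0 A :
  (0 <= ereal_inf [set energy mu | mu in [set mu : probability (@borelC R) R | mu A = 1%E]])%E.
Proof. by apply: le_ereal_inf_tmp => _ [P _ <-]; exact: energy_ge0. Qed.

Lemma capacity_ge0 A : (0 <= capacity A)%E.
Proof. by rewrite inve_ge0; exact: energy_inf_ge0. Qed.

Lemma capacity_ge A P (c : R) : 0 < c -> P A = 1%E -> (energy P <= c%:E)%E ->
  ((c^-1)%:E <= capacity A)%E.
Proof.
move=> c0 PA Pc; rewrite /capacity.
have <- : (c%:E^-1 = (c^-1)%:E)%E by rewrite inver gt_eqF.
rewrite lee_pV2 ?inE ?energy_inf_ge0 ?lee_fin ?(ltW c0)//.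
by apply: le_trans Pc; apply: ereal_inf_lbound; exists P.
Qed.

Lemma near_pinfty_bound (h : R -> R) (H : R) : h x @[x --> +oo] --> +oo ->
  exists2 X : R, 0 <= X & forall x, X <= x -> H <= h x.
Proof.
move=> /cvgryPge /(_ H)[X [_ HX]]; exists (Num.max 0 (X + 1)); first by rewrite le_max lexx.
by move=> x; rewrite ge_max => /andP[_ h1]; apply: HX; lra.
Qed.

Lemma cont_inv1B (al be : R) : be < 1 -> cont_on al be (fun s => (1 - s)^-1).
Proof.
move=> b1 s /andP[s1 s2]; apply: (@continuous_comp R R R (fun s => 1 - s) GRing.inv).
  apply: (@lipschitz_cont R 1) => // x y.
  by rewrite mul1r (_ : 1 - x - (1 - y) = y - x) 1?distrC//; ring.
by apply: inv_continuous; rewrite gt_eqF; lra.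
Qed.

Lemma integral_inv1B (al be : R) : al < be -> be < 1 ->
  (\int[mu]_(s in `[al, be]) ((1 - s)^-1)%:E = (ln (1 - al) - ln (1 - be))%:E)%E.
Proof.
move=> ab b1.
have D (s : R) : al <= s <= be -> is_derive s 1 (fun s => - ln (1 - s)) ((1 - s)^-1).
  move=> /andP[s1 s2]; have s0 : 0 < 1 - s by lra.
  have Dl : is_derive s 1 (fun s : R => 1 - s) (-1).
    apply/is_derive_epsP => e e0; exists 1 => // h _.
    rewrite (_ : _ - _ = 0); last by ring.
    by rewrite normr0 mulr_ge0// ltW.
  have h := is_deriveN (@is_derive1_comp R (@ln R) (fun s => 1 - s) s _ _ (is_derive1_ln s0) Dl).
  by apply: (is_derive_eq h); rewrite mulrN1 opprK.
have cc := @cont_inv1B al be b1.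
by rewrite (int_cont cc) (RI_FTC_on ab cc D); congr (_%:E); ring.
Qed.

(** Integrate from [1 - 2 exp (- T / 2)] to [1 - 2 exp (- T)]: there the capacity is at
    least [1 / q], the logarithm at least [T / 4] and [h] at least [H], while
    [1 / (1 - s)] integrates to [T / 2]. *)
Lemma capacity_integral_ge (phi : C -> C) (h : R -> R) (a T q H : R) :
  (forall x : R, 1 <= x -> 1 <= h x) -> 0 < a < 1 -> 4 <= T -> 4 / (1 - a) < T -> 0 < q -> 0 <= H ->
  (forall x, expR (T / 2) / 2 <= x -> H <= h x) ->
  (forall s, s <= 1 - 2 * expR (- T) -> ((q^-1)%:E <= capacity (level_set phi s))%E) ->
  ((H * T ^+ 2 / (8 * q))%:E <= \int[mu]_(s in `]a, 1%R[)
     (capacity (level_set phi s) * ((1 - s)^-1 * ln ((1 - s)^-1) * h ((1 - s)^-1))%:E))%E.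
Proof.
move=> h1 /andP[a0 a1] T4 Ta q0 H0 hH hcap.
have T0 : 0 < T by lra.
pose al := 1 - 2 * expR (- (T / 2)); pose be := 1 - 2 * expR (- T).
have E1 := expR_gt0 (- T); have E2 := expR_gt0 (- (T / 2)).
have E3 : expR (- T) < expR (- (T / 2)) by rewrite ltr_expR; lra.
have E4 : expR (- (T / 2)) * expR (T / 2) = 1 by rewrite -expRD addNr expR0.
have E5 := expR_ge1Dx (T / 2); have E6 := expR_gt0 (T / 2).
have ab : al < be by rewrite /al /be; lra.
have b1 : be < 1 by rewrite /be; lra.
have aal : a < al.
  have h2 : 4 < T * (1 - a) by rewrite -ltr_pdivrMr; lra.
  have h3 : 2 < expR (T / 2) * (1 - a).
    have : (1 + T / 2) * (1 - a) <= expR (T / 2) * (1 - a) by apply: ler_wpM2r => //; lra.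
    by lra.
  suff : 2 * expR (- (T / 2)) < 1 - a by rewrite /al; lra.
  rewrite -(ltr_pM2r E6) -mulrA E4 mulr1 mulrC mulrC.
  by rewrite [X in _ < X]mulrC.
pose K := q^-1 * (T / 4) * H.
have K0 : 0 <= K by rewrite !mulr_ge0 ?invr_ge0//; lra.
have -> : ((H * T ^+ 2 / (8 * q))%:E = \int[mu]_(s in `[al, be]) (K * (1 - s)^-1)%:E)%E.
  under eq_integral do rewrite EFinM.
  rewrite ge0_integralZl//; last 2 first.
  - exact: (measurable_int mu (cont_on_integrable (@cont_inv1B al be b1))).
  - by move=> s; rewrite /= in_itv/= => /andP[s1 s2]; rewrite lee_fin invr_ge0; lra.
  rewrite integral_inv1B// -EFinM /al /be !opprB !(addrC 1) !subrK.
  rewrite !lnM ?posrE// !expRK /K; congr (_%:E).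
  by field; rewrite gt_eqF.
rewrite [X in (X <= _)%E]integral_mkcond [X in (_ <= X)%E]integral_mkcond.
have pos s : a < s < 1 -> 1 <= (1 - s)^-1.
  by move=> /andP[s1 s2]; rewrite invf_ge1; lra.
have F0 s : `]a, 1%R[%classic s -> (0 <= capacity (level_set phi s) *
    ((1 - s)^-1 * ln ((1 - s)^-1) * h ((1 - s)^-1))%:E)%E.
  rewrite /= in_itv/= => /pos s1; rewrite mule_ge0 ?capacity_ge0// lee_fin.
  by rewrite !mulr_ge0 ?ln_ge0//; have := h1 _ s1; lra.
apply: le_integral_nonmeasurable => s _.
  rewrite patchE; case: ifPn => //; rewrite inE /= in_itv/= => /andP[s1 s2].
  by rewrite lee_fin mulr_ge0// invr_ge0; lra.
rewrite !patchE; case: ifPn => [|_]; last first.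
  by case: ifPn => //; rewrite inE; exact: F0.
rewrite inE /= in_itv/= => /andP[s1 s2].
have sa : a < s < 1 by apply/andP; split; lra.
rewrite mem_set ?in_itv//=.
set y := (1 - s)^-1; have y1 : 1 <= y := pos s sa.
have ylow : expR (T / 2) / 2 <= y.
  rewrite /y -[X in X <= _]invrK lef_pV2 ?posrE ?invr_gt0 ?divr_gt0//; last by lra.
  rewrite invfM invrK -expRN mulrC.
  by move: s1; rewrite /al; lra.
(* [exp (T / 4) <= exp (T / 2) / 2], because [2 <= exp (T / 4)] for [4 <= T]. *)
have lny : T / 4 <= ln y.
  rewrite -[X in X <= _]expRK ler_ln ?posrE ?expR_gt0//; last by lra.
  apply: le_trans ylow.
  have E7 := expR_ge1Dx (T / 4); have -> : expR (T / 2) = expR (T / 4) * expR (T / 4).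
    by rewrite -expRD; congr expR; lra.
  by nra.
have hy := hH _ ylow.
apply: (@le_trans _ _ ((q^-1)%:E * (y * ln y * h y)%:E)%E).
  rewrite -EFinM lee_fin /K.
  have -> : q^-1 * (T / 4) * H * y = q^-1 * (y * (T / 4 * H)) by ring.
  apply: ler_wpM2l; first by rewrite invr_ge0 ltW.
  rewrite -[X in _ <= X]mulrA; apply: ler_wpM2l; first by lra.
  by apply: ler_pM => //; lra.
apply: lee_wpmul2r; first by rewrite lee_fin !mulr_ge0; lra.
by apply: hcap; exact: s2.
Qed.

End CapacityBounds.

Section Construction.
Context {R : realType}.
Local Notation C := (Cplx R).
Local Notation half_pow := (@half_pow R).

(** The weight [b = half_pow k / (6 sqrt Q)] keeps the Dirichlet integrals [b^2 Q]
    summable, while [b Q], proportional to [sqrt Q], can be made as large as the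
    growth of [h] demands. *)
Lemma block_choice (h : R -> R) (E : set C) : h x @[x --> +oo] --> +oo ->
  closed E -> E `<=` circle -> E !=set0 -> capacity E = 0%E ->
  forall k : nat, exists s : seq C, exists b : R,
  [/\ [/\ s != [::], on_circle s & {in s, forall x, exists2 e, E e & modulus (x - e) <= half_pow k}],
      [/\ 0 < b, b <= half_pow k / 6 & b ^+ 2 * truncated_energy s = half_pow k ^+ 2 / 36],
      [/\ 1 <= truncated_energy s, 10 <= b * truncated_energy s - 5, k%:R <= b * truncated_energy s - 5 &
        forall x, expR ((b * truncated_energy s - 5) / 2) / 2 <= x -> 48 * 144 * k%:R / half_pow k
          ^+ 2 <= h x],
      (exists2 eta : R, 0 < eta & forall e z, E e -> modulus z <= 1 -> modulus (z - e) < eta ->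
        truncated_energy s - 20 <= cre (pot s z)) &
      exists2 P : probability (@borelC R) R, (energy P <= (6 * truncated_energy s)%:E)%E &
        forall A : set C, (forall z, modulus z = 1 -> truncated_energy s - 20 <= cre (pot s z) -> A z) ->
          P A = 1%E].
Proof.
move=> hh cE EC E0 Ecap k; have h0 := half_pow_gt0 (R := R) k.
have [X X0 HX] := near_pinfty_bound (48 * 144 * k%:R / half_pow k ^+ 2) hh.
(* [15] yields [10 <= b Q - 5], and [4 X] yields [X <= exp ((b Q - 5) / 2) / 2] through
   the tangent of the exponential at 0. *)
pose Y : R := k%:R + 15 + 4 * X; have Y0 : 0 <= Y.
  by have : 0 <= k%:R :> R by []; rewrite /Y; lra.
have [s [[s0 sc] sE sM sN sP]] := block cE EC E0 Ecap (Num.max 1 ((6 * Y / half_pow k) ^+ 2)) h0.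
move: sM; rewrite ge_max => /andP[Q1 QY]; set Q := truncated_energy s in Q1 QY *.
pose r := Num.sqrt Q; have r2 : r ^+ 2 = Q by rewrite sqr_sqrtr//; lra.
have r1 : 1 <= r by rewrite -[1]sqrtr1 ler_wsqrtr.
have rY : 6 * Y / half_pow k <= r.
  by rewrite -[X in X <= _]ger0_norm ?divr_ge0 ?mulr_ge0 ?(ltW h0)// -sqrtr_sqr ler_wsqrtr.
have r0 : 0 < r by lra.
pose b := half_pow k / (6 * r).
have bQ : b * Q = half_pow k * r / 6 by rewrite -r2 /b; field; rewrite gt_eqF.
have bY : Y <= b * Q.
  rewrite bQ; move: rY; rewrite ler_pdivrMr// => rY; lra.
exists s, b; split => //; split => //.
- by rewrite divr_gt0// mulr_gt0.
- rewrite /b invfM mulrA; apply: ler_piMr; first by rewrite divr_ge0// ltW.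
  by rewrite invf_le1.
- by rewrite -/Q -r2 /b; field; rewrite gt_eqF.
- by have : 0 <= k%:R :> R by []; rewrite -/Q; move: bY; rewrite /Y; lra.
- by rewrite -/Q; move: bY; rewrite /Y; lra.
- move=> x hx; apply: HX; apply: le_trans hx.
  have := expR_ge1Dx ((b * Q - 5) / 2); have : 0 <= k%:R :> R by [].
  by move: bY; rewrite /Y; lra.
Qed.

Lemma growth_ge0 (k : nat) (x : R) : 0 <= 48 * 144 * k%:R / x ^+ 2.
Proof. by rewrite divr_ge0 ?sqr_ge0// !mulr_ge0// ler0n. Qed.

(** Since [(b Q)^2 / Q = hk^2 / 36] and [b Q <= 2 (b Q - 5)], the constant is the product
    of the factors 8 and 6 of the denominator with [36 * 2^2]. *)
Lemma block_contribution (k hk Q b : R) : 0 <= k -> 0 < hk -> 0 < Q -> 0 < b ->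
  b ^+ 2 * Q = hk ^+ 2 / 36 -> 10 <= b * Q - 5 ->
  k <= 48 * 144 * k / hk ^+ 2 * (b * Q - 5) ^+ 2 / (8 * (6 * Q)).
Proof.
move=> k0 h0 Q0 b0 bQ T10; set T := b * Q - 5 in T10 *.
have -> : 48 * 144 * k / hk ^+ 2 * T ^+ 2 / (8 * (6 * Q)) = k * (144 * T ^+ 2 / (hk ^+ 2 * Q)).
  by field; rewrite !gt_eqF.
apply: ler_peMr => //.
rewrite ler_pdivlMr ?mul1r ?mulr_gt0 ?exprn_gt0//.
have e : hk ^+ 2 = 36 * (b ^+ 2 * Q) by rewrite bQ; lra.
have bQ0 : b * Q <= 2 * T by rewrite /T in T10 *; lra.
have bQp : 0 <= b * Q by rewrite mulr_ge0// ltW.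
have : (b * Q) ^+ 2 <= (2 * T) ^+ 2.
  by apply: lerXn2r; rewrite ?nnegrE//; lra.
rewrite e !exprMn (_ : Q ^+ 2 = Q * Q) ?expr2// => h.
by rewrite -!mulrA -!expr2 in h *; lra.
Qed.

End Construction.

Theorem theorem3p6 (R : realType) (h : R -> R)
  (h_ge1 : forall x : R, 1 <= x -> 1 <= h x)
  (h_cvg : h x @[x --> +oo] --> +oo)
  (E : set (Cplx R)) (E_closed : closed E) (E_circle : E `<=` circle)
  (E_nonempty : E !=set0) (E_cap : capacity E = 0%E) :
  exists phi : Cplx R -> Cplx R,
    [/\ disc_algebra phi /\ dirichlet_space phi,
        forall z, disc z -> disc (phi z),
        level_set phi 1 = E,
        hilbert_schmidt (composition_operator phi)
      & forall a : R, 0 < a < 1 ->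
          (\int[lebesgue_measure]_(s in `]a, 1%R[)
             (capacity (level_set phi s) *
              ((1 - s)^-1 * ln ((1 - s)^-1) * h ((1 - s)^-1))%:E) = +oo)%E].
Proof.
have [s Hs] := choice (block_choice h_cvg E_closed E_circle E_nonempty E_cap).
have [b Hb] := choice Hs.
pose f k := pot (s k); pose f' k := pot' (s k); pose Q k : R := truncated_energy (s k).
have s0 k : s k != [::] by have [[]] := Hb k.
have sc k : on_circle (s k) by have [[]] := Hb k.
have f_far k z (d : R) : modulus z <= 1 -> 0 < d ->
    (forall e, E e -> d + half_pow k <= modulus (z - e)) -> modulus (f k z) <= 2 / d.
  move=> z1 d0 H; apply: pot_far => // x xs; have [[_ _ /(_ x xs)[e Ee xe]] _ _ _ _] := Hb k.
  by have := H _ Ee; have := modulus_triangle z x e; lra.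
have f_near k : exists2 eta : R, 0 < eta & forall e z, E e -> modulus z <= 1 ->
    modulus (z - e) < eta -> Q k - 20 <= cre (f k z).
  by have [_ _ _ + _] := Hb k.
have b_gt0 k : 0 < b k by have [_ [+ _ _] _ _ _] := Hb k.
have b_le k : b k <= half_pow k / 6 by have [_ [_ + _] _ _ _] := Hb k.
have bQ k : b k ^+ 2 * Q k = half_pow k ^+ 2 / 36 by have [_ [_ _ +] _ _ _] := Hb k.
have bQ' k : b k ^+ 2 * Q k <= half_pow k ^+ 2 / 36 by rewrite bQ.
have b_large k : k%:R <= b k * Q k - 5 by have [_ _ [_ _ + _] _ _] := Hb k.
have fac := @outer_function R E E_closed E_circle f f' (fun k => (size (s k))%:R) Q b
  (fun k => ler0n _ _) (fun k => pot0 (s k)) (fun k => @pot_lip R (s k) (s0 k) (sc k))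
  (fun k => @pot_im R (s k) (s0 k) (sc k)) (fun k => @pot_re R (s k) (s0 k) (sc k)) f_far
  (fun k => @pot_quad R (s k) (s0 k) (sc k)) (fun k => @pot'_le R (s k) (s0 k) (sc k))
  (fun k => @pot'_ccont R (s k)) (fun k => @pot_area R (s k)) f_near b_gt0 b_le bQ' b_large.
have [A1 A2 A3 A4 A5] := fac; exists (phi E f b); split => // a a01.
have a1 : 0 < 1 - a by lra.
apply: eq_infty => r.
(* Every block of large index contributes at least its index, over an interval that
   approaches 1. *)
pose k := (maxn (Num.truncn r).+1 (Num.truncn (4 / (1 - a))).+1).
have kr : r <= k%:R.
  by apply/ltW; apply: lt_le_trans (truncnS_gt r) _; rewrite ler_nat leq_maxl.
have ka : 4 / (1 - a) < k%:R.
  by apply: lt_le_trans (truncnS_gt _) _; rewrite ler_nat leq_maxr.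
have [_ _ [Q1 T10 kT hH] _ [P Pe PA]] := Hb k.
rewrite -/(Q k) in Q1 T10 kT hH Pe PA.
have h0 := half_pow_gt0 (R := R) k; pose T := b k * Q k - 5.
have Q0 : 0 < Q k := lt_le_trans ltr01 Q1.
apply: le_trans (@capacity_integral_ge R (phi E f b) h a T (6 * Q k) (48 * 144 * k%:R / half_pow k ^+ 2)
  h_ge1 a01 _ _ _ _ hH _).
- rewrite lee_fin; apply: le_trans kr _.
  exact: (block_contribution (ler0n R k) h0 Q0 (b_gt0 k) (bQ k) T10).
- by apply: le_trans T10; rewrite ler_nat.
- exact: lt_le_trans ka kT.
- exact: mulr_gt0.
- exact: growth_ge0.
move=> t tT; have Q6 : 0 < 6 * Q k by exact: mulr_gt0.
refine (capacity_ge Q6 (PA _ _) Pe) => z zc zk; split; first exact: zc.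
have z1 : modulus z <= 1 by rewrite zc.
have h5 := A5 k z z1 zk; have := modulus_rev 1 (phi E f b z); rewrite modulus1 modulus_distC.
move=> h6; apply: le_trans tT _; rewrite lerBlDr -lerBlDl.
exact: le_trans h6 h5.
Qed.
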